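(* Let $\alpha,\beta\in(0,2\wedge d)$, let $U,V:\mathbb{R}^d\to(0,\infty)$ be measurable, and let $p_1,q_2>0$, $p_2,q_1\ge0$. Consider the problem $$(-\Delta)^{\alpha/2}u\ge U(x)u^{p_1}v^{p_2}\ \text{ in }\mathbb{R}^d,\qquad (-\Delta)^{\beta/2}v\ge V(x)u^{q_1}v^{q_2}\ \text{ in }\mathbb{R}^d,\qquad u,v\ge0\ \text{ in }\mathbb{R}^d.$$ This problem has only trivial (classical) solutions (i.e. either $u=0$ or $v=0$ in $\mathbb{R}^d$) if one of the following holds. (i) $(p_1+q_1)\wedge(p_2+q_2)\ge1$ and $$\liminf_{r\to\infty}\frac{r^{(p_1+p_2+q_1+q_2)d}}{r^{\alpha(p_1+q_1)}r^{\beta(p_2+q_2)}}\frac{1}{\Phi_U(r)\Phi_V(r)}=0.$$ (ii) $q_2<1$ and one of the following holds: (a) $(p_1-1)(1-q_2)+p_2q_1<0$ and $$\limsup_{r\to\infty}\frac{\Phi_U^{1-q_2}(r)}{r^{(d-\alpha)(1-q_2)}}\frac{\Phi_V^{p_2}(r)}{r^{(d-\beta)p_2}}=\infty;$$ (b) $(p_1-1)(1-q_2)+p_2q_1\ge0$ and $$\limsup_{r\to\infty}\frac{\Phi_V^{p_2}(r)\,\Phi_U^{1-q_2}(r)}{r^{(d-\beta)p_2}}\frac{1}{r^{(d-\alpha)(p_2q_1+p_1(1-q_2))}}=\infty.$$ (iii) $p_1<1$ and one of the following holds: (a) $(1-p_1)(q_2-1)+p_2q_1<0$ and $$\limsup_{r\to\infty}\frac{\Phi_U^{q_1}(r)}{r^{(d-\alpha)q_1}}\frac{\Phi_V^{1-p_1}(r)}{r^{(d-\beta)(1-p_1)}}=\infty;$$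 (b) $(1-p_1)(q_2-1)+p_2q_1\ge0$ and $$\limsup_{r\to\infty}\frac{\Phi_U^{q_1}(r)\,\Phi_V^{1-p_1}(r)}{r^{(d-\alpha)q_1}}\frac{1}{r^{(d-\beta)(p_2q_1+q_2(1-p_1))}}=\infty.$$ (iv) $(p_1+q_1)\vee(p_2+q_2)\le1$ and $$\liminf_{r\to\infty}\frac{r^{d-\alpha}}{\Phi_U(r)}\cdot\frac{r^{d-\beta}}{\Phi_V(r)}=0.$$
   Context: $d\ge1$; $a\wedge b=\min\{a,b\}$, $a\vee b=\max\{a,b\}$; $B(x,r)$ is the ball of radius $r$ centered at $x$. For $\alpha\in(0,2)$, $(-\Delta)^{\alpha/2}u(x)=c_{d,\alpha}\,\mathrm{P.V.}\int_{\mathbb{R}^d}\frac{u(x)-u(y)}{|x-y|^{d+\alpha}}\,dy$ is the fractional Laplacian, with the usual normalizing constant $c_{d,\alpha}>0$. For $U,V:\mathbb{R}^d\to(0,\infty)$ define $$\Phi_U(r)=\inf_{\frac r2\le|x|\le\frac{3r}2}\int_{B(x,r/4)}U(y)\,dy,\qquad \Phi_V(r)=\inf_{\frac r2\le|x|\le\frac{3r}2}\int_{B(x,r/4)}V(y)\,dy,$$ and write $\Phi_U^{a}(r)=(\Phi_U(r))^a$, and similarly for $V$. Solutions (super-solutions) are classical: $u\in\mathcal{C}^{\alpha+}(\mathbb{R}^d)\cap L^1(\mathbb{R}^d,\omega_\alpha)$ and $v\in\mathcal{C}^{\beta+}(\mathbb{R}^d)\cap L^1(\mathbb{R}^d,\omega_\beta)$,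 both continuous, with the inequalities holding pointwise. Here $h\in\mathcal{C}^{\alpha+}(D)$ means that for every compact $K\Subset D$ there is $\gamma>0$ with $h\in\mathcal{C}^{\alpha+\gamma}(K)$, and $L^1(\mathbb{R}^d,\omega_\alpha)$ is the class of functions integrable with respect to the weight $\omega_\alpha(x)=\frac{1}{1+|x|^{d+\alpha}}$. *)

(* Defs.v *)
From HB Require Import structures.
From mathcomp Require Import all_boot all_order all_algebra.
From mathcomp Require Import all_classical all_reals all_analysis.
From mathcomp Require Import measurable_realfun.

Set Implicit Arguments.
Unset Strict Implicit.
Unset Printing Implicit Defensive.

Import Order.TTheory GRing.Theory Num.Theory.
Import numFieldNormedType.Exports.

Local Open Scope classical_set_scope.
Local Open Scope ring_scope.

Definition rV_display : measure_display.
Proof. exact: default_measure_display. Qed.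

Section rV_measurable.
Context {R : realType} {n : nat}.

Definition rV_coord (i : 'I_n) (x : 'rV[R]_n) : measurableTypeR R := x ord0 i.

Let rV_set0 : g_sigma_preimage rV_coord set0.
Proof. exact: sigma_algebra0. Qed.

Let rV_setC A : g_sigma_preimage rV_coord A -> g_sigma_preimage rV_coord (~` A).
Proof. exact: sigma_algebraC. Qed.

Let rV_bigcup (F : _^nat) : (forall i, g_sigma_preimage rV_coord (F i)) ->
  g_sigma_preimage rV_coord (\bigcup_i (F i)).
Proof. exact: sigma_algebra_bigcup. Qed.

(* The Borel sigma-algebra of R^n, as the product sigma-algebra. *)
HB.instance Definition _ := @isMeasurable.Build rV_display
  'rV[R]_n (g_sigma_preimage rV_coord) rV_set0 rV_setC rV_bigcup.

Lemma measurable_rV_coord (i : 'I_n) : measurable_fun [set: 'rV[R]_n] (rV_coord i).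
Proof.
move=> _ Y mY; rewrite setTI; apply: sub_sigma_algebra => /=.
rewrite -bigcup_seq/=; exists i => /=; first by rewrite mem_index_enum.
by exists Y => //; rewrite setTI.
Qed.

Lemma measurable_fun_rV d (T : measurableType d) (f : T -> 'rV[R]_n) :
  (forall i, measurable_fun [set: T] (rV_coord i \o f)) ->
  measurable_fun [set: T] f.
Proof.
pose G := \big[setU/set0]_(i < n) preimage_set_system setT (rV_coord i)
  measurable.
move=> mf; apply: (@measurability d rV_display T 'rV[R]_n setT f G); first by [].
move=> _ [B GB <-]; move: GB; rewrite /G -bigcup_seq => -[i _ [A mA <-]].
by rewrite !setTI; have := mf i measurableT A mA; rewrite setTI.
Qed.

End rV_measurable.

Section lebesgue_rV.
Context {R : realType}.

Definition rV_cons n (p : measurableTypeR R * 'rV[R]_n) : 'rV[R]_n.+1 :=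
  row_mx (p.1)%:M p.2.

Lemma rV_cons0 n (p : measurableTypeR R * 'rV[R]_n) : rV_cons p ord0 ord0 = p.1.
Proof.
rewrite /rV_cons (_ : ord0 = lshift n (ord0 : 'I_1)); last exact: val_inj.
by rewrite (row_mxEl (p.1)%:M p.2) mxE eqxx.
Qed.

Lemma rV_consS n (p : measurableTypeR R * 'rV[R]_n) (i : 'I_n) :
  rV_cons p ord0 (lift ord0 i) = p.2 ord0 i.
Proof.
rewrite /rV_cons (_ : lift ord0 i = rshift 1 i); last exact: val_inj.
by rewrite (row_mxEr (p.1)%:M p.2).
Qed.

Lemma measurable_rV_cons n :
  measurable_fun [set: measurableTypeR R * 'rV[R]_n] (@rV_cons n).
Proof.
apply: measurable_fun_rV => i.
have [->|] := eqVneq i ord0.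
  rewrite (_ : _ \o _ = fst)//; apply/funext => p /=; exact: rV_cons0.
rewrite eq_sym => /unlift_some[j -> _].
rewrite (_ : _ \o _ = rV_coord j \o snd); last first.
  by apply/funext => p /=; exact: rV_consS.
by apply: measurableT_comp => //; exact: measurable_rV_coord.
Qed.

Definition rV_uncons n (x : 'rV[R]_n.+1) : measurableTypeR R * 'rV[R]_n :=
  (x ord0 ord0, \row_i x ord0 (lift ord0 i)).

Lemma rV_consK n : cancel (@rV_cons n) (@rV_uncons n).
Proof.
move=> p; rewrite /rV_uncons rV_cons0 [RHS]surjective_pairing; congr pair.
by apply/rowP => i; rewrite mxE rV_consS.
Qed.

Lemma measurable_rV_uncons n : measurable_fun [set: 'rV[R]_n.+1] (@rV_uncons n).
Proof.
apply: measurable_fun_pair; first exact: (measurable_rV_coord ord0).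
apply: measurable_fun_rV => i.
rewrite (_ : _ \o _ = rV_coord (lift ord0 i)); first exact: measurable_rV_coord.
by apply/funext => x; rewrite /rV_coord /= mxE.
Qed.

Section lebesgue_rV_step.
Variables (n : nat) (mu : {sigma_finite_measure set 'rV[R]_n -> \bar R}).

Definition lebesgue_rV_step : set 'rV[R]_n.+1 -> \bar R :=
  pushforward (@lebesgue_measure R \x mu)%E (@rV_cons n).

Let step0 : lebesgue_rV_step set0 = 0%E.
Proof. apply: measure0; exact: measurable_rV_cons. Qed.

Let step_ge0 A : (0 <= lebesgue_rV_step A)%E.
Proof. apply: measure_ge0; exact: measurable_rV_cons. Qed.

Let step_sigma_additive : semi_sigma_additive lebesgue_rV_step.
Proof. apply: measure_semi_sigma_additive; exact: measurable_rV_cons. Qed.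

HB.instance Definition _ := isMeasure.Build _ _ _ lebesgue_rV_step
  step0 step_ge0 step_sigma_additive.

Let lebesgue_rV_step_sigma_finite : sigma_finite setT lebesgue_rV_step.
Proof.
have /sigma_finiteP[F [TF ndF Foo]] := sigma_finiteT (@lebesgue_measure R).
have /sigma_finiteP[G [TG ndG Goo]] := sigma_finiteT mu.
exists (fun k => @rV_uncons n @^-1` (F k `*` G k)).
  rewrite -preimage_bigcup (_ : \bigcup_i _ = setT) ?preimage_setT//.
  rewrite -subTset => -[x y] _.
  have [i _ Fix] : (\bigcup_i F i) x by rewrite -TF.
  have [j _ Gjy] : (\bigcup_i G i) y by rewrite -TG.
  exists (maxn i j) => //; split => /=.
  - by move: x Fix; exact/subsetPset/ndF/leq_maxl.
  - by move: y Gjy; exact/subsetPset/ndG/leq_maxr.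
move=> k; have [mF Fk] := Foo k; have [mG Gk] := Goo k; split.
  rewrite -[X in measurable X]setTI; apply: measurable_rV_uncons => //.
  exact: measurableX.
rewrite /lebesgue_rV_step /pushforward (_ : _ @^-1` _ = F k `*` G k); last first.
  by rewrite -comp_preimage (_ : _ \o _ = id) ?preimage_id//; apply/funext/rV_consK.
by rewrite product_measure1E// lte_mul_pinfty// ge0_fin_numE.
Qed.

HB.instance Definition _ := Measure_isSigmaFinite.Build _ _ _ lebesgue_rV_step
  lebesgue_rV_step_sigma_finite.

End lebesgue_rV_step.

Fixpoint lebesgue_rV n : {sigma_finite_measure set 'rV[R]_n -> \bar R} :=
  if n is m.+1 then lebesgue_rV_step (lebesgue_rV m)
  else @dirac _ 'rV[R]_0 0 R.

Lemma lebesgue_rV_box n (A : 'I_n -> set (measurableTypeR R)) :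
  (forall i, measurable (A i)) ->
  lebesgue_rV n [set x | forall i, A i (x ord0 i)] =
  (\prod_(i < n) lebesgue_measure (A i))%E.
Proof.
elim: n A => [|n IH] A mA.
  by rewrite big_ord0 /= diracE mem_set//= => -[].
have mB : measurable [set x : 'rV[R]_n | forall i, A (lift ord0 i) (x ord0 i)].
  suff -> : [set x : 'rV[R]_n | forall i, A (lift ord0 i) (x ord0 i)] =
      \bigcap_(i in [set: 'I_n]) (rV_coord i @^-1` A (lift ord0 i)).
    apply: fin_bigcap_measurable => // i _.
    by rewrite -[X in measurable X]setTI; exact: measurable_rV_coord.
  by apply/seteqP; split => x /= xA i; [move=> _|]; exact: xA.
rewrite big_ord_recl /= /lebesgue_rV_step /pushforward.
rewrite -(IH (fun i => A (lift ord0 i)))// -product_measure1E//.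
congr (product_measure1 _ _ _); apply/seteqP; split => p /=.
  move=> pA; split; first by have := pA ord0; rewrite rV_cons0.
  by move=> i; have := pA (lift ord0 i); rewrite rV_consS.
move=> [p1 p2] i; have [->|] := eqVneq i ord0; first by rewrite rV_cons0.
by rewrite eq_sym => /unlift_some[j -> _]; rewrite rV_consS.
Qed.

End lebesgue_rV.

Section euclidean.
Context {R : realType} {d : nat}.
Implicit Types (x y : 'rV[R]_d) (r : R) (f U : 'rV[R]_d -> R).

(* The library norm on 'rV[R]_d is the sup norm. *)
Definition enorm x : R := Num.sqrt (\sum_(i < d) x ord0 i ^+ 2).

Definition eball x r : set 'rV[R]_d := [set y | enorm (x - y) < r].

Let mu := @lebesgue_rV R d.

(* Lebesgue (not only Borel) measurability: the domain carries the completed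
   sigma-algebra. The library integral of a nonnegative function is a supremum
   over Borel simple functions below it, which for a Lebesgue measurable
   integrand is its Lebesgue integral. *)
Definition lebesgue_measurable_fun f : Prop :=
  measurable_fun setT
    (f : g_sigma_algebraType (completed_algebra_gen mu) -> measurableTypeR R).

(* +oo is possible: U need not be locally integrable. *)
Definition Phi U r : \bar R :=
  ereal_inf [set (\int[mu]_(y in eball x (r / 4)) (U y)%:E)%E
            | x in [set x | r / 2 <= enorm x <= 3 * r / 2]].

Definition holder_on (sigma : R) (K : set 'rV[R]_d) f : Prop :=
  exists C : R, forall x y, K x -> K y ->
    `|f x - f y| <= C * enorm (x - y) `^ sigma.

Fixpoint Ck_holder_on (k : nat) (sigma : R) (K : set 'rV[R]_d) f : Prop :=
  if k is k'.+1 then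
    (forall x, K x -> differentiable f x) /\
    (forall i : 'I_d, Ck_holder_on k' sigma K ('D_(delta_mx ord0 i) f))
  else holder_on sigma K f.

(* C^s(K) = C^{k,sigma}(K) for s = k + sigma with 0 < sigma <= 1. *)
Definition C_on (s : R) (K : set 'rV[R]_d) f : Prop :=
  exists (k : nat) (sigma : R),
    [/\ 0 < sigma <= 1, s = k%:R + sigma & Ck_holder_on k sigma K f].

Definition C_plus (alpha : R) f : Prop :=
  forall K : set 'rV[R]_d, compact K ->
    exists2 gamma : R, 0 < gamma & C_on (alpha + gamma) K f.

Definition omega (alpha : R) x : R := (1 + enorm x `^ (d%:R + alpha))^-1.

Definition L1_omega (alpha : R) f : Prop :=
  mu.-integrable setT (fun x => (f x * omega alpha x)%:E).

Definition Gamma (t : R) : R :=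
  (\int[@lebesgue_measure R]_(s in `]0, +oo[) (s `^ (t - 1) * expR (- s)))%R.

(* 2^alpha Gamma((d+alpha)/2) / (pi^(d/2) |Gamma(-alpha/2)|), where
   |Gamma(-alpha/2)| = Gamma(1 - alpha/2) / (alpha/2) for 0 < alpha < 2. *)
Definition frac_lap_cst (alpha : R) : R :=
  2 `^ alpha * (alpha / 2) * Gamma ((d%:R + alpha) / 2) /
  (pi `^ (d%:R / 2) * Gamma (1 - alpha / 2)).

(* lim is total; the principal value exists when classical_regularity alpha f
   holds and 0 < alpha < 2. *)
Definition frac_lap (alpha : R) f x : R :=
  frac_lap_cst alpha *
  lim ((\int[mu]_(y in [set y | eps < enorm (x - y)])
          ((f x - f y) / enorm (x - y) `^ (d%:R + alpha)))%R
       @[eps --> (0 : R)^'+]).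

Definition classical_regularity (alpha : R) f : Prop :=
  [/\ continuous f, C_plus alpha f & L1_omega alpha f].

(* 0 `^ 0 = 1, for u x = 0 with q1 = 0 and v x = 0 with p2 = 0. *)
Definition classical_solution (alpha beta p1 p2 q1 q2 : R)
    (U V u v : 'rV[R]_d -> R) : Prop :=
  [/\ classical_regularity alpha u, classical_regularity beta v,
      forall x, 0 <= u x /\ 0 <= v x,
      forall x, frac_lap alpha u x >= U x * u x `^ p1 * v x `^ p2 &
      forall x, frac_lap beta v x >= V x * u x `^ q1 * v x `^ q2].

End euclidean.

Section limits_at_infinity.
Context {R : realType}.

Definition limsup_infty (f : R -> \bar R) : \bar R := limf_esup f (pinfty_nbhs R).
Definition liminf_infty (f : R -> \bar R) : \bar R := limf_einf f (pinfty_nbhs R).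

End limits_at_infinity.

(* Main.v *)
(** A nonnegative classical supersolution u of order alpha satisfies two integral
estimates. Write L u for the limit of the truncated operators and R for a radius.
First, slide a multiple of the bump (1 - |x|^2/R^2)^+ under u until it touches:
at the contact point L u >= 0 forces the average of u over the ball of radius R to be
at most C u(x), for every x in the half ball. Second, pairing L u with the same bump
and moving the operator to the other side bounds the integral of L u over the half
ball by C R^(-alpha) times the integral of u. Together they give
u(x) >= c R^(alpha - d) * (integral of L u over the half ball). On an annulus of
radius r, with m and w the minima of u and v there, this yields
  m >= c r^(alpha - d) m^p1 w^p2 Phi_U(r)  and  w >= c r^(beta - d) m^q1 w^q2 Phi_V(r),
together with c r^(alpha - d) <= m <= C and c r^(beta - d) <= w <= C. Eliminating m and w
contradicts each of the four growth conditions. *)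

Require Import Defs.
From mathcomp Require Import all_boot all_order all_algebra.
From mathcomp Require Import all_classical all_reals all_analysis.
From mathcomp Require Import measurable_realfun.
From mathcomp Require Import ring lra.
Import Order.TTheory GRing.Theory Num.Theory.
Import numFieldNormedType.Exports.
Local Open Scope classical_set_scope.
Local Open Scope ring_scope.

Set Implicit Arguments.
Unset Strict Implicit.
Unset Printing Implicit Defensive.

(** * Borel sets and invariance of the Lebesgue measure on R^d *)

(** The kernel |z|^(-d-alpha) has infinite mass at the origin, so neither estimate is run on the
    limit operator itself. Both are proved for the kernel cut off to |z| > e: its mass is finite,
    the quantities involved are integrals of nonnegative functions, and Tonelli moves the operator
    from u to the bump. The mass blows up as e tends to 0, but it cancels before the limit and
    leaves errors that vanish: pointwise at the contact point, uniformly on a ball in the pairing.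
    Regularity strictly above order alpha is what gives this convergence, with a rate.

    The bump is a truncated paraboloid because its second differences are at least -2 min(1,
    |z|^2/r^2) everywhere, even across the edge of its support, where it is only Lipschitz. Hence a
    one-sided bound of order r^(-alpha), uniform in e and in the point.

    The lower bound on m comes from the positive integral of L u over a fixed ball, the upper bound
    from comparing an average of u inside the annulus with u(0). A nontrivial component is positive
    everywhere: at a zero, the average bound would make u vanish on every large ball. *)

Section rV_borel.
Context {R : realType} {n : nat}.
Implicit Types (A : set 'rV[R]_n) (x z : 'rV[R]_n).

Lemma measurable_rV_box (A : 'I_n -> set (measurableTypeR R)) :
  (forall i, measurable (A i)) ->
  measurable [set x : 'rV[R]_n | forall i, A i (x ord0 i)].
Proof.
move=> mA.
suff -> : [set x : 'rV[R]_n | forall i, A i (x ord0 i)] =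
    \bigcap_(i in [set: 'I_n]) (rV_coord i @^-1` A i).
  apply: fin_bigcap_measurable => // i _.
  by rewrite -[X in measurable X]setTI; exact: measurable_rV_coord.
by apply/seteqP; split => x /= xA i; [move=> _|]; exact: xA.
Qed.

(** The sigma-algebra is generated by the coordinates, so an open set is written as a countable
    union of cubes with rational centres and half-sides 1/(k+1). *)
Lemma open_measurable_rV A : open A -> measurable A.
Proof.
move=> oA.
pose a (k : nat) : R := k.+1%:R^-1.
have a0 k : 0 < a k by rewrite /a invr_gt0.
pose box (p : 'rV[rat]_n * nat) : set 'rV[R]_n :=
  [set x | forall i, `](ratr (p.1 ord0 i) - a p.2),
    (ratr (p.1 ord0 i) + a p.2)[%classic (x ord0 i)].
pose F p := if `[< box p `<=` A >] then box p else set0.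
have -> : A = \bigcup_p F p.
  apply/seteqP; split => [x Ax|x [p _]]; last first.
    by rewrite /F; case: asboolP => // + bx; apply.
  have /nbhs_ballP[e /= e0 eA] := open_nbhs_nbhs (conj oA Ax).
  (* The point and any other point of the cube are each within [a k] of the rational centre, hence
     within [2 * a k < e] of each other. *)
  have [k _ /(_ _ (leqnn k)) ke] : \forall k \near \oo, a k < e / 2.
    by near=> k; near: k; apply: near_infty_natSinv_lt (PosNum _); rewrite divr_gt0.
  have qP i : exists q : rat, ratr q \in `](x ord0 i - a k), (x ord0 i + a k)[.
    by apply: rat_in_itvoo; have := a0 k; lra.
  pose q : 'rV[rat]_n := \row_i projT1 (cid (qP i)).
  have bx y : box (q, k) y <-> forall i, `|ratr (q ord0 i) - y ord0 i| < a k.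
    split => h i; have := h i; rewrite /= in_itv/= ltr_norml => /andP[h1 h2];
      by apply/andP; split; lra.
  exists (q, k) => //; rewrite /F asboolT.
    apply/bx => i; rewrite mxE; case: cid => r /=.
    by rewrite in_itv/= => /andP[r1 r2]; rewrite ltr_norml; apply/andP; split; lra.
  move=> y /bx yb; apply: eA => //; split => // i j; rewrite /ball /=.
  rewrite ord1; have := yb j; rewrite mxE; case: cid => r /=.
  rewrite in_itv/= => /andP[r1 r2]; rewrite !ltr_norml => /andP[y1 y2].
  by apply/andP; split; lra.
apply: countable_bigcupT_measurable => [|p]; first exact: countableP.
rewrite /F; case: ifPn => // _; apply: (@measurable_rV_box (fun i =>
  `](ratr (p.1 ord0 i) - a p.2), (ratr (p.1 ord0 i) + a p.2)[%classic)) => i.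
exact: measurable_itv.
Unshelve. all: by end_near. Qed.

Lemma continuous_measurable_rV (f : 'rV[R]_n -> R) :
  continuous f -> measurable_fun setT (f : 'rV[R]_n -> measurableTypeR R).
Proof.
move=> /continuousP cf; apply: (measurability _ (RGenOpens.measurableE R)).
move=> _ [_ [a [b ->] <-]]; rewrite setTI; apply: open_measurable_rV.
exact/cf/interval_open.
Qed.

Lemma coord_le_mx_norm x i : `|x ord0 i| <= `|x|.
Proof.
by rewrite [leRHS]/Num.norm /= mx_normrE; apply/bigmax_geP; right => /=; exists (ord0, i).
Qed.

Lemma lebesgue_rV_cube (a : 'I_n -> R) (b : R) : 0 < b ->
  lebesgue_rV n [set x | forall i, `[(a i - b), (a i + b)]%classic (x ord0 i)] =
  ((2 * b) ^+ n)%:E.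
Proof.
move=> b0; rewrite (@lebesgue_rV_box _ _ (fun i => `[(a i - b), (a i + b)]%classic))//.
rewrite (eq_bigr (fun=> (2 * b)%:E)) => [|i _]; last first.
  rewrite lebesgue_measure_itv/= lte_fin ifT; last by lra.
  by rewrite -EFinB; congr (_%:E); ring.
by rewrite -(big_morph EFin EFinM erefl) prodr_const card_ord.
Qed.

(** Boxes form a pi-system that generates the product sigma-algebra, and the cubes of half-side k +
    1 exhaust the space with finite measure. Invariance under translation and reflection is thereby
    reduced to dimension one. *)
Lemma lebesgue_rV_unique (m : {measure set 'rV[R]_n -> \bar R}) :
  (forall A : 'I_n -> set (measurableTypeR R), (forall i, measurable (A i)) ->
    lebesgue_rV n [set x | forall i, A i (x ord0 i)] =
    m [set x | forall i, A i (x ord0 i)]) ->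
  forall B, measurable B -> lebesgue_rV n B = m B.
Proof.
pose G : set_system 'rV[R]_n := [set B | exists2 A : 'I_n -> set (measurableTypeR R),
  (forall i, measurable (A i)) & B = [set x : 'rV[R]_n | forall i, A i (x ord0 i)]].
move=> mE B mB; pose g (k : nat) : set 'rV[R]_n :=
  [set x | forall i : 'I_n, `[(0 - k.+1%:R), (0 + k.+1%:R)]%classic (x ord0 i)].
apply: (measure_unique G g) => //.
- apply/seteqP; split; last first.
    by apply: smallest_sub; [exact: sigma_algebra_measurable|
      move=> _ [A mA ->]; exact: measurable_rV_box].
  apply: smallest_sub; first exact: smallest_sigma_algebra.
  move=> C; rewrite -bigcup_seq => -[i _ [A mA <-]]; apply: sub_sigma_algebra.
  (* A constraint on one coordinate is a box whose other sides are the whole line. *)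
  exists (fun j => if j == i then A else setT); first by move=> j; case: ifP.
  rewrite setTI; apply/seteqP; split => x /= xA; last by have := xA i; rewrite eqxx.
  by move=> j; case: eqP => // ->.
- move=> _ _ [A mA ->] [A' mA' ->]; exists (fun i => A i `&` A' i).
    by move=> i; exact: measurableI.
  apply/seteqP; split => x /=; first by move=> [xA xA'] i; split; [exact: xA|exact: xA'].
  by move=> h; split => i; case: (h i).
- move=> k; exists (fun=> `[(0 - k.+1%:R), (0 + k.+1%:R)]%classic) => //.
- apply/seteqP; split => // x _; exists (Num.truncn `|x|) => // i.
  rewrite /= in_itv/= sub0r add0r -ler_norml.
  apply: (@le_trans _ _ `|x|); last by apply/ltW/truncnS_gt.
  exact: coord_le_mx_norm.
- by move=> _ [A mA ->]; exact: mE.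
- by move=> k; have /= := @lebesgue_rV_cube (fun=> 0) k.+1%:R; rewrite -/(g k) => ->//; rewrite ltry.
Qed.

Lemma measurable_rV_add z : measurable_fun setT (fun x : 'rV[R]_n => z + x).
Proof.
apply: measurable_fun_rV => i.
rewrite (_ : _ \o _ = (fun x => z ord0 i + rV_coord i x)); last first.
  by apply/funext => x; rewrite /rV_coord/= mxE.
by apply: measurable_funD => //; exact: measurable_rV_coord.
Qed.

Lemma measurable_rV_opp : measurable_fun setT (fun x : 'rV[R]_n => - x).
Proof.
apply: measurable_fun_rV => i.
rewrite (_ : _ \o _ = (fun x => - rV_coord i x)); last first.
  by apply/funext => x; rewrite /rV_coord/= mxE.
by apply: measurableT_comp => //; exact: measurable_rV_coord.
Qed.

Lemma lebesgue_measureD (c : R) (A : set R) : measurable A ->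
  pushforward lebesgue_measure (+%R c : _ -> measurableTypeR R) A = lebesgue_measure A.
Proof.
move=> mA; apply/esym/lebesgue_measure_unique => //=; first exact: measurable_funD.
move=> mc _ [[a b]] _ <- /=.
rewrite /pushforward (_ : _ @^-1` _ = `](a - c), (b - c)]%classic); last first.
  by apply/seteqP; split => x /=; rewrite !in_itv/=; lra.
by rewrite !lebesgue_measure_itv/= !lte_fin ltrD2r; case: ifP => // _;
  rewrite -!EFinB; congr (_%:E); ring.
Qed.

Lemma lebesgue_rVD z A : measurable A ->
  pushforward (lebesgue_rV n) (fun x => z + x) A = lebesgue_rV n A.
Proof.
move=> mA; apply/esym.
apply: (@lebesgue_rV_unique (pushforward (lebesgue_rV n) (fun x => z + x))) => //.
  exact: measurable_rV_add.
move=> mz B mB; rewrite lebesgue_rV_box//.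
transitivity (lebesgue_rV n [set x : 'rV[R]_n | forall i,
    [set t | B i (z ord0 i + t)] (x ord0 i)]); last first.
  by rewrite /pushforward; congr (lebesgue_rV n _); apply/seteqP; split => x /= h i;
    have := h i; rewrite mxE.
rewrite (@lebesgue_rV_box _ _ (fun i => [set t | B i (z ord0 i + t)])) => [|i].
   by apply: eq_bigr => i _; have := lebesgue_measureD (z ord0 i) (mB i).
have /(_ measurableT _ (mB i)) := @measurable_funD _ _ _ setT (fun=> z ord0 i) (@idfun (measurableTypeR R)) (measurable_cst _) (@measurable_id _ _ _).
by rewrite setTI.
Qed.

Lemma lebesgue_rVN A : measurable A ->
  pushforward (lebesgue_rV n) (fun x => - x) A = lebesgue_rV n A.
Proof.
move=> mA; apply/esym.
apply: (@lebesgue_rV_unique (pushforward (lebesgue_rV n) (fun x => - x))) => //.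
  exact: measurable_rV_opp.
move=> mz B mB; rewrite lebesgue_rV_box//.
transitivity (lebesgue_rV n [set x : 'rV[R]_n | forall i,
    [set t | B i (- t)] (x ord0 i)]); last first.
  by rewrite /pushforward; congr (lebesgue_rV n _); apply/seteqP; split => x /= h i;
    have := h i; rewrite mxE.
rewrite (@lebesgue_rV_box _ _ (fun i => [set t | B i (- t)])) => [|i].
  by apply: eq_bigr => i _; have := lebesgue_measureN (mB i).
have /(_ measurableT _ (mB i)) := @oppr_measurable R setT.
by rewrite setTI.
Qed.

Lemma ge0_integral_rVD z (f : 'rV[R]_n -> \bar R) : measurable_fun setT f ->
  (forall x, (0 <= f x)%E) ->
  (\int[lebesgue_rV n]_x f (z + x)%R = \int[lebesgue_rV n]_x f x)%E.
Proof.
move=> mf f0; transitivity (\int[pushforward (lebesgue_rV n) (fun x => z + x)%R]_x f x)%E.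
  by rewrite ge0_integral_pushforward//; exact: measurable_rV_add.
apply: eq_measure_integral; first exact: measurable_rV_add.
by move=> mz A mA _; exact: lebesgue_rVD.
Qed.

Lemma ge0_integral_rVN (f : 'rV[R]_n -> \bar R) : measurable_fun setT f ->
  (forall x, (0 <= f x)%E) ->
  (\int[lebesgue_rV n]_x f (- x)%R = \int[lebesgue_rV n]_x f x)%E.
Proof.
move=> mf f0; transitivity (\int[pushforward (lebesgue_rV n) (fun x => - x)%R]_x f x)%E.
  by rewrite ge0_integral_pushforward//; exact: measurable_rV_opp.
apply: eq_measure_integral; first exact: measurable_rV_opp.
by move=> mz A mA _; exact: lebesgue_rVN.
Qed.

End rV_borel.

(** * Dyadic bounds for integrals of powers *)

Section dyadic.
Context {R : realType}.

Lemma dyadic_bracket (y : R) : 1 < y -> exists k : nat, 2 ^+ k < y <= 2 ^+ k.+1.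
Proof.
move=> y1; have ex : exists k, y <= 2 ^+ k.+1.
  exists (Num.truncn y); apply: (@le_trans _ _ (Num.truncn y).+1%:R).
    exact/ltW/truncnS_gt.
  by rewrite -natrX ler_nat; apply/ltnW/ltn_expl.
case: (ex_minnP ex) => k yk kmin; exists k; rewrite yk andbT.
case: k => [|k] in yk kmin *; first by rewrite expr0.
by rewrite ltNge; apply/negP => /kmin; rewrite ltnn.
Qed.

Lemma powR_exprn (b e : R) (k : nat) : 0 <= b -> (b ^+ k) `^ e = (b `^ e) ^+ k.
Proof. by move=> b0; rewrite -!powR_mulrn ?powR_ge0// powRAC. Qed.

Lemma powR_lt1 (b e : R) : 0 < b < 1 -> 0 < e -> b `^ e < 1.
Proof.
move=> /andP[b0 b1] e0; rewrite -[ltRHS](powRr0 b) /powR gt_eqF//.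
by rewrite ltr_expR mul0r pmulr_rlt0// ln_lt0// b0.
Qed.

Lemma le_powR_npos (e x y : R) : e <= 0 -> 0 < x -> x <= y -> y `^ e <= x `^ e.
Proof.
move=> e0 x0 xy; have y0 := lt_le_trans x0 xy.
rewrite /powR !gt_eqF// ler_expR ler_wnM2l//.
by rewrite ler_ln.
Qed.

Context d (T : measurableType d) (mu : {measure set T -> \bar R}) (rho : T -> R).
Hypothesis mrho : measurable_fun setT rho.

Let msub a : measurable [set x | rho x <= a].
Proof.
rewrite (_ : [set x | _] = rho @^-1` `]-oo, a]%classic); last first.
  by apply/seteqP; split => x /=; rewrite in_itv.
by rewrite -[X in measurable X]setTI; exact: mrho.
Qed.

Lemma measurable_gt_lvl a : measurable [set x | a < rho x].
Proof.
rewrite (_ : [set x | _] = ~` [set x | rho x <= a]); first exact: measurableC.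
by apply/seteqP; split => x /=; rewrite ltNge => /negP.
Qed.

Lemma measurable_gt_le_lvl a b : measurable [set x | a < rho x <= b].
Proof.
rewrite (_ : [set x | _] = [set x | a < rho x] `&` [set x | rho x <= b]).
  by apply: measurableI => //; exact: measurable_gt_lvl.
by apply/seteqP; split => x /= => [/andP|] [] // -> ->.
Qed.

Variables (C D : R).
Hypotheses (C0 : 0 <= C) (D0 : 0 <= D).
Hypothesis muC : forall a, 0 < a -> (mu [set x | (rho x <= a)%R] <= (C * a `^ D)%:E)%E.

(** On [A] the function [g] is dominated by the sum of [c k] times the indicator of the sublevel set
    at height [b k], because one term already dominates at each point. The growth bound [muC] makes
    the k-th term contribute at most [M * q ^+ k]. This stands in for polar coordinates and uses
    only the growth of sublevel sets, so it serves both R^d and the half-line in [Gamma]. *)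
Lemma integral_le_geometric (A : set T) (g : T -> R) (b c : nat -> R) (M q : R) :
  measurable A -> measurable_fun A g -> (forall x, A x -> 0 <= g x) ->
  0 <= M -> 0 < q < 1 -> (forall k, 0 < b k) -> (forall k, 0 <= c k) ->
  (forall k, c k * (C * b k `^ D) <= M * q ^+ k) ->
  (forall x, A x -> exists k, rho x <= b k /\ g x <= c k) ->
  (\int[mu]_(x in A) (g x)%:E <= (M / (1 - q))%:E)%E.
Proof.
move=> mA mg g0 M0 /andP[q0 q1] b0 c0 cM Ag.
pose h k x : \bar R := (c k * \1_[set x | rho x <= b k] x)%:E.
have h0 k x : (0 <= h k x)%E by rewrite lee_fin mulr_ge0.
have mh k : measurable_fun A (h k).
  by apply/measurable_EFinP; apply: measurable_funM.
apply: (@le_trans _ _ (\int[mu]_(x in A) (\sum_(k <oo) h k x))%E).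
  apply: ge0_le_integral => //.
  - exact/measurable_EFinP.
  - by apply: ge0_emeasurable_sum => //.
  - move=> x Ax; have [k [xb gc]] := Ag x Ax.
    apply: (@le_trans _ _ (h k x)).
      by rewrite lee_fin indicE mem_set// mulr1.
    apply: (@le_trans _ _ (\sum_(0 <= i < k.+1) h i x)%E).
      by rewrite big_nat_recr//= leeDr// sume_ge0.
    exact: nneseries_lim_ge.
rewrite integral_nneseries//.
apply: lime_le; first by apply: is_cvg_nneseries => k _ _; exact: integral_ge0.
apply: nearW => n.
apply: (@le_trans _ _ (\sum_(0 <= k < n) (geometric M q k)%:E)%E); last first.
  rewrite sumEFin lee_fin.
  by have := geometric_le_lim n M0 q0; rewrite /series/=; apply; rewrite ger0_norm// ltW.
apply: lee_sum => k _; apply: (@le_trans _ _ (\int[mu]_x h k x)%E).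
  by apply: ge0_subset_integral => //; apply/measurable_EFinP;
    apply: measurable_funM.
rewrite /h; under eq_integral do rewrite EFinM.
rewrite ge0_integralZl//; [|exact/measurable_EFinP|by rewrite lee_fin].
rewrite integral_indic// setIT.
apply: (@le_trans _ _ ((c k)%:E * (C * b k `^ D)%:E)%E).
  by rewrite lee_wpmul2l ?lee_fin// muC.
by rewrite -EFinM lee_fin.
Qed.

Definition dyadic_cst (s : R) := 2 `^ `|s - D| * (C * 2 `^ D) / (1 - 2^-1 `^ s).

Lemma dyadic_cst_ge0 s : 0 < s -> 0 <= dyadic_cst s.
Proof.
move=> s0; rewrite /dyadic_cst divr_ge0//.
  by rewrite !mulr_ge0 ?powR_ge0.
by rewrite subr_ge0 ltW// powR_lt1//; apply/andP; split; lra.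
Qed.

Lemma integral_powR_near (s a : R) : 0 < s -> 0 < a ->
  (\int[mu]_(x in [set x | (0 < rho x <= a)%R]) (rho x `^ (s - D))%:E
    <= (dyadic_cst s * a `^ s)%:E)%E.
Proof.
move=> s0 a0; pose q : R := 2^-1 `^ s.
have q01 : 0 < q < 1.
  by rewrite powR_gt0 ?powR_lt1//; apply/andP; split; lra.
have := @integral_le_geometric [set x | 0 < rho x <= a]
  (fun x => rho x `^ (s - D)) (fun k => 2 * (a * 2^-1 ^+ k))
  (fun k => 2 `^ `|s - D| * (a * 2^-1 ^+ k) `^ (s - D))
  (2 `^ `|s - D| * (C * 2 `^ D) * a `^ s) q.
rewrite (_ : _ / _ = dyadic_cst s * a `^ s); last first.
  by rewrite /dyadic_cst -/q; ring.
apply => //.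
- exact: measurable_gt_le_lvl.
- by apply: measurable_funTS; apply: (measurableT_comp (measurable_powR _)).
- by move=> x _; exact: powR_ge0.
- by rewrite !mulr_ge0 ?powR_ge0.
- by move=> k; rewrite !mulr_gt0 ?exprn_gt0.
- by move=> k; rewrite mulr_ge0 ?powR_ge0.
- move=> k; have k0 : 0 < 2^-1 ^+ k :> R by rewrite exprn_gt0.
  have w0 : 0 < a * 2^-1 ^+ k by rewrite mulr_gt0.
  rewrite (powRM D (ler0n _ 2) (ltW w0)).
  rewrite [leLHS](_ : _ = 2 `^ `|s - D| * (C * 2 `^ D) *
    ((a * 2^-1 ^+ k) `^ (s - D) * (a * 2^-1 ^+ k) `^ D)); last by ring.
  rewrite -powRD; last by rewrite (gt_eqF w0) /= implybT.
  by rewrite subrK (powRM s (ltW a0) (ltW k0)) powR_exprn// mulrA.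
- move=> x /= /andP[x0 xa].
  (* The factor 2 keeps the quotient above 1 even at [rho x = a]; the bracket then reads a/2^k <=
     rho x < 2a/2^k. *)
  have [k /andP[k1 k2]] : exists k : nat, 2 ^+ k < 2 * a / rho x <= 2 ^+ k.+1.
    by apply: dyadic_bracket; rewrite ltr_pdivlMr// mul1r; lra.
  have k0 : 0 < 2 ^+ k :> R by rewrite exprn_gt0.
  have w0 : 0 < a / 2 ^+ k by rewrite divr_gt0.
  have wx : a / 2 ^+ k <= rho x.
    move: k2; rewrite ler_pdivrMr// exprS ler_pdivrMr// => k2; lra.
  have xw : rho x <= 2 * (a / 2 ^+ k).
    by move: k1; rewrite ltr_pdivlMr// mulrA ler_pdivlMr// mulrC => /ltW.
  exists k; rewrite exprVn; split => //.
  have [sD|sD] := lerP 0 (s - D).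
    rewrite (ger0_norm sD) -(powRM (s - D) (ler0n _ 2) (ltW w0)); apply: ge0_ler_powR => //; rewrite nnegrE; first exact: ltW.
    by rewrite mulr_ge0// ltW.
  apply: (le_trans (le_powR_npos (ltW sD) w0 wx)).
  by rewrite ler_peMl ?powR_ge0// -[leLHS](powRr0 2) ler_powR// ?ler1n// normr_ge0.
Qed.

Lemma integral_powR_far (s a : R) : 0 < s -> 0 < a ->
  (\int[mu]_(x in [set x | (a < rho x)%R]) (rho x `^ (- (D + s)))%:E
    <= (dyadic_cst s * a `^ (- s))%:E)%E.
Proof.
move=> s0 a0; pose q : R := 2^-1 `^ s.
have q01 : 0 < q < 1.
  by rewrite powR_gt0 ?powR_lt1//; apply/andP; split; lra.
have := @integral_le_geometric [set x | a < rho x]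
  (fun x => rho x `^ (- (D + s))) (fun k => 2 * (a * 2 ^+ k))
  (fun k => 2 `^ `|s - D| * (a * 2 ^+ k) `^ (- (D + s)))
  (2 `^ `|s - D| * (C * 2 `^ D) * a `^ (- s)) q.
rewrite (_ : _ / _ = dyadic_cst s * a `^ (- s)); last first.
  by rewrite /dyadic_cst -/q; ring.
apply => //.
- exact: measurable_gt_lvl.
- by apply: measurable_funTS; apply: (measurableT_comp (measurable_powR _)).
- by move=> x _; exact: powR_ge0.
- by rewrite !mulr_ge0 ?powR_ge0.
- by move=> k; rewrite !mulr_gt0 ?exprn_gt0.
- by move=> k; rewrite mulr_ge0 ?powR_ge0.
- move=> k; have k0 : 0 < 2 ^+ k :> R by rewrite exprn_gt0.
  have w0 : 0 < a * 2 ^+ k by rewrite mulr_gt0.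
  rewrite (powRM D (ler0n _ 2) (ltW w0)).
  rewrite [leLHS](_ : _ = 2 `^ `|s - D| * (C * 2 `^ D) *
    ((a * 2 ^+ k) `^ (- (D + s)) * (a * 2 ^+ k) `^ D)); last by ring.
  rewrite -powRD; last by rewrite (gt_eqF w0) /= implybT.
  rewrite (_ : - (D + s) + D = - s); last by ring.
  rewrite (powRM (- s) (ltW a0) (ltW k0)) powR_exprn// mulrA.
  by rewrite /q -powR_inv1// -powRrM mulN1r.
- move=> x /= xa.
  have [k /andP[k1 k2]] : exists k : nat, 2 ^+ k < rho x / a <= 2 ^+ k.+1.
    by apply: dyadic_bracket; rewrite ltr_pdivlMr// mul1r.
  have k0 : 0 < 2 ^+ k :> R by rewrite exprn_gt0.
  have w0 : 0 < a * 2 ^+ k by rewrite mulr_gt0.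
  exists k; split.
    by move: k2; rewrite ler_pdivrMr// exprS; lra.
  apply: (@le_trans _ _ ((a * 2 ^+ k) `^ (- (D + s)))).
    apply: le_powR_npos => //; first by rewrite oppr_le0 addr_ge0// ltW.
    by move: k1; rewrite ltr_pdivlMr// mulrC => /ltW.
  by rewrite ler_peMl ?powR_ge0// -[leLHS](powRr0 2) ler_powR// ?ler1n// normr_ge0.
Qed.

End dyadic.

(** * The Euclidean norm *)

Section enorm_theory.
Context {R : realType} {d : nat}.
Implicit Types (x y z : 'rV[R]_d).
Local Notation mu := (@lebesgue_rV R d).

Lemma sqr_enorm x : enorm x ^+ 2 = \sum_(i < d) x ord0 i ^+ 2.
Proof. by rewrite /enorm sqr_sqrtr// sumr_ge0// => i _; exact: sqr_ge0. Qed.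

Lemma enorm_ge0 x : 0 <= enorm x.
Proof. exact: sqrtr_ge0. Qed.

Lemma enormN x : enorm (- x) = enorm x.
Proof. by rewrite /enorm; congr Num.sqrt; apply: eq_bigr => i _; rewrite mxE sqrrN. Qed.

Lemma enormC x y : enorm (x - y) = enorm (y - x).
Proof. by rewrite -enormN opprB. Qed.

Lemma enormZ a x : enorm (a *: x) = `|a| * enorm x.
Proof.
rewrite /enorm -sqrtr_sqr -sqrtrM ?sqr_ge0// mulr_sumr; congr Num.sqrt.
by apply: eq_bigr => i _; rewrite mxE exprMn.
Qed.

Lemma coord_le_enorm x i : `|x ord0 i| <= enorm x.
Proof.
rewrite -sqrtr_sqr ler_wsqrtr// (bigD1 i)//= lerDl sumr_ge0// => j _.
exact: sqr_ge0.
Qed.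

(** Cauchy-Schwarz, by expanding the sum of the squares (b x_i - a y_i)^2. The division by [a * b]
    is why a vanishing norm is treated apart. *)
Lemma sum_coordM_le x y : \sum_(i < d) x ord0 i * y ord0 i <= enorm x * enorm y.
Proof.
set a := enorm x; set b := enorm y; set S := \sum_(i < d) _.
have a0 : 0 <= a := enorm_ge0 x; have b0 : 0 <= b := enorm_ge0 y.
have [/eqP|ab] := eqVneq (a * b) 0; last first.
  have ab0 : 0 < a * b by rewrite lt_neqAle eq_sym ab mulr_ge0.
  have : 0 <= \sum_(i < d) (b * x ord0 i - a * y ord0 i) ^+ 2.
    by apply: sumr_ge0 => i _; exact: sqr_ge0.
  rewrite (eq_bigr (fun i => b ^+ 2 * x ord0 i ^+ 2 + a ^+ 2 * y ord0 i ^+ 2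
    + (- (2 * (a * b))) * (x ord0 i * y ord0 i))); last by move=> i _; ring.
  rewrite !big_split/= -!mulr_sumr -!sqr_enorm -/a -/b -/S => h.
  rewrite -(ler_pM2l ab0); nra.
rewrite mulf_eq0 => /orP[] /eqP e0; rewrite e0 ?mul0r ?mulr0 /S big1// => i _.
  have := coord_le_enorm x i; rewrite -/a e0 normr_le0 => /eqP ->; exact: mul0r.
have := coord_le_enorm y i; rewrite -/b e0 normr_le0 => /eqP ->; exact: mulr0.
Qed.

Lemma ler_enormD x y : enorm (x + y) <= enorm x + enorm y.
Proof.
rewrite -(@ler_pXn2r _ 2)// ?nnegrE ?addr_ge0 ?enorm_ge0//.
rewrite sqr_enorm (eq_bigr (fun i => x ord0 i ^+ 2 + y ord0 i ^+ 2 +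
  2 * (x ord0 i * y ord0 i))); last by move=> i _; rewrite mxE; ring.
rewrite !big_split/= -mulr_sumr -!sqr_enorm; have := sum_coordM_le x y; nra.
Qed.

Lemma ler_enormB x y : enorm (x - y) <= enorm x + enorm y.
Proof. by rewrite -(enormN y); exact: ler_enormD. Qed.

Lemma enorm_le_bound x b : 0 <= b -> (forall i, `|x ord0 i| <= b) ->
  enorm x <= d%:R * b.
Proof.
move=> b0 xb; rewrite -(@ler_pXn2r _ 2)// ?nnegrE ?mulr_ge0 ?enorm_ge0//.
rewrite sqr_enorm; apply: (@le_trans _ _ (\sum_(i < d) b ^+ 2)).
  by apply: ler_sum => i _; rewrite -real_normK ?num_real// ler_sqr ?nnegrE.
rewrite sumr_const card_ord -[leLHS]mulr_natl exprMn; apply: ler_wpM2r; first exact: sqr_ge0.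
by rewrite -natrX ler_nat; case: (d) => // n; rewrite expnS expn1 leq_pmulr.
Qed.

Lemma enorm0 : enorm (0 : 'rV[R]_d) = 0.
Proof. by rewrite /enorm big1 ?sqrtr0// => i _; rewrite mxE expr0n. Qed.

Lemma continuous_sum_sqr : continuous (fun x => \sum_(i < d) x ord0 i ^+ 2).
Proof.
apply: continuous_big => [|i _ x]; first exact: add_continuous.
apply: (@continuous_comp _ _ _ (fun y : 'rV[R]_d => y ord0 i) (fun t : R => t ^+ 2)).
  exact: (@coord_continuous R 1 d ord0 i).
exact: exprn_continuous.
Qed.

Lemma continuous_enorm : continuous (@enorm R d).
Proof.
move=> x; apply: (@continuous_comp _ _ _ _ Num.sqrt); first exact: continuous_sum_sqr.
exact: sqrt_continuous.
Qed.

Lemma measurable_enorm : measurable_fun setT (@enorm R d).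
Proof. by apply: continuous_measurable_rV; exact: continuous_enorm. Qed.

Lemma measurable_eball x r : measurable (eball x r).
Proof.
rewrite (_ : eball x r = (fun y => enorm (x - y)) @^-1` `]-oo, r[%classic); last first.
  by apply/seteqP; split => y /=; rewrite in_itv.
rewrite -[X in measurable X]setTI.
apply: (measurableT_comp measurable_enorm (measurableT_comp (measurable_rV_add x) measurable_rV_opp)) => //.
Qed.

Lemma lebesgue_rV_enorm_le a : 0 < a ->
  (mu [set x | (enorm x <= a)%R] <= (2 ^+ d * a `^ d%:R)%:E)%E.
Proof.
move=> a0; rewrite (powR_mulrn d (ltW a0)) -exprMn.
have <- := lebesgue_rV_cube (fun=> 0) a0.
apply: le_measure; rewrite ?inE.
- rewrite (_ : [set x | _] = @enorm R d @^-1` `]-oo, a]%classic); last first.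
    by apply/seteqP; split => x /=; rewrite in_itv.
  by rewrite -[X in measurable X]setTI; exact: measurable_enorm.
- by apply: (@measurable_rV_box _ _ (fun=> `[0 - a, 0 + a]%classic)) => i; exact: measurable_itv.
- move=> x /= xa i; rewrite in_itv/= sub0r add0r -ler_norml.
  exact: le_trans (coord_le_enorm _ _) xa.
Qed.

Lemma lebesgue_rV_eball_ge x a : (0 < d)%N -> 0 < a ->
  (((a / d%:R) ^+ d)%:E <= mu (eball x a))%E.
Proof.
(* Half-side of a cube inside the ball: by [enorm_le_bound] its points are within [a / 2] of the
   centre, so strictly inside. *)
move=> d0 a0; have b0 : 0 < a / (2 * d%:R) by rewrite divr_gt0// mulr_gt0 ?ltr0n.
rewrite (_ : a / d%:R = 2 * (a / (2 * d%:R))); last first.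
  by field; rewrite pnatr_eq0 -lt0n.
have <- := lebesgue_rV_cube (x ord0) b0.
apply: le_measure; rewrite ?inE.
- by apply: (@measurable_rV_box _ _ (fun i => `[x ord0 i - a / (2 * d%:R), x ord0 i + a / (2 * d%:R)]%classic)) => i; exact: measurable_itv.
- exact: measurable_eball.
- move=> y /= ya; apply: (@le_lt_trans _ _ (d%:R * (a / (2 * d%:R)))).
    apply: enorm_le_bound => [|i]; first exact: ltW.
    have := ya i; rewrite in_itv/= !mxE ler_norml => /andP[y1 y2].
    by apply/andP; split; lra.
  rewrite (_ : _ * _ = a / 2); first lra.
  by field; rewrite pnatr_eq0 -lt0n.
Qed.

Lemma compact_enorm_le r : compact [set x : 'rV[R]_d | enorm x <= r].
Proof.
apply: bounded_closed_compact.
  exists r; split; first exact: num_real.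
  move=> M rM x /= xr; apply: (le_trans _ (ltW rM)); apply: le_trans xr.
  rewrite [leLHS]/Num.norm /= mx_normrE; apply/bigmax_leP; split; first exact: enorm_ge0.
  by move=> [i j] _ /=; rewrite (ord1 i) coord_le_enorm.
rewrite (_ : [set x | _] = @enorm R d @^-1` [set x | x <= r])//.
apply: preimage_closed; last exact: closed_le.
by move=> x _; exact: continuous_enorm.
Qed.

End enorm_theory.

(** * The constant of the fractional Laplacian *)

Section frac_lap_constant.
Context {R : realType}.
Local Notation mu1 := (@lebesgue_measure R).

Lemma lebesgue_measure_normr_le (a : R) : 0 < a ->
  (mu1 [set x : R | (`|x| <= a)%R] <= (2 * a `^ 1)%:E)%E.
Proof.
move=> a0; rewrite powRr1 ?(ltW a0)//.
rewrite (_ : [set x | _] = `[- a, a]%classic); last first.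
  by apply/seteqP; split => x /=; rewrite in_itv/= ler_norml.
rewrite lebesgue_measure_itv/= lte_fin ifT; last by lra.
by rewrite -EFinB lee_fin; lra.
Qed.

(** This is ln y <= y - 1 at y = s/(t+1), multiplied by t + 1 and exponentiated. The exponent is
    written [- (1 + 1)] to match [integral_powR_far] with dimension 1 and decay 1. *)
Lemma Gamma_integrand_tail (t s : R) : 0 < t -> 1 < s ->
  s `^ (t - 1) * expR (- s) <= (t + 1) `^ (t + 1) * s `^ (- (1 + 1)).
Proof.
move=> t0 s1; have s0 : 0 < s by lra.
have t1 : 0 < t + 1 by lra.
rewrite -ler_pdivrMr ?powR_gt0// -powRN opprK -mulrA (mulrC (expR _)) mulrA.
rewrite -powRD; last by rewrite (gt_eqF s0) implybT.
rewrite (_ : t - 1 + (1 + 1) = t + 1); last by ring.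
rewrite /powR !gt_eqF// -expRD ler_expR.
have : ln (s / (t + 1)) <= s / (t + 1) - 1.
  have /le_ln1Dx : -1 < s / (t + 1) - 1 by have := divr_gt0 s0 t1; lra.
  by rewrite (_ : 1 + _ = s / (t + 1)) //; ring.
rewrite ln_div ?posrE// -(ler_pM2l t1) mulrBr mulrBr mulrCA divff ?gt_eqF// mulr1.
by lra.
Qed.

Lemma Gamma_integrand_measurable (t : R) :
  measurable_fun setT (fun s : R => s `^ (t - 1) * expR (- s)).
Proof.
apply: measurable_funM; first exact: measurable_powR.
by apply: measurableT_comp; [exact: measurable_expR|exact: oppr_measurable].
Qed.

(** [Gamma] is the finite part of an extended integral and would be 0 if that integral were
    infinite, so positivity requires both a positive lower bound and finiteness. *)
Lemma Gamma_gt0 (t : R) : 0 < t -> 0 < Gamma t.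
Proof.
move=> t0; pose f (s : R) := s `^ (t - 1) * expR (- s).
have f0 s : 0 <= f s by rewrite mulr_ge0 ?powR_ge0 ?expR_ge0.
have mf (D : set R) : measurable_fun D (EFin \o f).
  by apply: measurable_funTS; apply/measurable_EFinP; exact: Gamma_integrand_measurable.
have mr : measurable_fun setT (fun x : R => `|x|) by exact: normr_measurable.
have mA : measurable [set s : R | 0 < `|s| <= 1] by exact: measurable_gt_le_lvl.
have mB : measurable [set s : R | 1 < `|s|] by exact: measurable_gt_lvl.
rewrite /Gamma /Rintegral -/f; apply: fine_gt0; apply/andP; split.
  (* On ]1, 2[ the power x^(t-1) is monotone in a direction that depends on t, so it stays above the
     smaller of its two endpoint values. *)
  pose m : R := Num.min 1 (2 `^ (t - 1)) * expR (- 2).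
  have m0 : 0 < m by rewrite mulr_gt0 ?expR_gt0// lt_min ltr01 powR_gt0.
  apply: (@lt_le_trans _ _ (\int[mu1]_(s in `]1%R, 2%R[) m%:E)%E).
    rewrite integral_cst//= lebesgue_measure_itv/= lte_fin ifT; last by lra.
    by rewrite -EFinB -EFinM lte_fin mulr_gt0//; lra.
  apply: (@le_trans _ _ (\int[mu1]_(s in `]1%R, 2%R[) (f s)%:E)%E).
    apply: ge0_le_integral => //.
    - by move=> x _; rewrite lee_fin ltW.
    - exact: mf.
    - move=> x /=; rewrite in_itv/= => /andP[x1 x2]; rewrite lee_fin /m /f.
      apply: ler_pM; rewrite ?expR_ge0//.
      + have [t1|t1] := lerP 0 (t - 1).
          rewrite ge_min; apply/orP; left.
          apply: le_trans (ge0_ler_powR t1 _ _ (ltW x1)); rewrite ?powR1 ?nnegrE//; lra.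
        rewrite ge_min; apply/orP; right; apply: le_powR_npos; lra.
      + by rewrite ler_expR; lra.
  apply: ge0_subset_integral => //; [exact: mf|by move=> x _; rewrite lee_fin f0|].
  by move=> x /=; rewrite !in_itv/= andbT => /andP[]; lra.
rewrite (_ : `]0, +oo[%classic = `]0, 1] `|` `]1, +oo[); last first.
  apply/seteqP; split => x /=; rewrite !in_itv/= ?andbT.
    by case: (lerP x 1) => x1 x0; [left; rewrite x0|right].
  by case => [/andP[]//|]; lra.
rewrite ge0_integral_setU//; [|exact: mf|by move=> x _; rewrite lee_fin f0|]; last first.
  apply/disj_set2P; rewrite -subset0 => x [] /=.
  by rewrite !in_itv/= andbT => /andP[_ x1]; rewrite ltNge x1.
apply: (@le_lt_trans _ _ ((dyadic_cst 2 1 t * 1 `^ t)%:E +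
  ((t + 1) `^ (t + 1) * (dyadic_cst 2 1 1 * 1 `^ (- 1)))%:E)%E); last exact: ltry.
apply: leeD.
  apply: (le_trans _ (@integral_powR_near R _ _ mu1 _ mr _ _ (ler0n _ 2) lebesgue_measure_normr_le _ _ t0 ltr01)) => //.
  have mp D : measurable_fun D (fun x : R => (`|x| `^ (t - 1))%:E).
    apply/measurable_EFinP/measurable_funTS.
    exact: (measurableT_comp (measurable_powR _) mr).
  apply: (@le_trans _ _ (\int[mu1]_(s in `]0%R, 1%R]) (`|s| `^ (t - 1))%:E)%E).
    apply: ge0_le_integral => //; [by move=> x _; rewrite lee_fin; exact: f0|exact: mf|exact: mp|].
    move=> x /=; rewrite in_itv/= => /andP[x0 x1]; rewrite lee_fin /f gtr0_norm//.
    by rewrite ler_piMr ?powR_ge0// -[leRHS]expR0 ler_expR; lra.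
  apply: ge0_subset_integral => //; first exact: mp.
  - by move=> x /=; rewrite in_itv/= => /andP[x0 x1]; rewrite gtr0_norm// x0.
have mp D : measurable_fun D (fun x : R => (`|x| `^ (- (1 + 1)))%:E).
  apply/measurable_EFinP/measurable_funTS.
  exact: (measurableT_comp (measurable_powR _) mr).
have c0 : 0 <= (t + 1) `^ (t + 1) by exact: powR_ge0.
rewrite EFinM; apply: (le_trans _ (lee_wpmul2l _ (@integral_powR_far R _ _ mu1 _ mr _ _ (ler0n _ 2) ler01 lebesgue_measure_normr_le _ _ ltr01 ltr01))) => //.
rewrite -ge0_integralZl//; last exact: mp.
apply: (@le_trans _ _ (\int[mu1]_(s in `]1%R, +oo[)
    (((t + 1) `^ (t + 1))%:E * (`|s| `^ (- (1 + 1)))%:E))%E).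
  apply: ge0_le_integral => //; [by move=> x _; rewrite lee_fin; exact: f0|exact: mf| |].
    by apply: emeasurable_funM => //; exact: mp.
  move=> x /=; rewrite in_itv/= andbT => x1; rewrite -EFinM lee_fin gtr0_norm; last by lra.
  exact: Gamma_integrand_tail.
apply: ge0_subset_integral => //.
- by apply: emeasurable_funM => //; exact: mp.
- by move=> x _; rewrite -EFinM lee_fin mulr_ge0 ?powR_ge0.
- by move=> x /=; rewrite in_itv/= andbT => x1; rewrite gtr0_norm//; lra.
Qed.

Lemma frac_lap_cst_gt0 (d : nat) (alpha : R) : (0 < d)%N -> 0 < alpha < 2 ->
  0 < @frac_lap_cst R d alpha.
Proof.
move=> d0 /andP[a0 a2]; rewrite /frac_lap_cst.
have dR : 0 < d%:R :> R by rewrite ltr0n.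
by rewrite divr_gt0 ?mulr_gt0 ?powR_gt0 ?Gamma_gt0 ?pi_gt0//; lra.
Qed.

End frac_lap_constant.

(** * The truncated Riesz kernel *)

Section truncated_kernel.
Context {R : realType} {d : nat}.
Variable alpha : R.
Hypotheses (alpha_gt0 : 0 < alpha) (alpha_lt2 : alpha < 2).
Implicit Types (x y z : 'rV[R]_d) (f h k : 'rV[R]_d -> R) (A : set 'rV[R]_d).
Local Notation mu := (@lebesgue_rV R d).
Local Notation D := (d%:R : R).

(** Extended-real valued, so that identities between integrals of nonnegative functions hold before
    finiteness is known. *)
Definition conv k f x : \bar R := (\int[mu]_z (f (x + z)%R * k z)%:E)%E.

Lemma measurable_fun_shift f x : measurable_fun setT f ->
  measurable_fun setT (fun z => f (x + z)).
Proof. by move=> mf; apply: (measurableT_comp mf); exact: measurable_rV_add. Qed.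

Lemma measurable_fun_reflect f x : measurable_fun setT f ->
  measurable_fun setT (fun z => f (x - z)).
Proof.
move=> mf; apply: (measurableT_comp (measurable_fun_shift x mf)).
exact: measurable_rV_opp.
Qed.

Section even_kernel.
Variable k : 'rV[R]_d -> R.
Hypotheses (k_ge0 : forall z, 0 <= k z) (mk : measurable_fun setT k)
  (k_even : forall z, k (- z) = k z).

Lemma conv_ge0 f x : (forall y, 0 <= f y) -> (0 <= conv k f x)%E.
Proof. by move=> f0; apply: integral_ge0 => z _; rewrite lee_fin mulr_ge0. Qed.

Lemma conv_reflect f x : measurable_fun setT f -> (forall y, 0 <= f y) ->
  conv k f x = (\int[mu]_z (f (x - z)%R * k z)%:E)%E.
Proof.
move=> mf f0; rewrite /conv -ge0_integral_rVN.
- by apply: eq_integral => z _; rewrite k_even.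
- apply/measurable_EFinP; apply: measurable_funM => //.
  exact: measurable_fun_shift.
- by move=> z; rewrite lee_fin mulr_ge0.
Qed.

Lemma conv_sub f x : measurable_fun setT f -> (forall y, 0 <= f y) ->
  conv k f x = (\int[mu]_y (f y * k (x - y)%R)%:E)%E.
Proof.
move=> mf f0; rewrite /conv -[RHS](ge0_integral_rVD x).
- by apply: eq_integral => z _; rewrite opprD addrA subrr sub0r k_even.
- apply/measurable_EFinP; apply: measurable_funM => //.
  exact: measurable_fun_reflect.
- by move=> z; rewrite lee_fin mulr_ge0.
Qed.

(** Averaging with the reflected integral brings out f(x+z) + f(x-z), whose comparison with 2 f(x)
    is free of first-order terms; this cancellation is what makes the principal value converge. *)
Lemma conv_symmetric f x : measurable_fun setT f -> (forall y, 0 <= f y) ->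
  (conv k f x + conv k f x = \int[mu]_z ((f (x + z)%R + f (x - z)%R) * k z)%:E)%E.
Proof.
move=> mf f0; rewrite {2}conv_reflect// /conv -ge0_integralD//.
- by apply: eq_integral => z _; rewrite -EFinD mulrDl.
- by move=> z _; rewrite lee_fin mulr_ge0.
- by apply/measurable_EFinP; apply: measurable_funM => //; exact: measurable_fun_shift.
- by move=> z _; rewrite lee_fin mulr_ge0.
- by apply/measurable_EFinP; apply: measurable_funM => //; exact: measurable_fun_reflect.
Qed.

(** [h] measures how far [f] may be concave at [x]. Like its converse below, the inequality compares
    sums of nonnegative integrals without subtraction, so it holds even if some are infinite. *)
Lemma conv_second_difference_ge f h x : measurable_fun setT f ->
  (forall y, 0 <= f y) -> measurable_fun setT h -> (forall z, 0 <= h z) ->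
  (forall z, k z != 0 -> 2 * f x <= f (x + z) + f (x - z) + h z) ->
  ((2 * f x)%:E * \int[mu]_z (k z)%:E <=
    conv k f x + conv k f x + \int[mu]_z (h z * k z)%:E)%E.
Proof.
move=> mf f0 mh h0 fh.
have f2 : 0 <= 2 * f x by rewrite mulr_ge0.
rewrite conv_symmetric// -ge0_integralZl//; last 2 first.
- exact/measurable_EFinP.
- by move=> z _; rewrite lee_fin.
have m1 : measurable_fun setT (fun z => ((f (x + z) + f (x - z)) * k z)%:E).
  apply/measurable_EFinP; apply: measurable_funM => //; apply: measurable_funD.
    exact: measurable_fun_shift.
  exact: measurable_fun_reflect.
have m2 : measurable_fun setT (fun z => (h z * k z)%:E).
  by apply/measurable_EFinP; exact: measurable_funM.
rewrite -ge0_integralD//; last 2 first.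
- by move=> z _; rewrite lee_fin mulr_ge0// addr_ge0.
- by move=> z _; rewrite lee_fin mulr_ge0.
apply: ge0_le_integral => //.
- by move=> z _; rewrite -EFinM lee_fin mulr_ge0.
- by apply: emeasurable_funM => //; exact/measurable_EFinP.
- exact: emeasurable_funD.
- move=> z _; rewrite -EFinM -EFinD lee_fin -mulrDl.
  have [->|kz] := eqVneq (k z) 0; first by rewrite !mulr0.
  by rewrite ler_wpM2r// fh.
Qed.

Lemma conv_second_difference_le f h x : measurable_fun setT f ->
  (forall y, 0 <= f y) -> measurable_fun setT h -> (forall z, 0 <= h z) ->
  (forall z, k z != 0 -> f (x + z) + f (x - z) <= 2 * f x + h z) ->
  (conv k f x + conv k f x <=
    (2 * f x)%:E * \int[mu]_z (k z)%:E + \int[mu]_z (h z * k z)%:E)%E.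
Proof.
move=> mf f0 mh h0 fh.
have f2 : 0 <= 2 * f x by rewrite mulr_ge0.
rewrite conv_symmetric// -ge0_integralZl//; last 2 first.
- exact/measurable_EFinP.
- by move=> z _; rewrite lee_fin.
have m1 : measurable_fun setT (fun z => ((f (x + z) + f (x - z)) * k z)%:E).
  apply/measurable_EFinP; apply: measurable_funM => //; apply: measurable_funD.
    exact: measurable_fun_shift.
  exact: measurable_fun_reflect.
have m2 : measurable_fun setT (fun z => (h z * k z)%:E).
  by apply/measurable_EFinP; exact: measurable_funM.
have m3 : measurable_fun setT (fun z => (2 * f x)%:E * (k z)%:E)%E.
  by apply: emeasurable_funM => //; exact/measurable_EFinP.
rewrite -ge0_integralD//; last 2 first.
- by move=> z _; rewrite -EFinM lee_fin mulr_ge0.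
- by move=> z _; rewrite lee_fin mulr_ge0.
apply: ge0_le_integral => //.
- by move=> z _; rewrite lee_fin mulr_ge0// addr_ge0.
- exact: emeasurable_funD.
- move=> z _; rewrite -EFinM -EFinD lee_fin -mulrDl.
  have [->|kz] := eqVneq (k z) 0; first by rewrite !mulr0.
  by rewrite ler_wpM2r// fh.
Qed.

End even_kernel.

Definition riesz A z : R := \1_A z * enorm z `^ (- (D + alpha)).

Definition outside (e : R) : set 'rV[R]_d := [set z | e < enorm z].
Definition shell (e e' : R) : set 'rV[R]_d := [set z | e < enorm z <= e'].

Lemma riesz_ge0 A z : 0 <= riesz A z.
Proof. by rewrite mulr_ge0 ?powR_ge0. Qed.

Lemma measurable_riesz A : measurable A -> measurable_fun setT (riesz A).
Proof.
move=> mA; apply: measurable_funM; first exact: measurable_indic.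
exact: (measurableT_comp (measurable_powR _) measurable_enorm).
Qed.

Lemma measurable_outside e : measurable (outside e).
Proof. by apply: measurable_gt_lvl; exact: measurable_enorm. Qed.

Lemma measurable_shell e e' : measurable (shell e e').
Proof. by apply: measurable_gt_le_lvl; exact: measurable_enorm. Qed.

Lemma riesz_even A z : (forall x, A x -> A (- x)) -> riesz A (- z) = riesz A z.
Proof.
move=> AN; rewrite /riesz enormN !indicE; congr (_%:R * _); congr nat_of_bool.
by apply/idP/idP; rewrite !inE => /AN; rewrite ?opprK.
Qed.

Lemma outside_even e z : outside e z -> outside e (- z).
Proof. by rewrite /outside/= enormN. Qed.

Lemma shell_even e e' z : shell e e' z -> shell e e' (- z).
Proof. by rewrite /shell/= enormN. Qed.

Lemma integral_rieszM A h : measurable A -> measurable_fun setT h ->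
  (forall z, 0 <= h z) ->
  (\int[mu]_z (h z * riesz A z)%:E =
   \int[mu]_(z in A) (h z * enorm z `^ (- (D + alpha)))%:E)%E.
Proof.
move=> mA mh h0; rewrite [RHS]integral_mkcond; apply: eq_integral => z _.
rewrite /patch /riesz indicE; case: ifPn => _; first by rewrite mul1r.
by rewrite mul0r mulr0.
Qed.

(** [2 ^+ d] is the volume growth constant of [lebesgue_rV_enorm_le]. In [near_cst] the weight |z|^s
    against the kernel leaves |z|^((s - alpha) - d), hence the parameter [s - alpha]. *)
Definition far_cst : R := dyadic_cst (2 ^+ d) D alpha.
Definition near_cst (s : R) : R := dyadic_cst (2 ^+ d) D (s - alpha).

Lemma far_cst_ge0 : 0 <= far_cst.
Proof. by apply: dyadic_cst_ge0; rewrite ?exprn_ge0. Qed.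

Lemma near_cst_ge0 s : alpha < s -> 0 <= near_cst s.
Proof. by move=> s0; apply: dyadic_cst_ge0; rewrite ?exprn_ge0 ?subr_gt0. Qed.

Lemma integral_riesz_outside e : 0 < e ->
  (\int[mu]_z (riesz (outside e) z)%:E <= (far_cst * e `^ (- alpha))%:E)%E.
Proof.
move=> e0; under eq_integral do rewrite -[riesz _ _]mul1r.
rewrite (@integral_rieszM (outside e) (fun=> 1))//; last exact: measurable_outside.
under eq_integral do rewrite mul1r.
apply: (@integral_powR_far R _ _ mu _ measurable_enorm _ _ _ (ler0n _ d)) => //.
exact: lebesgue_rV_enorm_le.
Qed.

Lemma integral_powR_riesz_near s e : alpha < s -> 0 < e ->
  (\int[mu]_z (enorm z `^ s * riesz (shell 0 e) z)%:E
    <= (near_cst s * e `^ (s - alpha))%:E)%E.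
Proof.
move=> sa e0.
rewrite (@integral_rieszM (shell 0 e) (fun z => enorm z `^ s)); last 3 first.
- exact: measurable_shell.
- exact: (measurableT_comp (measurable_powR _) measurable_enorm).
- by move=> z; exact: powR_ge0.
rewrite (_ : integral _ _ _ = \int[mu]_(z in shell 0 e) (enorm z `^ (s - alpha - D))%:E)%E.
  apply: (@integral_powR_near R _ _ mu _ measurable_enorm) => //.
  - exact: lebesgue_rV_enorm_le.
  - by rewrite subr_gt0.
apply: eq_integral => z; rewrite inE => /andP[z0 _].
rewrite -powRD; last by rewrite (gt_eqF z0) implybT.
by congr ((_ `^ _)%:E); ring.
Qed.

Definition barrier_cst : R := 2 * near_cst 2 + 2 * far_cst.

Lemma barrier_cst_ge0 : 0 <= barrier_cst.
Proof. by rewrite addr_ge0// mulr_ge0 ?far_cst_ge0 ?near_cst_ge0. Qed.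

(** For |z| <= r the quadratic term is used and converges at the origin since alpha < 2; for |z| > r
    the constant 1 is used and converges at infinity since alpha > 0. Both parts scale like
    r^(-alpha), independently of the cutoff e, and give the two terms of [barrier_cst]. *)
Lemma integral_barrier r e : 0 < r -> 0 < e ->
  (\int[mu]_z (2 * Num.min 1 (enorm z ^+ 2 / r ^+ 2) * riesz (outside e) z)%:E
    <= (barrier_cst * r `^ (- alpha))%:E)%E.
Proof.
move=> r0 e0.
have mr2 : measurable_fun setT (fun z => enorm z `^ 2 * riesz (shell 0 r) z).
  apply: measurable_funM.
    exact: (measurableT_comp (measurable_powR _) measurable_enorm).
  by apply: measurable_riesz; exact: measurable_shell.
have mo : measurable_fun setT (riesz (outside r)).
  by apply: measurable_riesz; exact: measurable_outside.
have c0 : 0 <= 2 / r ^+ 2 by rewrite divr_ge0 ?exprn_ge0 ?(ltW r0).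
apply: (@le_trans _ _ (\int[mu]_z (
    (2 / r ^+ 2)%:E * (enorm z `^ 2 * riesz (shell 0 r) z)%:E +
    2%:E * (riesz (outside r) z)%:E))%E).
  apply: ge0_le_integral => //.
  - move=> z _; rewrite lee_fin mulr_ge0 ?riesz_ge0// mulr_ge0//.
    rewrite le_min; apply/andP; split=> //.
    by rewrite divr_ge0 ?exprn_ge0 ?enorm_ge0 ?(ltW r0).
  - apply/measurable_EFinP; apply: measurable_funM.
      apply: measurable_funM => //; apply: measurable_minr => //.
      apply: measurable_funM => //; apply: measurable_funX; exact: measurable_enorm.
    by apply: measurable_riesz; exact: measurable_outside.
  - by apply: emeasurable_funD; apply: emeasurable_funM => //; exact/measurable_EFinP.
  - move=> z _; rewrite -!EFinM -EFinD lee_fin.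
    rewrite powR_mulrn ?enorm_ge0// /riesz !indicE.
    set p := enorm z `^ _; have p0 : 0 <= p by exact: powR_ge0.
    have [ez|ez] := boolP (z \in outside e); last first.
      rewrite mul0r mulr0; apply: addr_ge0; apply: mulr_ge0 => //.
        by rewrite mulr_ge0 ?exprn_ge0 ?enorm_ge0 ?mulr_ge0.
      by rewrite mulr_ge0.
    have z0 : 0 < enorm z by exact: lt_trans e0 (set_mem ez).
    have [rz|rz] := lerP (enorm z) r.
      rewrite (mem_set (_ : shell 0 r z)); last by rewrite /shell/= z0.
      rewrite (memNset (_ : ~ outside r z)); last by rewrite /outside/=; apply/negP; rewrite -leNgt.
      rewrite !mul1r !mul0r mulr0 addr0 mulrA ler_wpM2r//.
      rewrite [leRHS]mulrAC -[leRHS]mulrA ler_wpM2l//.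
      by rewrite ge_min lexx orbT.
    rewrite (memNset (_ : ~ shell 0 r z)); last by rewrite /shell/= z0/= leNgt rz.
    rewrite (mem_set (_ : outside r z))//.
    rewrite !mul1r !mul0r !mulr0 add0r ler_wpM2r// ler_piMr//.
    by rewrite ge_min lexx.
rewrite ge0_integralD//; last 4 first.
- move=> z _; rewrite -EFinM lee_fin; apply: mulr_ge0 => //.
  by rewrite mulr_ge0 ?powR_ge0 ?riesz_ge0.
- by apply: emeasurable_funM => //; exact/measurable_EFinP.
- by move=> z _; rewrite mule_ge0 ?lee_fin ?riesz_ge0.
- by apply: emeasurable_funM => //; exact/measurable_EFinP.
rewrite !ge0_integralZl//; last 4 first.
- exact/measurable_EFinP.
- by move=> z _; rewrite lee_fin riesz_ge0.
- exact/measurable_EFinP.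
- by move=> z _; rewrite lee_fin mulr_ge0 ?powR_ge0 ?riesz_ge0.
rewrite {1}/barrier_cst [X in (_ <= X%:E)%E]mulrDl [leRHS]EFinD; apply: leeD.
  apply: (@le_trans _ _ ((2 / r ^+ 2)%:E * (near_cst 2 * r `^ (2 - alpha))%:E)%E).
    by rewrite lee_wpmul2l//; exact: integral_powR_riesz_near.
  rewrite -EFinM lee_fin powRD ?(gt_eqF r0) ?implybT// powR_mulrn ?(ltW r0)//.
  rewrite le_eqVlt; apply/orP; left; apply/eqP; field.
  by rewrite (gt_eqF r0).
apply: (@le_trans _ _ (2%:E * (far_cst * r `^ (- alpha))%:E)%E).
  by rewrite lee_wpmul2l//; exact: integral_riesz_outside.
by rewrite -EFinM mulrA.
Qed.

End truncated_kernel.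

(** * Truncated fractional Laplacians *)

Section truncated_laplacian.
Context {R : realType} {d : nat}.
Variable alpha : R.
Hypotheses (alpha_gt0 : 0 < alpha) (alpha_lt2 : alpha < 2).
Implicit Types (x y z : 'rV[R]_d) (f g : 'rV[R]_d -> R) (e : R).
Local Notation mu := (@lebesgue_rV R d).
Local Notation D := (d%:R : R).
Local Notation K e := (@riesz R d alpha (@outside R d e)).

Lemma K_even e z : K e (- z) = K e z.
Proof. by apply: riesz_even => y; exact: outside_even. Qed.

Lemma measurable_K e : measurable_fun setT (K e).
Proof. by apply: measurable_riesz; exact: measurable_outside. Qed.

Lemma mass_K_fin_num e : 0 < e -> (\int[mu]_z (K e z)%:E)%E \is a fin_num.
Proof.
move=> e0; rewrite ge0_fin_numE; last first.
  by apply: integral_ge0 => z _; rewrite lee_fin riesz_ge0.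
exact: le_lt_trans (integral_riesz_outside alpha_gt0 e0) (ltry _).
Qed.

(** If t = |x - y| > e then |y| <= |x| + t <= t (|x|/e + 1); dividing 1 + |y|^p by t^p gives the two
    terms of [C]. The weighted class [L1_omega] thus yields finite truncated convolutions. *)
Lemma K_le_omega e x : 0 < e -> exists2 C : R, 0 <= C &
  forall y, K e (x - y) <= C * omega alpha y.
Proof.
move=> e0; pose p := D + alpha; have p0 : 0 < p by rewrite ltr_wpDl.
pose C := e `^ (- p) + (enorm x / e + 1) `^ p.
have xe0 : 0 <= enorm x / e by rewrite divr_ge0 ?enorm_ge0 ?(ltW e0).
exists C => [|y]; first by rewrite addr_ge0 ?powR_ge0.
have o0 : 0 < 1 + enorm y `^ p by rewrite ltr_pwDl ?powR_ge0.
rewrite /omega -/p /riesz indicE -/p ler_pdivlMr//.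
have [h|_] := boolP (x - y \in outside e); last first.
  by rewrite !mul0r addr_ge0 ?powR_ge0.
have {}h : e < enorm (x - y) := set_mem h.
have t0 : 0 < enorm (x - y) := lt_trans e0 h.
have tp0 : 0 < enorm (x - y) `^ p by rewrite powR_gt0.
rewrite mul1r powRN mulrC (ler_pdivrMr _ _ tp0) /C mulrDl; apply: lerD.
  rewrite powRN mulrC ler_pdivlMr ?powR_gt0// mul1r.
  by apply: ge0_ler_powR; rewrite ?nnegrE ?(ltW e0) ?(ltW t0) ?(ltW p0) ?(ltW h).
rewrite -powRM ?addr_ge0 ?(ltW t0)//.
apply: ge0_ler_powR; rewrite ?nnegrE ?enorm_ge0 ?(ltW p0)//.
  by rewrite mulr_ge0 ?(ltW t0)// addr_ge0.
have := ler_enormB x (x - y); rewrite subKr => /le_trans; apply.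
rewrite mulrDl mul1r lerD2r mulrAC ler_pdivlMr//.
by rewrite ler_wpM2l ?enorm_ge0 ?(ltW h).
Qed.

Lemma conv_K_fin_num f e x : 0 < e -> measurable_fun setT f -> (forall y, 0 <= f y) ->
  L1_omega alpha f -> conv (K e) f x \is a fin_num.
Proof.
move=> e0 mf f0 /integrableP[mo]; have [C C0 KC] := K_le_omega x e0.
have o0 y : 0 <= omega alpha y by rewrite invr_ge0 addr_ge0 ?powR_ge0.
move=> fo; have cge : (0 <= conv (K e) f x)%E by apply: conv_ge0 => // z; exact: riesz_ge0.
rewrite ge0_fin_numE// conv_sub//; [|exact: riesz_ge0|exact: measurable_K|exact: K_even].
apply: (@le_lt_trans _ _ (\int[mu]_y (C%:E * `|(f y * omega alpha y)%:E|))%E).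
  apply: ge0_le_integral => //.
  - by move=> y _; rewrite lee_fin mulr_ge0 ?riesz_ge0.
  - apply/measurable_EFinP; apply: measurable_funM => //.
    by apply: measurable_fun_reflect; exact: measurable_K.
  - apply: emeasurable_funM => //; exact: measurableT_comp.
  - move=> y _; rewrite abse_EFin -EFinM lee_fin ger0_norm ?mulr_ge0//.
    by rewrite [leRHS]mulrCA ler_wpM2l.
rewrite ge0_integralZl//; last exact: measurableT_comp.
by rewrite lte_mul_pinfty.
Qed.

(** The truncated operator without its normalizing constant, split into two terms that are
    separately finite for e > 0 when f is nonnegative, measurable and in [L1_omega]. *)
Definition trunc e f x : R :=
  f x * fine (\int[mu]_z (K e z)%:E)%E - fine (conv (K e) f x).

Lemma truncE e f x : 0 < e -> measurable_fun setT f -> (forall y, 0 <= f y) ->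
  conv (K e) f x \is a fin_num ->
  (\int[mu]_(y in [set y | e < enorm (x - y)])
    ((f x - f y) / enorm (x - y) `^ (D + alpha)))%R = trunc e f x.
Proof.
move=> e0 mf f0 cf; rewrite /Rintegral /trunc.
have mK := measurable_K e; have Ke := K_even e.
have K0 z : 0 <= K e z := riesz_ge0 _ _ _.
have mKx : measurable_fun setT (fun y => K e (x - y)) by exact: measurable_fun_reflect.
have f0' y : 0 <= cst (f x) y :> R by exact: f0.
have E1 : (\int[mu]_y (f x * K e (x - y))%:E = (f x)%:E * \int[mu]_z (K e z)%:E)%E.
  rewrite -(conv_sub _ _ _ x (@measurable_cst _ _ _ _ setT (f x)))//.
  rewrite /conv /=; under eq_integral do rewrite EFinM.
  rewrite ge0_integralZl//; [exact/measurable_EFinP|by move=> z _; rewrite lee_fin|by rewrite lee_fin].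
have E2 := conv_sub K0 mK Ke x mf f0.
have Kfin := mass_K_fin_num e0.
have -> : f x * fine (\int[mu]_z (K e z)%:E)%E =
    fine ((f x)%:E * \int[mu]_z (K e z)%:E)%E by rewrite fineM.
rewrite -fineB; [|by rewrite fin_numM|exact: cf]; rewrite -E1 E2; congr fine.
have i1 : mu.-integrable setT (fun y => (f x * K e (x - y))%:E).
  apply/integrableP; split; first by apply/measurable_EFinP; exact: measurable_funM.
  rewrite (_ : (fun _ => _) = fun y => (f x * K e (x - y))%:E); last first.
    by apply/funext => y; rewrite abse_EFin (ger0_norm (mulr_ge0 (f0 _) (K0 _))).
  by rewrite E1 ltey_eq fin_numM.
have i2 : mu.-integrable setT (fun y => (f y * K e (x - y))%:E).
  apply/integrableP; split; first by apply/measurable_EFinP; exact: measurable_funM.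
  rewrite (_ : (fun _ => _) = fun y => (f y * K e (x - y))%:E); last first.
    by apply/funext => y; rewrite abse_EFin (ger0_norm (mulr_ge0 (f0 _) (K0 _))).
  by rewrite -E2 ltey_eq cf.
rewrite -integralB; [|exact: measurableT|exact: i1|exact: i2].
rewrite integral_mkcond; apply: eq_integral => y _.
rewrite /patch /riesz indicE -EFinB -mulrBl.
have -> : (x - y \in outside e) = (y \in [set y | e < enorm (x - y)]).
  by apply/idP/idP; rewrite !inE.
by case: ifPn => _; [rewrite mul1r powRN|rewrite mul0r mulr0].
Qed.

End truncated_laplacian.

(** * Second differences of regular functions *)

Section second_difference.
Context {R : realType} {d : nat}.
Implicit Types (x y z : 'rV[R]_d) (f g : 'rV[R]_d -> R) (K : set 'rV[R]_d).

Lemma derive_coord f x z : differentiable f x ->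
  'D_z f x = \sum_(i < d) z ord0 i * 'D_(delta_mx ord0 i) f x.
Proof.
move=> df; rewrite deriveE// {1}(row_sum_delta z) linear_sum.
by apply: eq_bigr => i _; rewrite linearZ/= deriveE.
Qed.

Lemma is_derive_line f x z (t : R) : differentiable f (x + t *: z) ->
  is_derive t 1 (fun s : R => f (x + s *: z)) ('D_z f (x + t *: z)).
Proof.
move=> df; pose h (s : R^o) : 'rV[R]_d := x + s *: z.
have dh : is_diff t h (fun s => s *: z).
  rewrite (_ : (fun _ => _) = (cst 0 + (fun s : R => s *: z))); last first.
    by apply/funext => s /=; rewrite add0r.
  exact: is_diffD.
have dfh : differentiable (f \o h) t by apply: differentiable_comp => //; exact: ex_diff.
have dv : derivable (f \o h) t 1 by exact: diff_derivable.
have -> : 'D_z f (x + t *: z) = 'D_1 (f \o h) t.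
  by rewrite [RHS]deriveE// diff_comp//= [in RHS]diff_val scale1r deriveE.
exact: derivableP.
Qed.

Definition segment_closed K := forall x y (t : R), K x -> K y -> 0 <= t <= 1 ->
  K (y + t *: (x - y)).

Lemma Ck_holder_bounded k sigma K f : compact K -> 0 < sigma ->
  Ck_holder_on k sigma K f -> exists2 B : R, 0 <= B & forall x, K x -> `|f x| <= B.
Proof.
move=> cK s0 hf.
have [K0|/set0P K0] := eqVneq K set0; first by exists 0 => // x; rewrite K0.
case: k hf => [|k] /=; last first.
  move=> [df _].
  have cf : {within K, continuous (fun x => `|f x|)}.
    apply: continuous_in_subspaceT => x; rewrite inE => Kx.
    apply: (@continuous_comp _ _ _ f (fun t : R => `|t|)); last exact: norm_continuous.
    exact/differentiable_continuous/df.
  have [c _ cM] := EVT_max_rV K0 cK cf.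
  by exists `|f c| => // x Kx; apply: cM; rewrite inE.
move=> [C hC]; have [x0 Kx0] := K0.
have [c _ cM] := EVT_max_rV K0 cK (continuous_subspaceT (@continuous_enorm R d)).
exists (`|f x0| + `|C| * (enorm c + enorm x0) `^ sigma) => [|x Kx].
  by rewrite addr_ge0// mulr_ge0// powR_ge0.
have := ler_normD (f x0) (f x - f x0); rewrite subrKC => /le_trans; apply.
rewrite lerD2l.
apply: (le_trans (hC _ _ Kx Kx0)); apply: (@le_trans _ _ (`|C| * enorm (x - x0) `^ sigma)).
  by rewrite ler_wpM2r ?powR_ge0// ler_norm.
rewrite ler_wpM2l// ge0_ler_powR ?nnegrE ?addr_ge0 ?enorm_ge0 ?(ltW s0)//.
by apply: (le_trans (ler_enormB _ _)); rewrite lerD2r; apply: cM; rewrite inE.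
Qed.

(** Mean value theorem along the segment, with gradients bounded on the compact set. It reduces
    regularity of order above 2 to a Lipschitz gradient. *)
Lemma Ck_holder_lipschitz k sigma K f : compact K -> segment_closed K -> 0 < sigma ->
  Ck_holder_on k.+1 sigma K f -> holder_on 1 K f.
Proof.
move=> cK sK s0 [df hf].
have /choice[B hB] i : exists B : R, 0 <= B /\ forall x, K x -> `|'D_(delta_mx ord0 i) f x| <= B.
  by have [B] := Ck_holder_bounded cK s0 (hf i); exists B.
exists (\sum_(i < d) B i) => x y Kx Ky; rewrite powRr1 ?enorm_ge0//.
pose g (t : R) := f (y + t *: (x - y)).
have dg (t : R) : 0 <= t <= 1 -> is_derive t 1 g ('D_(x - y) f (y + t *: (x - y))).
  by move=> t01; apply: is_derive_line; apply: df; exact: sK.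
have [t||t t01] := @MVT_segment R g (fun t => 'D_(x - y) f (y + t *: (x - y))) 0 1 ler01.
- by rewrite in_itv/= => /andP[t0 t1]; apply: dg; rewrite !ltW.
- apply: derivable_within_continuous => t; rewrite in_itv/= => /dg h.
  exact: ex_derive.
rewrite /g scale0r addr0 scale1r subrKC subr0 mulr1 => ->.
have Kt : K (y + t *: (x - y)) by apply: sK => //; move: t01; rewrite in_itv.
rewrite derive_coord; last exact: df.
apply: (le_trans (ler_norm_sum _ _ _)); rewrite mulr_suml; apply: ler_sum => i _.
rewrite normrM mulrC; apply: ler_pM => //; last exact: coord_le_enorm.
by have [_] := hB i; apply.
Qed.

(** The mean value theorem is applied to t -> f(x + tz) + f(x - tz), so both gradients are taken at
    the same t, at points 2t|z| apart. The Hölder bound of the gradient then adds [sigma] to the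
    exponent 1 of |z|. *)
Lemma holder_second_difference sigma K f x z : 0 < sigma ->
  segment_closed K -> K (x + z) -> K (x - z) -> K x ->
  (forall y, K y -> differentiable f y) ->
  forall C : 'I_d -> R,
  (forall i y y', K y -> K y' -> `|'D_(delta_mx ord0 i) f y - 'D_(delta_mx ord0 i) f y'|
     <= C i * enorm (y - y') `^ sigma) ->
  `|f (x + z) + f (x - z) - 2 * f x| <=
    (\sum_(i < d) `|C i|) * 2 `^ sigma * enorm z `^ (1 + sigma).
Proof.
move=> s0 sK Kp Km Kx df C hC.
have Kpt t : 0 <= t <= 1 -> K (x + t *: z).
  by move=> t01; have := sK _ _ _ Kp Kx t01; rewrite [x + z - x]addrC addKr.
have Kmt t : 0 <= t <= 1 -> K (x + t *: (- z)).
  by move=> t01; have := sK _ _ _ Km Kx t01; rewrite [x - z - x]addrC addKr.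
pose g (t : R) := f (x + t *: z) + f (x + t *: (- z)).
pose g' (t : R) := 'D_z f (x + t *: z) + 'D_(- z) f (x + t *: (- z)).
have dg (t : R) : 0 <= t <= 1 -> is_derive t 1 g (g' t).
  move=> t01; apply: is_deriveD; apply: is_derive_line; apply: df;
    [exact: Kpt|exact: Kmt].
have [t||t t01] := @MVT_segment R g g' 0 1 ler01.
- by rewrite in_itv/= => /andP[t0 t1]; apply: dg; rewrite !ltW.
- apply: derivable_within_continuous => t; rewrite in_itv/= => /dg h.
  exact: ex_derive.
rewrite /g !scale0r !addr0 !scale1r subr0 mulr1 => ge.
rewrite (_ : _ - 2 * f x = f (x + z) + f (x - z) - (f x + f x)); last by ring.
rewrite ge /g'; move: t01; rewrite in_itv/= => t01.
have [Kp' Km'] := (Kpt _ t01, Kmt _ t01); have /andP[t0 t1] := t01.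
rewrite !derive_coord; [|exact: df..].
rewrite -big_split/=; apply: (le_trans (ler_norm_sum _ _ _)).
rewrite !mulr_suml; apply: ler_sum => i _.
rewrite mxE mulNr -mulrBr normrM.
have e1 : enorm z `^ (1 + sigma) = enorm z * enorm z `^ sigma.
  have [->|z0] := eqVneq (enorm z) 0.
    by rewrite mul0r powR0// gt_eqF// addr_gt0.
  by rewrite powRD ?z0 ?implybT// powRr1 ?enorm_ge0.
rewrite e1 mulrCA; apply: ler_pM => //; first exact: coord_le_enorm.
apply: (le_trans (hC _ _ _ Kp' Km')).
apply: (@le_trans _ _ (`|C i| * (2 * enorm z) `^ sigma)); last first.
  by rewrite powRM ?enorm_ge0// mulrA.
apply: (@le_trans _ _ (`|C i| * enorm (x + t *: z - (x + t *: - z)) `^ sigma)).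
  by rewrite ler_wpM2r ?powR_ge0// ler_norm.
rewrite ler_wpM2l// ge0_ler_powR ?nnegrE ?enorm_ge0 ?(ltW s0) ?mulr_ge0 ?enorm_ge0//.
rewrite (_ : x + t *: z - _ = (2 * t) *: z); last first.
  by rewrite scalerN opprD opprK addrACA subrr add0r -scalerDl; congr (_ *: _); ring.
rewrite enormZ ger0_norm ?mulr_ge0// -mulrA ler_wpM2l// ler_piMl ?enorm_ge0//.
Qed.

(** An exponent strictly above alpha makes the second difference integrable against the kernel at
    the origin. For k = 0 it is the Hölder exponent itself, for k = 1 it is 1 + sigma, and for k >=
    2 a Lipschitz gradient gives 2 > alpha. The compact set has radius r + 1 to contain x + z and x
    - z for |z| <= 1. *)
Lemma C_plus_second_difference (alpha r : R) f : 0 < alpha < 2 -> C_plus alpha f ->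
  exists2 s : R, alpha < s & exists2 C : R, 0 <= C &
  forall x z, enorm x <= r -> enorm z <= 1 ->
    `|f (x + z) + f (x - z) - 2 * f x| <= C * enorm z `^ s.
Proof.
move=> /andP[a0 a2] /(_ [set x | enorm x <= r + 1] (@compact_enorm_le _ _ _)).
set K := [set x | _] => -[g g0 [k [sigma [/andP[s0 s1] ags hf]]]].
have cK : compact K by exact: compact_enorm_le.
have sK : segment_closed K.
  move=> x y t /= xr yr /andP[t0 t1].
  rewrite (_ : y + _ = (1 - t) *: y + t *: x); last first.
    by rewrite scalerBr scalerBl scale1r addrA addrAC.
  apply: (le_trans (ler_enormD _ _)); rewrite !enormZ !ger0_norm ?subr_ge0//.
  by rewrite (_ : r + 1 = (1 - t) * (r + 1) + t * (r + 1)); [apply: lerD; apply: ler_wpM2l; rewrite ?subr_ge0|ring].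
have Kp x z : enorm x <= r -> enorm z <= 1 -> K (x + z).
  by move=> xr z1; apply: (le_trans (ler_enormD _ _)); exact: lerD.
have Km x z : enorm x <= r -> enorm z <= 1 -> K (x - z).
  by move=> xr z1; apply: Kp; rewrite ?enormN.
have Kx x : enorm x <= r -> K x by move=> xr; rewrite /K/= (le_trans xr)// lerDl.
have key tau : 0 < tau -> alpha < 1 + tau -> (forall y, K y -> differentiable f y) ->
    (forall i, holder_on tau K ('D_(delta_mx ord0 i) f)) ->
    exists2 s : R, alpha < s & exists2 C : R, 0 <= C &
      forall x z, enorm x <= r -> enorm z <= 1 ->
      `|f (x + z) + f (x - z) - 2 * f x| <= C * enorm z `^ s.
  move=> t0 at1 df /choice[C hC]; exists (1 + tau) => //.
  exists ((\sum_(i < d) `|C i|) * 2 `^ tau).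
    by rewrite mulr_ge0 ?powR_ge0// sumr_ge0.
  move=> x z xr z1.
  by apply: (@holder_second_difference tau K) => //; [exact: Kp|exact: Km|exact: Kx].
case: k => [|[|k]] in ags hf *.
- case: hf => C hC; exists sigma; first by lra.
  exists (2 * `|C|) => [|x z xr z1]; first exact: mulr_ge0.
  rewrite (_ : _ - 2 * f x = (f (x + z) - f x) + (f (x - z) - f x)); last by ring.
  have hz w : enorm w <= 1 -> `|f (x + w) - f x| <= `|C| * enorm w `^ sigma.
    move=> w1; apply: (le_trans (hC _ _ (Kp _ _ xr w1) (Kx _ xr))).
    by rewrite addrC addKr ler_wpM2r ?powR_ge0// ler_norm.
  apply: (le_trans (ler_normD _ _)).
  rewrite (_ : 2 * _ * _ = `|C| * enorm z `^ sigma + `|C| * enorm z `^ sigma); last by ring.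
  apply: lerD; first exact: hz.
  by have := hz (- z); rewrite enormN => ->.
- case: hf => df hf; apply: (key sigma) => //; lra.
- case: hf => df hf; apply: (key 1 ltr01 _ df); first by clear - a2; lra.
  by move=> i; exact: Ck_holder_lipschitz s0 (hf i).
Qed.

End second_difference.

(** * Pointwise convergence of the truncated operators *)

(** The Cauchy rate passes to the limit with the same constant; constants uniform in a parameter
    therefore give uniform convergence. *)
Lemma powR_cauchy_at_right (R : realType) (g : R -> R) (C kappa : R) :
  0 <= C -> 0 < kappa ->
  (forall e e', 0 < e -> e <= e' -> e' <= 1 -> `|g e - g e'| <= C * e' `^ kappa) ->
  cvg (g e @[e --> 0^'+]) /\
  forall e, 0 < e -> e <= 1 -> `|g e - lim (g t @[t --> 0^'+])| <= C * e `^ kappa.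
Proof.
move=> C0 k0 gC.
have Ck : C * e `^ kappa @[e --> 0^'+] --> (0 : R).
  by rewrite -[X in _ --> X](mulr0 C); apply: cvgM; [exact: cvg_cst|exact: powR_cvg0].
have cg : cvg (g e @[e --> 0^'+]).
  apply/cauchy_cvgP; apply: cauchy_exP => eps eps0.
  have [e [e0 e1 eC]] : exists e, [/\ 0 < e, e <= 1 & C * e `^ kappa < eps].
    near (0 : R)^'+ => e; exists e; split.
    - by near: e; exact: nbhs_right_gt.
    - by near: e; exact: nbhs_right_le.
    - near: e; have /cvgr0Pnorm_lt/(_ _ eps0) := Ck; apply: filterS => t.
      by apply: le_lt_trans; exact: ler_norm.
  exists (g e); suff : \forall t \near 0^'+, ball (g e) eps (g t) by [].
  near=> t; rewrite /ball /= distrC; apply: (le_lt_trans _ eC).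
  by apply: gC; [near: t; exact: nbhs_right_gt|near: t; exact: nbhs_right_le|exact: e1].
split=> // e e0 e1; rewrite distrC ler_distl; apply/andP; split.
  apply: limr_ge => //; near=> t.
  have : `|g t - g e| <= C * e `^ kappa.
    by apply: gC; [near: t; exact: nbhs_right_gt|near: t; exact: nbhs_right_le|exact: e1].
  by rewrite ler_distl => /andP[].
apply: limr_le => //; near=> t.
have : `|g t - g e| <= C * e `^ kappa.
  by apply: gC; [near: t; exact: nbhs_right_gt|near: t; exact: nbhs_right_le|exact: e1].
by rewrite ler_distl => /andP[].
Unshelve. all: by end_near. Qed.

Section fractional_limit.
Context {R : realType} {d : nat}.
Variable alpha : R.
Hypotheses (alpha_gt0 : 0 < alpha) (alpha_lt2 : alpha < 2).
Implicit Types (x y z : 'rV[R]_d) (f g : 'rV[R]_d -> R) (e : R).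
Local Notation mu := (@lebesgue_rV R d).
Local Notation D := (d%:R : R).
Local Notation K e := (@riesz R d alpha (@outside R d e)).
Local Notation Sh e e' := (@riesz R d alpha (@shell R d e e')).

Lemma Sh_even e e' z : Sh e e' (- z) = Sh e e' z.
Proof. by apply: riesz_even => y; exact: shell_even. Qed.

Lemma measurable_Sh e e' : measurable_fun setT (Sh e e').
Proof. by apply: measurable_riesz; exact: measurable_shell. Qed.

Lemma riesz_outside_split e e' z : e <= e' -> K e z = Sh e e' z + K e' z.
Proof.
move=> ee; rewrite /riesz -mulrDl !indicE; congr (_ * _).
have [ze|ze] := lerP (enorm z) e'; last first.
  rewrite (mem_set (_ : outside e z)) ?(mem_set (_ : outside e' z))//; last first.
    exact: le_lt_trans ze.
  by rewrite memNset ?add0r// /shell/= [X in _ && X]leNgt ze andbF.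
rewrite (memNset (_ : ~ outside e' z)) ?addr0; last by rewrite /outside/=; apply/negP; rewrite -leNgt.
have [ez|ez] := ltP e (enorm z).
  by rewrite (mem_set (_ : outside e z))// (mem_set (_ : shell e e' z))// /shell/= ez.
rewrite (memNset (_ : ~ outside e z)); last by rewrite /outside/=; apply/negP; rewrite -leNgt.
by rewrite memNset// /shell/= ltNge ez.
Qed.

Lemma conv_outside_split f x e e' : e <= e' -> measurable_fun setT f ->
  (forall y, 0 <= f y) -> conv (K e) f x = (conv (Sh e e') f x + conv (K e') f x)%E.
Proof.
move=> ee mf f0; rewrite /conv -ge0_integralD.
- by apply: eq_integral => z _; rewrite -EFinD -mulrDr -riesz_outside_split.
- exact: measurableT.
- by move=> z _; rewrite lee_fin; apply: mulr_ge0; [exact: f0|exact: riesz_ge0].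
- apply/measurable_EFinP; apply: measurable_funM; first exact: measurable_fun_shift.
  exact: measurable_Sh.
- by move=> z _; rewrite lee_fin; apply: mulr_ge0; [exact: f0|exact: riesz_ge0].
- apply/measurable_EFinP; apply: measurable_funM; first exact: measurable_fun_shift.
  exact: measurable_K.
Qed.

(** Two truncations differ by the mass of a shell times f(x) minus the convolution over that shell.
    By evenness this is minus half the integral of the second difference, of order |z|^s near the
    origin. *)
Lemma trunc_cauchy f x (s C : R) (e e' : R) : alpha < s -> 0 <= C ->
  measurable_fun setT f -> (forall y, 0 <= f y) -> L1_omega alpha f ->
  0 < e -> e <= e' -> e' <= 1 ->
  (forall z, enorm z <= 1 ->
     `|f (x + z) + f (x - z) - 2 * f x| <= C * enorm z `^ s) ->
  `|trunc alpha e f x - trunc alpha e' f x|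
    <= C * @near_cst R d alpha s * e' `^ (s - alpha).
Proof.
move=> as_ C0 mf f0 fo e0 ee e1 fC; have e0' : 0 < e' by exact: lt_le_trans ee.
have S0 : forall z, 0 <= Sh e e' z by move=> z; exact: riesz_ge0.
have mS := measurable_Sh e e'; have Se := Sh_even e e'.
pose h z := C * enorm z `^ s.
have h0 z : 0 <= h z by rewrite mulr_ge0 ?powR_ge0.
have mh : measurable_fun setT h.
  apply: measurable_funM; first exact: measurable_cst.
  exact: (measurableT_comp (measurable_powR _) measurable_enorm).
have hbd z : Sh e e' z != 0 -> `|f (x + z) + f (x - z) - 2 * f x| <= h z.
  rewrite /riesz indicE; case: (boolP (z \in shell e e')) => [ze _|_]; last by rewrite mul0r eqxx.
  by apply: fC; have /andP[_ ze'] := set_mem ze; exact: le_trans e1.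
have intC : (\int[mu]_z (h z * Sh e e' z)%:E <=
    (C * @near_cst R d alpha s * e' `^ (s - alpha))%:E)%E.
  (* Filling the hole of the shell makes the bound depend on the outer radius e' only. *)
  apply: (@le_trans _ _ (\int[mu]_z (C%:E * (enorm z `^ s * Sh 0 e' z)%:E))%E).
    apply: ge0_le_integral.
    - exact: measurableT.
    - by move=> z _; rewrite lee_fin mulr_ge0.
    - by apply/measurable_EFinP; exact: measurable_funM.
    - apply: emeasurable_funM; first exact: measurable_cst.
      apply/measurable_EFinP; apply: measurable_funM; last exact: measurable_Sh.
      exact: (measurableT_comp (measurable_powR _) measurable_enorm).
    - move=> z _; rewrite -EFinM lee_fin /h -mulrA.
      apply: ler_wpM2l => //; apply: ler_wpM2l; first exact: powR_ge0.
      rewrite /riesz; apply: ler_wpM2r; first exact: powR_ge0.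
      rewrite !indicE; case: (boolP (z \in shell e e')) => // /set_mem/andP[ez ze].
      by rewrite mem_set// /shell/= ze (lt_trans e0 ez).
  rewrite ge0_integralZl; [|exact: measurableT| | |by rewrite lee_fin].
  - rewrite -mulrA EFinM; apply: lee_wpmul2l; first by rewrite lee_fin.
    exact: integral_powR_riesz_near.
  - apply/measurable_EFinP; apply: measurable_funM; last exact: measurable_Sh.
    exact: (measurableT_comp (measurable_powR _) measurable_enorm).
  - by move=> z _; rewrite lee_fin; apply: mulr_ge0; [exact: powR_ge0|exact: riesz_ge0].
have cK e1' : 0 < e1' -> conv (K e1') f x \is a fin_num.
  by move=> ?; exact: conv_K_fin_num.
have mK e1' : 0 < e1' -> (\int[mu]_z (K e1' z)%:E)%E \is a fin_num.
  by move=> ?; exact: mass_K_fin_num.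
have cspl := conv_outside_split x ee mf f0.
have mspl : (\int[mu]_z (K e z)%:E = \int[mu]_z (Sh e e' z)%:E + \int[mu]_z (K e' z)%:E)%E.
  have := @conv_outside_split (fun=> 1) x e e' ee (measurable_cst _) (fun=> ler01).
  have E k : conv k (fun=> 1) x = (\int[mu]_z (k z)%:E)%E.
    by apply: eq_integral => z _; rewrite mul1r.
  by rewrite !E.
have cS : conv (Sh e e') f x \is a fin_num.
  by move: (cK _ e0); rewrite cspl fin_numD => /andP[].
have mSf : (\int[mu]_z (Sh e e' z)%:E)%E \is a fin_num.
  by move: (mK _ e0); rewrite mspl fin_numD => /andP[].
have ge : (2 * f x * fine (\int[mu]_z (Sh e e' z)%:E)%E <=
    2 * fine (conv (Sh e e') f x) + C * @near_cst R d alpha s * e' `^ (s - alpha)).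
  have H : ((2 * f x)%:E * \int[mu]_z (Sh e e' z)%:E <= conv (Sh e e') f x +
      conv (Sh e e') f x + \int[mu]_z (h z * Sh e e' z)%:E)%E.
    apply: (conv_second_difference_ge S0 mS Se mf f0 mh h0) => z /hbd.
    by rewrite ler_norml => /andP[]; lra.
  have := le_trans H (leeD (lexx _) intC).
  rewrite -(fineK cS) -(fineK mSf) -EFinM -!EFinD lee_fin => ?; lra.
have le : (2 * fine (conv (Sh e e') f x) <=
  2 * f x * fine (\int[mu]_z (Sh e e' z)%:E)%E + C * @near_cst R d alpha s * e' `^ (s - alpha)).
  have H : (conv (Sh e e') f x + conv (Sh e e') f x <=
      (2 * f x)%:E * \int[mu]_z (Sh e e' z)%:E + \int[mu]_z (h z * Sh e e' z)%:E)%E.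
    apply: (conv_second_difference_le S0 mS Se mf f0 mh h0) => z /hbd.
    by rewrite ler_norml => /andP[]; lra.
  have := le_trans H (leeD (lexx _) intC).
  rewrite -(fineK cS) -(fineK mSf) -EFinM -!EFinD lee_fin => ?; lra.
have N0 : 0 <= C * @near_cst R d alpha s * e' `^ (s - alpha).
  apply: mulr_ge0; last exact: powR_ge0.
  by apply: mulr_ge0 => //; exact: near_cst_ge0.
have [cKe' mKe'] := (cK _ e0', mK _ e0').
rewrite /trunc cspl mspl (fineD cS cKe') (fineD mSf mKe').
move: ge le; move: (fine (conv (Sh e e') f x)) (fine (\int[mu]_z (Sh e e' z)%:E)%E)
  (fine (conv (K e') f x)) (fine (\int[mu]_z (K e' z)%:E)%E) => c m c' m' ge le.
rewrite [X in `|X|](_ : _ = f x * m - c); last by ring.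
by rewrite ler_norml; apply/andP; split; lra.
Qed.

Lemma measurable_conv (k f : 'rV[R]_d -> R) : measurable_fun setT k -> (forall z, 0 <= k z) ->
  measurable_fun setT f -> (forall y, 0 <= f y) -> measurable_fun setT (conv k f).
Proof.
move=> mk k0 mf f0.
apply: (@measurable_fun_fubini_tonelli_F _ _ _ _ R mu
  (fun p : 'rV[R]_d * 'rV[R]_d => (f (p.1 + p.2) * k p.2)%:E)).
  apply/measurable_EFinP; apply: measurable_funM; last exact: measurableT_comp.
  apply: (measurableT_comp mf); apply: measurable_fun_rV => i.
  rewrite (_ : _ \o _ = (rV_coord i \o fst) \+ (rV_coord i \o snd)); last first.
    by apply/funext => p; rewrite /rV_coord/= mxE.
  by apply: measurable_funD; apply: measurableT_comp => //; exact: measurable_rV_coord.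
by move=> p; rewrite lee_fin; exact: mulr_ge0.
Qed.

Lemma measurable_trunc e f : measurable_fun setT f -> (forall y, 0 <= f y) ->
  measurable_fun setT (trunc alpha e f).
Proof.
move=> mf f0; apply: measurable_funB.
  by apply: measurable_funM => //; exact: measurable_cst.
apply: measurableT_comp => //; apply: measurable_conv => //; first exact: measurable_K.
by move=> z; exact: riesz_ge0.
Qed.

(** [frac_lap] up to the positive factor [frac_lap_cst], for nonnegative regular functions; see
    [frac_lapE]. *)
Definition frac_limit f x : R := lim (trunc alpha e f x @[e --> 0^'+]).

Section nonnegative.
Variable u : 'rV[R]_d -> R.
Hypotheses (u_ge0 : forall x, 0 <= u x) (u_reg : classical_regularity alpha u).

Let cu : continuous u. Proof. by case: u_reg. Qed.

Let meas_u : measurable_fun setT u. Proof. exact: continuous_measurable_rV. Qed.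

Let lu : L1_omega alpha u. Proof. by case: u_reg. Qed.

(** Uniformity over the ball lets [duality] integrate the limit operator against the bump with a
    controlled error. *)
Lemma trunc_uniform r : exists2 kappa : R, 0 < kappa & exists2 C : R, 0 <= C &
  forall x, enorm x <= r -> cvg (trunc alpha e u x @[e --> 0^'+]) /\
  forall e, 0 < e -> e <= 1 ->
    `|trunc alpha e u x - frac_limit u x| <= C * e `^ kappa.
Proof.
have [_ Cu _] := u_reg; have a02 : 0 < alpha < 2 by rewrite alpha_gt0.
have [s as_ [C C0 hC]] := C_plus_second_difference r a02 Cu.
exists (s - alpha); first by rewrite subr_gt0.
exists (C * @near_cst R d alpha s).
  by apply: mulr_ge0 => //; exact: near_cst_ge0.
move=> x xr; apply: powR_cauchy_at_right; rewrite ?subr_gt0//.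
  by apply: mulr_ge0 => //; exact: near_cst_ge0.
move=> e e' e0 ee e1; apply: trunc_cauchy => // z z1; exact: hC.
Qed.

Lemma cvg_trunc x : trunc alpha e u x @[e --> 0^'+] --> frac_limit u x.
Proof.
by have [kappa _ [C _ /(_ x (lexx _))[]]] := trunc_uniform (enorm x).
Qed.

Lemma frac_lapE x : frac_lap alpha u x = @frac_lap_cst R d alpha * frac_limit u x.
Proof.
rewrite /frac_lap; congr (_ * _); apply: cvg_lim; first exact: Rhausdorff.
have := @cvg_trunc x; apply: cvg_trans; apply: near_eq_cvg; near=> e.
have e0 : 0 < e by near: e; exact: nbhs_right_gt.
by apply/esym/truncE => //; exact: conv_K_fin_num.
Unshelve. all: by end_near. Qed.

Lemma measurable_frac_limit : measurable_fun setT (frac_limit u).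
Proof.
apply: (@measurable_fun_cvg _ _ _ _ (fun n => trunc alpha (harmonic n) u)).
  by move=> n; exact: measurable_trunc.
move=> x _; have /cvg_at_rightP := @cvg_trunc x; apply.
by split; [move=> n; exact: harmonic_gt0|exact: cvg_harmonic].
Qed.

End nonnegative.

End fractional_limit.

(** * The quadratic bump *)

Section superharmonic.
Context {R : realType} {d : nat}.
Variable alpha : R.
Hypotheses (alpha_gt0 : 0 < alpha) (alpha_lt2 : alpha < 2).
Implicit Types (x y z : 'rV[R]_d) (f g : 'rV[R]_d -> R) (e r : R).
Local Notation mu := (@lebesgue_rV R d).
Local Notation D := (d%:R : R).
Local Notation K e := (@riesz R d alpha (@outside R d e)).

(** Self-adjointness of convolution with an even kernel. Every integrand is nonnegative, so Tonelli
    applies without integrability. *)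
Lemma conv_adjoint (k f g : 'rV[R]_d -> R) : measurable_fun setT k ->
  (forall z, 0 <= k z) -> (forall z, k (- z) = k z) ->
  measurable_fun setT f -> (forall y, 0 <= f y) ->
  measurable_fun setT g -> (forall y, 0 <= g y) ->
  (\int[mu]_x ((g x)%:E * conv k f x) = \int[mu]_y ((f y)%:E * conv k g y))%E.
Proof.
move=> mk k0 ke mf f0 mg g0.
pose F (p : 'rV[R]_d * 'rV[R]_d) : \bar R := (g p.1 * (f p.2 * k (p.1 - p.2)))%:E.
have mF : measurable_fun setT F.
  apply/measurable_EFinP; apply: measurable_funM; first exact: measurableT_comp.
  apply: measurable_funM; first exact: measurableT_comp.
  apply: (measurableT_comp mk); apply: measurable_fun_rV => i.
  rewrite (_ : _ \o _ = (rV_coord i \o fst) \- (rV_coord i \o snd)); last first.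
    by apply/funext => p; rewrite /rV_coord/= !mxE.
  by apply: measurable_funB; apply: measurableT_comp => //; exact: measurable_rV_coord.
have F0 p : (0 <= F p)%E by rewrite lee_fin; apply: mulr_ge0 => //; exact: mulr_ge0.
have mr f' x : measurable_fun setT f' -> measurable_fun setT (fun y => (f' y * k (x - y))%:E).
  move=> mf'; apply/measurable_EFinP; apply: measurable_funM => //.
  exact: measurable_fun_reflect.
transitivity (\int[mu]_x \int[mu]_y F (x, y))%E.
  apply: eq_integral => x _; rewrite (conv_sub k0 mk ke x mf f0) -ge0_integralZl.
  - by apply: eq_integral => y _; rewrite -EFinM.
  - exact: measurableT.
  - exact: mr.
  - by move=> y _; rewrite lee_fin; exact: mulr_ge0.
  - by rewrite lee_fin.
rewrite (@fubini_tonelli _ _ _ _ R mu mu F mF F0); apply: eq_integral => y _.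
rewrite (conv_sub k0 mk ke y mg g0) -ge0_integralZl.
- apply: eq_integral => x _; rewrite -EFinM /F/=; congr (_%:E).
  by rewrite -(ke (x - y)) opprB mulrCA.
- exact: measurableT.
- exact: mr.
- by move=> x _; rewrite lee_fin; exact: mulr_ge0.
- by rewrite lee_fin.
Qed.

Definition bump r x : R := Num.max 0 (1 - enorm x ^+ 2 / r ^+ 2).

Lemma bump_ge0 r x : 0 <= bump r x.
Proof. by rewrite /bump le_max lexx. Qed.

Lemma bump_ge r x : 1 - enorm x ^+ 2 / r ^+ 2 <= bump r x.
Proof. by rewrite /bump le_max lexx orbT. Qed.

Lemma bump_le1 r x : bump r x <= 1.
Proof.
by rewrite /bump ge_max ler01 gerBl; apply: divr_ge0; exact: sqr_ge0.
Qed.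

Lemma bump_out r x : 0 < r -> r <= enorm x -> bump r x = 0.
Proof.
move=> r0 rx; apply/max_idPl; rewrite subr_le0 ler_pdivlMr ?exprn_gt0// mul1r.
by rewrite ler_sqr ?nnegrE ?enorm_ge0 ?(ltW r0).
Qed.

Lemma bump_half r x : 0 < r -> enorm x <= r / 2 -> 2^-1 <= bump r x.
Proof.
move=> r0 xr; apply: (le_trans _ (bump_ge r x)).
have r2 : 0 < r ^+ 2 by rewrite exprn_gt0.
have : enorm x ^+ 2 / r ^+ 2 <= 4^-1.
  rewrite ler_pdivrMr//; have := enorm_ge0 x; nra.
lra.
Qed.

Lemma continuous_bump r : continuous (bump r).
Proof.
move=> x; apply: (@continuous_comp _ _ _ (@enorm R d)
  (fun t => Num.max 0 (1 - t ^+ 2 / r ^+ 2))); first exact: continuous_enorm.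
apply: continuous_max; first exact: cvg_cst.
apply: cvgB; first exact: cvg_cst.
by apply: cvgM; [exact: exprn_continuous|exact: cvg_cst].
Qed.

Lemma parallelogram x z :
  enorm (x + z) ^+ 2 + enorm (x - z) ^+ 2 = 2 * enorm x ^+ 2 + 2 * enorm z ^+ 2.
Proof.
rewrite !sqr_enorm !mulr_sumr -!big_split/=; apply: eq_bigr => i _.
by rewrite !mxE; ring.
Qed.

(* [bump r] lies above the paraboloid 1 - |x|^2/r^2 and agrees with it where positive,
   so there the parallelogram law bounds its second differences from below. *)
Lemma bump_second_difference r x z : 0 < r ->
  2 * bump r x <= bump r (x + z) + bump r (x - z) +
    2 * Num.min 1 (enorm z ^+ 2 / r ^+ 2).
Proof.
move=> r0; have r2 : 0 < r ^+ 2 by rewrite exprn_gt0.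
have [b1 b2] := (bump_ge0 r (x + z), bump_ge0 r (x - z)).
have [c1 c2] := (bump_ge r (x + z), bump_ge r (x - z)).
have z2 : 0 <= enorm z ^+ 2 / r ^+ 2 by apply: divr_ge0; exact: sqr_ge0.
have q : enorm (x + z) ^+ 2 / r ^+ 2 + enorm (x - z) ^+ 2 / r ^+ 2 =
    2 * (enorm x ^+ 2 / r ^+ 2) + 2 * (enorm z ^+ 2 / r ^+ 2).
  by rewrite -mulrDl parallelogram mulrDl !mulrA.
have x2 : 0 <= enorm x ^+ 2 / r ^+ 2 by apply: divr_ge0; exact: sqr_ge0.
rewrite {1}/bump; move: c1 c2 q x2 z2.
move: (enorm (x + z) ^+ 2 / _) (enorm (x - z) ^+ 2 / _) (enorm x ^+ 2 / _)
  (enorm z ^+ 2 / _) => s1 s2 s3 s4 *.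
(* Where the paraboloid is negative, [bump r x] is 0 and the right side is nonnegative. Otherwise,
   if the minimum is 1, then 2 dominates [2 * bump r x]; if it is the quadratic term, the
   parallelogram law concludes. *)
have [h|h] := lerP 0 (1 - s3); last first.
  by have : 0 <= Num.min 1 s4; [rewrite le_min ler01|lra].
by rewrite minEle; case: ifP => _; lra.
Qed.

Let mbump r : measurable_fun setT (bump r).
Proof. by apply: continuous_measurable_rV; exact: continuous_bump. Qed.

Lemma conv_bump_fin_num r e x : 0 < e -> conv (K e) (bump r) x \is a fin_num.
Proof.
move=> e0; have K0 z : 0 <= K e z := riesz_ge0 _ _ _.
rewrite ge0_fin_numE; last by apply: conv_ge0 => //; exact: bump_ge0.
apply: (@le_lt_trans _ _ (\int[mu]_z (K e z)%:E)%E); last first.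
  by rewrite ltey_eq mass_K_fin_num.
apply: ge0_le_integral.
- exact: measurableT.
- by move=> z _; rewrite lee_fin; apply: mulr_ge0 => //; exact: bump_ge0.
- apply/measurable_EFinP; apply: measurable_funM; last exact: measurable_K.
  exact: measurable_fun_shift.
- by apply/measurable_EFinP; exact: measurable_K.
- by move=> z _; rewrite lee_fin; apply: ler_piMl => //; exact: bump_le1.
Qed.

(** An upper bound for the truncated operator on the bump, uniform in [e] and [x]. Both
    [weak_harnack] and [duality] use the bump's fractional Laplacian only through it. *)
Lemma bump_barrier r e x : 0 < r -> 0 < e ->
  ((bump r x)%:E * \int[mu]_z (K e z)%:E <=
    conv (K e) (bump r) x + (@barrier_cst R d alpha * r `^ (- alpha))%:E)%E.
Proof.
move=> r0 e0; set b := @barrier_cst R d alpha * _.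
have b0 : 0 <= b by apply: mulr_ge0; [exact: barrier_cst_ge0|exact: powR_ge0].
have K0 z : 0 <= K e z := riesz_ge0 _ _ _.
have mh : measurable_fun setT (fun z => 2 * Num.min 1 (enorm z ^+ 2 / r ^+ 2)).
  apply: measurable_funM; first exact: measurable_cst.
  apply: measurable_minr; first exact: measurable_cst.
  apply: measurable_funM; last exact: measurable_cst.
  by apply: measurable_funX; exact: measurable_enorm.
have h0 z : 0 <= 2 * Num.min 1 (enorm z ^+ 2 / r ^+ 2).
  apply: mulr_ge0 => //; rewrite le_min ler01/=.
  by apply: divr_ge0; exact: sqr_ge0.
have H := conv_second_difference_ge K0 (measurable_K alpha e) (K_even alpha e)
  (mbump r) (@bump_ge0 r) mh h0 (fun z _ => bump_second_difference x z r0).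
have {H} := le_trans H (leeD (lexx _) (integral_barrier alpha_gt0 alpha_lt2 r0 e0)).
have mf : (\int[mu]_z (K e z)%:E)%E \is a fin_num by exact: mass_K_fin_num.
rewrite -/b -(fineK mf) -(fineK (conv_bump_fin_num r x e0)).
by rewrite -!EFinM -!EFinD !lee_fin; lra.
Qed.

Lemma integral_indic_enorm_le x e : 0 < e ->
  (\int[mu]_y (\1_[set z : 'rV[R]_d | (enorm z <= e)%R] (x - y)%R)%:E
    <= (2 ^+ d * e ^+ d)%:E)%E.
Proof.
move=> e0; set B := [set z : 'rV[R]_d | _].
have mB : measurable B.
  rewrite (_ : B = @enorm R d @^-1` `]-oo, e]%classic); last first.
    by apply/seteqP; split => y /=; rewrite in_itv.
  by rewrite -[X in measurable X]setTI; exact: measurable_enorm.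
have mI : measurable_fun setT (fun z => (\1_B z)%:E : \bar R).
  by apply/measurable_EFinP; exact: measurable_indic.
have I0 z : (0 <= (\1_B z)%:E :> \bar R)%E by rewrite lee_fin.
have -> : (\int[mu]_y (\1_B (x - y)%R)%:E = \int[mu]_y (\1_B y)%:E)%E.
  rewrite -[RHS](ge0_integral_rVD x mI I0).
  rewrite -[RHS](@ge0_integral_rVN R d (fun z => (\1_B (x + z))%:E)) //.
  exact: (measurableT_comp mI (measurable_rV_add x)).
rewrite integral_indic// setIT -(powR_mulrn d (ltW e0)).
exact: lebesgue_rV_enorm_le.
Qed.

Lemma integral_eball_indic r f : (forall x, 0 <= f x) ->
  (\int[mu]_(x in eball 0 r) (f x)%:E =
   \int[mu]_x (f x * \1_(eball 0 r) x)%:E)%E.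
Proof.
move=> f0; rewrite integral_mkcond; apply: eq_integral => x _.
by rewrite /patch indicE; case: ifP => _; rewrite ?mulr1 ?mulr0.
Qed.

Lemma eball0E r x : eball 0 r x = (enorm x < r).
Proof. by rewrite /eball/= sub0r enormN. Qed.

End superharmonic.

(** * Estimates for superharmonic functions *)

Section superharmonic_estimates.
Context {R : realType} {d : nat}.
Hypothesis d_gt0 : (0 < d)%N.
Variable alpha : R.
Hypotheses (alpha_gt0 : 0 < alpha) (alpha_lt2 : alpha < 2).
Implicit Types (x y z : 'rV[R]_d) (f g : 'rV[R]_d -> R) (e r : R).
Local Notation mu := (@lebesgue_rV R d).
Local Notation D := (d%:R : R).
Local Notation K e := (@riesz R d alpha (@outside R d e)).

Section nonnegative_superharmonic.
Variable u : 'rV[R]_d -> R.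
Hypotheses (u_ge0 : forall x, 0 <= u x) (u_reg : classical_regularity alpha u).
Hypothesis u_super : forall x, 0 <= frac_limit alpha u x.

Let cu : continuous u. Proof. by case: u_reg. Qed.

Let meas_u : measurable_fun setT u. Proof. exact: continuous_measurable_rV. Qed.

Let mbump r : measurable_fun setT (@bump R d r).
Proof. by apply: continuous_measurable_rV; exact: continuous_bump. Qed.

Let lu : L1_omega alpha u. Proof. by case: u_reg. Qed.

Lemma bounded_on_ball r : 0 <= r -> exists2 M : R, 0 <= M &
  forall x, enorm x <= r -> u x <= M.
Proof.
move=> r0.
have B0 : [set x : 'rV[R]_d | enorm x <= r] !=set0 by exists 0; rewrite /= enorm0.
have [c _ cM] := EVT_max_rV B0 (@compact_enorm_le R d r) (continuous_subspaceT cu).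
by exists (u c) => // x xr; apply: cM; rewrite inE.
Qed.

(** The 2 is from t <= 2 u(x0). The first summand comes from (2r)^(d+alpha), the inverse of the
    least kernel value on the ball, times the barrier bound r^(-alpha); the second is the volume
    bound applied to the bump. *)
Definition harnack_cst : R :=
  2 * (2 `^ (D + alpha) * @barrier_cst R d alpha + 2 ^+ d).

(* [t] is chosen so that [t * bump r] meets [u] at [x0]; the contact point [x1] minimizes
   [u - t * bump r], and lowering the bump by [c] keeps it below [u]. *)
Lemma touching_point r x0 : 0 < r -> enorm x0 <= r / 2 ->
  exists t c x1, [/\ 0 <= t <= 2 * u x0, 0 <= c, enorm x1 <= r,
    u x1 + c = t * bump r x1 & forall y, t * bump r y <= u y + c].
Proof.
move=> r0 x0r; have b2 := bump_half r0 x0r.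
have b0 : 0 < bump r x0 by lra.
pose t := u x0 / bump r x0.
pose w y := u y - t * bump r y.
have cw : continuous w.
  by move=> x; exact: (cvgB (@cu x) (cvgM (cvg_cst t) (@continuous_bump R d r x))).
have B0 : [set x : 'rV[R]_d | enorm x <= r] !=set0.
  by exists 0; rewrite /= enorm0 ltW.
have [x1 x1r wmin] := EVT_min_rV B0 (@compact_enorm_le R d r) (continuous_subspaceT cw).
have w0 : w x0 = 0 by rewrite /w /t divfK ?subrr// gt_eqF.
have w1 : w x1 <= 0.
  by rewrite -w0; apply: wmin; rewrite inE /=; lra.
have t0 : 0 <= t by rewrite divr_ge0 // ltW.
exists t, (- w x1), x1; split.
- rewrite t0 /t ler_pdivrMr//; have := u_ge0 x0; nra.
- by rewrite oppr_ge0.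
- by move: x1r; rewrite inE.
- by rewrite /w; ring.
- move=> y; have [yr|yr] := lerP (enorm y) r.
    have := wmin y; rewrite inE => /(_ yr); rewrite {2}/w; lra.
  rewrite bump_out ?mulr0 ?(ltW yr)//; have := u_ge0 y; lra.
Qed.

(** The gap v = u + c - t bump is nonnegative and vanishes at the contact point x1. There its
    convolution is bounded above, since L u >= 0 and the bump obeys the barrier. As the kernel seen
    from x1 is at least (2r)^(-(d+alpha)) on the ball outside the cutoff, this bounds the integral
    of v, and u <= v + t. *)
Lemma weak_harnack r x0 : 0 < r -> enorm x0 <= r / 2 ->
  (\int[mu]_(x in eball 0 r) (u x)%:E <= (harnack_cst * r ^+ d * u x0)%:E)%E.
Proof.
move=> r0 x0r.
have [t [c [x1 [/andP[t0 tu] c0 x1r ux1 tle]]]] := touching_point r0 x0r.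
pose p := D + alpha; have p0 : 0 < p by rewrite /p ltr_wpDl.
have [M M0 uM] := bounded_on_ball (ltW r0).
have ct := cvg_trunc alpha_gt0 alpha_lt2 u_ge0 u_reg.
set b := @barrier_cst R d alpha.
apply/lee_addgt0Pr => eta eta0.
have q0 : 0 < (2 * r) `^ p by rewrite powR_gt0// mulr_gt0.
(* The truncated operator at x1 is nonnegative only in the limit; [eta1] is its allowed defect,
   scaled to become eta/2 after division by the least kernel value. *)
pose eta1 := eta / 2 / (2 * r) `^ p.
have eta10 : 0 < eta1 by rewrite !divr_gt0.
have [e [e0 e1 e2]] : exists e, [/\ 0 < e, - eta1 <= trunc alpha e u x1 &
    M * (2 ^+ d * e ^+ d) <= eta / 2].
  have M1 : 0 < M * 2 ^+ d + 1 by rewrite ltr_wpDl// mulr_ge0// exprn_ge0.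
  have q1 : 0 < eta / 2 / (M * 2 ^+ d + 1) by rewrite !divr_gt0.
  near (0 : R)^'+ => e.
  have e0 : 0 < e by near: e; exact: nbhs_right_gt.
  have e1 : e <= 1 by near: e; exact: nbhs_right_le.
  have eq1 : e <= eta / 2 / (M * 2 ^+ d + 1) by near: e; exact: nbhs_right_le.
  exists e; split => //.
    have : `|frac_limit alpha u x1 - trunc alpha e u x1| < eta1.
      by near: e; have /cvgrPdist_lt/(_ _ eta10) := @ct x1.
    have := u_super x1; rewrite ltr_norml => h1 /andP[h2 h3]; lra.
  have ed : e ^+ d <= e by rewrite -[leRHS]expr1 ler_wiXn2l ?(ltW e0).
  move: eq1; rewrite ler_pdivlMr// => eq1.
  apply: (@le_trans _ _ (M * 2 ^+ d * e)); last by nra.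
  by rewrite mulrA; apply: ler_wpM2l => //; rewrite mulr_ge0// exprn_ge0.
have K0 z : 0 <= K e z := riesz_ge0 _ _ _.
have mK := @measurable_K R d alpha e; have Ke := @K_even R d alpha e.
pose v y := u y + c - t * bump r y.
have v0 y : 0 <= v y by rewrite subr_ge0.
have mv : measurable_fun setT v.
  apply: measurable_funB; first exact: measurable_funD.
  by apply: measurable_funM; [exact: measurable_cst|exact: mbump].
have convD f g : measurable_fun setT f -> (forall y, 0 <= f y) ->
    measurable_fun setT g -> (forall y, 0 <= g y) ->
    conv (K e) (fun y => f y + g y) x1 = (conv (K e) f x1 + conv (K e) g x1)%E.
  move=> mf f0 mg g0; rewrite /conv -ge0_integralD.
  - by apply: eq_integral => z _; rewrite mulrDl EFinD.
  - exact: measurableT.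
  - by move=> z _; rewrite lee_fin; apply: mulr_ge0.
  - by apply/measurable_EFinP; exact: (measurable_funM (measurable_fun_shift x1 mf) mK).
  - by move=> z _; rewrite lee_fin; apply: mulr_ge0.
  - by apply/measurable_EFinP; exact: (measurable_funM (measurable_fun_shift x1 mg) mK).
have convZ a f : 0 <= a -> measurable_fun setT f -> (forall y, 0 <= f y) ->
    conv (K e) (fun y => a * f y) x1 = (a%:E * conv (K e) f x1)%E.
  move=> a0 mf f0; rewrite /conv -ge0_integralZl.
  - by apply: eq_integral => z _; rewrite -mulrA EFinM.
  - exact: measurableT.
  - by apply/measurable_EFinP; exact: (measurable_funM (measurable_fun_shift x1 mf) mK).
  - by move=> z _; rewrite lee_fin; apply: mulr_ge0.
  - by rewrite lee_fin.
have conv1 : conv (K e) (fun=> c) x1 = (c%:E * \int[mu]_z (K e z)%:E)%E.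
  rewrite /conv -ge0_integralZl.
  - by apply: eq_integral => z _; rewrite EFinM.
  - exact: measurableT.
  - exact/measurable_EFinP.
  - by move=> z _; rewrite lee_fin.
  - by rewrite lee_fin.
have b0 : 0 <= b * r `^ (- alpha).
  by apply: mulr_ge0; [exact: barrier_cst_ge0|exact: powR_ge0].
have cub : (conv (K e) u x1 + conv (K e) (fun=> c) x1 =
    conv (K e) v x1 + t%:E * conv (K e) (bump r) x1)%E.
  have mtb : measurable_fun setT (fun y => t * bump r y).
    by apply: measurable_funM; [exact: measurable_cst|exact: mbump].
  have tb0 y : 0 <= t * bump r y by apply: mulr_ge0 => //; exact: bump_ge0.
  have mc : measurable_fun setT (fun _ : 'rV[R]_d => c) by exact: measurable_cst.
  rewrite -(convD _ _ meas_u u_ge0 mc (fun=> c0)) -(convZ _ _ t0 (mbump r) (@bump_ge0 R d r)).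
  rewrite -(convD _ _ mv v0 mtb tb0).
  by congr (conv _ _ _); apply/funext => y; rewrite /v subrK.
have fu : conv (K e) u x1 \is a fin_num by exact: conv_K_fin_num.
have fb := conv_bump_fin_num alpha_gt0 r x1 e0.
have fm : (\int[mu]_z (K e z)%:E)%E \is a fin_num by exact: mass_K_fin_num.
have fv : conv (K e) v x1 \is a fin_num.
  have : (conv (K e) v x1 + t%:E * conv (K e) (bump r) x1)%E \is a fin_num.
    by rewrite -cub conv1 fin_numD fu fin_numM.
  by rewrite fin_numD => /andP[].
(* The terms with the kernel mass cancel because u(x1) + c = t bump(x1). *)
have cv : (conv (K e) v x1 <= (t * (b * r `^ (- alpha)) + eta1)%:E)%E.
  move: cub (bump_barrier alpha_gt0 alpha_lt2 x1 r0 e0) e1; rewrite conv1 /trunc -/b.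
  rewrite -(fineK fu) -(fineK fb) -(fineK fm) -(fineK fv) -!EFinM -!EFinD !lee_fin /=.
  move: (fine (conv (K e) u x1)) (fine (conv (K e) (bump r) x1))
    (fine (conv (K e) v x1)) (fine (\int[mu]_z (K e z)%:E)%E) => cu_ cb_ cv_ m [E] B T.
  have : (u x1 + c) * m = t * bump r x1 * m by rewrite ux1.
  have := ler_wpM2l t0 B; lra.
pose I x r' := (fun y => (\1_[set z : 'rV[R]_d | (enorm z <= r')%R] (x - y)%R)%:E : \bar R).
have mI x r' : measurable_fun setT (I x r').
  apply/measurable_EFinP; apply: measurable_fun_reflect; apply: measurable_indic.
  rewrite (_ : mkset _ = @enorm R d @^-1` `]-oo, r']%classic); last first.
    by apply/seteqP; split => y /=; rewrite in_itv.
  by rewrite -[X in measurable X]setTI; exact: measurable_enorm.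
have I0 x r' y : (0 <= I x r' y)%E by rewrite lee_fin.
have mvK : measurable_fun setT (fun y => (v y * K e (x1 - y))%:E).
  by apply/measurable_EFinP; apply: measurable_funM => //; exact: measurable_fun_reflect.
have mvK0 y : (0 <= (v y * K e (x1 - y))%:E)%E by rewrite lee_fin; apply: mulr_ge0.
(* The last term covers the e-ball about x1, where the truncated kernel vanishes and u is only known
   to be at most [M]. *)
have pw y : u y * \1_(eball 0 r) y <= (2 * r) `^ p * (v y * K e (x1 - y)) +
    t * \1_[set z : 'rV[R]_d | enorm z <= r] (0 - y) +
    M * \1_[set z : 'rV[R]_d | enorm z <= e] (x1 - y).
  rewrite !indicE.
  have vK : 0 <= (2 * r) `^ p * (v y * K e (x1 - y)).
    by apply: mulr_ge0; [exact: powR_ge0|exact: mulr_ge0].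
  have [yr|_] := boolP (y \in eball 0 r); last first.
    by rewrite mulr0 addr_ge0// ?addr_ge0// mulr_ge0.
  have {}yr : enorm y < r by move: (set_mem yr); rewrite eball0E.
  rewrite (mem_set (_ : [set z : 'rV[R]_d | enorm z <= r] (0 - y))); last first.
    by rewrite /= sub0r enormN ltW.
  have [ye|ye] := boolP (x1 - y \in [set z : 'rV[R]_d | enorm z <= e]).
    by have := uM y (ltW yr); rewrite !mulr1; lra.
  have {}ye : e < enorm (x1 - y).
    by rewrite ltNge; apply/negP => h; move/negP: ye; apply; rewrite inE.
  have y0 : 0 < enorm (x1 - y) by exact: lt_trans ye.
  have vKE : v y <= (2 * r) `^ p * (v y * K e (x1 - y)).
    rewrite /riesz indicE mem_set// mul1r mulrCA; apply: ler_peMr => //.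
    rewrite -/p powRN ler_pdivlMr ?powR_gt0// mul1r.
    apply: ge0_ler_powR; rewrite ?nnegrE ?(ltW p0) ?(ltW y0) ?mulr_ge0 ?(ltW r0)//.
    by apply: (le_trans (ler_enormB _ _)); lra.
  have := bump_le1 r y; have := bump_ge0 r y; move: vKE; rewrite {1}/v !mulr1 mulr0.
  by set w := _ `^ _ * _ => ? ? ?; nra.
rewrite integral_eball_indic//.
pose G y := (((2 * r) `^ p)%:E * (v y * K e (x1 - y))%:E + t%:E * I 0%R r y +
  M%:E * I x1 e y)%E.
apply: (@le_trans _ _ (\int[mu]_y G y)%E); rewrite /G.
  apply: ge0_le_integral.
  - exact: measurableT.
  - by move=> y _; rewrite lee_fin; exact: mulr_ge0.
  - apply/measurable_EFinP; apply: measurable_funM => //.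
    by apply: measurable_indic; exact: measurable_eball.
  - apply: emeasurable_funD; last first.
      by apply: emeasurable_funM; [exact: measurable_cst|exact: mI].
    apply: emeasurable_funD; last first.
      by apply: emeasurable_funM; [exact: measurable_cst|exact: mI].
    by apply: emeasurable_funM; [exact: measurable_cst|exact: mvK].
  - by move=> y _; rewrite /I -!EFinM -!EFinD lee_fin.
have m1 : measurable_fun setT (fun y => ((2 * r) `^ p)%:E * (v y * K e (x1 - y))%:E)%E.
  by apply: emeasurable_funM; [exact: measurable_cst|exact: mvK].
have m2 a x r' : measurable_fun setT (fun y => a%:E * I x r' y)%E.
  by apply: emeasurable_funM; [exact: measurable_cst|exact: mI].
have n1 y : (0 <= ((2 * r) `^ p)%:E * (v y * K e (x1 - y))%:E)%E.
  by apply: mule_ge0; [rewrite lee_fin powR_ge0|exact: mvK0].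
have n2 a x r' y : 0 <= a -> (0 <= a%:E * I x r' y)%E.
  by move=> a0; apply: mule_ge0; [rewrite lee_fin|exact: I0].
have intI a x r' : 0 <= a -> 0 < r' ->
    (\int[mu]_y (a%:E * I x r' y) <= (a * (2 ^+ d * r' ^+ d))%:E)%E.
  move=> a0 r'0; rewrite ge0_integralZl; [|exact: measurableT|exact: mI| |by rewrite lee_fin].
    by rewrite [X in (_ <= X)%E]EFinM; apply: lee_wpmul2l; [rewrite lee_fin|exact: integral_indic_enorm_le].
  by move=> y _; exact: I0.
have intK : (\int[mu]_y (((2 * r) `^ p)%:E * (v y * K e (x1 - y))%:E) <=
    ((2 * r) `^ p * (t * (b * r `^ (- alpha)) + eta1))%:E)%E.
  rewrite ge0_integralZl; [|exact: measurableT|exact: mvK|by move=> y _; exact: mvK0|by rewrite lee_fin powR_ge0].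
  rewrite -(conv_sub K0 mK Ke x1 mv v0) [X in (_ <= X)%E]EFinM.
  by apply: lee_wpmul2l; [rewrite lee_fin powR_ge0|exact: cv].
rewrite ge0_integralD; [|exact: measurableT| | |by move=> y _; exact: n2|exact: m2]; last 2 first.
- by move=> y _; apply: adde_ge0; [exact: n1|exact: n2].
- by apply: emeasurable_funD; [exact: m1|exact: m2].
rewrite ge0_integralD; [|exact: measurableT|by move=> y _; exact: n1|exact: m1
  |by move=> y _; exact: n2|exact: m2].
apply: (le_trans (leeD (leeD intK (intI t 0 r t0 r0)) (intI M x1 e M0 e0))).
rewrite -!EFinD lee_fin.
have E1 : (2 * r) `^ p * eta1 = eta / 2 by rewrite /eta1 mulrC divfK// gt_eqF.
have E2 : (2 * r) `^ p * r `^ (- alpha) = 2 `^ p * r ^+ d.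
  rewrite powRM ?(ltW r0)// -mulrA -powRD; last by rewrite (gt_eqF r0) implybT.
  by rewrite (_ : p - alpha = D) ?powR_mulrn ?(ltW r0)// /p addrK.
rewrite mulrDr E1 (_ : (2 * r) `^ p * _ = t * b * (2 `^ p * r ^+ d)); last first.
  by rewrite -E2; ring.
rewrite /harnack_cst -/p -/b.
have b00 : 0 <= b := barrier_cst_ge0 alpha_gt0 alpha_lt2.
have rd : 0 <= r ^+ d by rewrite exprn_ge0 ?(ltW r0).
have w0 : 0 <= (2 `^ p * b + 2 ^+ d) * r ^+ d.
  by apply: mulr_ge0 => //; rewrite addr_ge0 ?exprn_ge0// mulr_ge0 ?powR_ge0.
have := ler_wpM2r w0 tu; move: e2; lra.
Unshelve. all: by end_near. Qed.

End nonnegative_superharmonic.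

End superharmonic_estimates.

(** * Pairing with the bump and the lower bound of Green type *)

Section green_estimate.
Context {R : realType} {d : nat}.
Hypothesis d_gt0 : (0 < d)%N.
Variable alpha : R.
Hypotheses (alpha_gt0 : 0 < alpha) (alpha_lt2 : alpha < 2).
Implicit Types (x y z : 'rV[R]_d) (f g : 'rV[R]_d -> R) (e r : R).
Local Notation mu := (@lebesgue_rV R d).
Local Notation D := (d%:R : R).
Local Notation K e := (@riesz R d alpha (@outside R d e)).

Section green_lower_bound.
Variable u : 'rV[R]_d -> R.
Hypotheses (u_ge0 : forall x, 0 <= u x) (u_reg : classical_regularity alpha u).
Hypothesis u_super : forall x, 0 <= frac_limit alpha u x.

Let cu : continuous u. Proof. by case: u_reg. Qed.

Let meas_u : measurable_fun setT u. Proof. exact: continuous_measurable_rV. Qed.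

Let mbump r : measurable_fun setT (@bump R d r).
Proof. by apply: continuous_measurable_rV; exact: continuous_bump. Qed.

Let lu : L1_omega alpha u. Proof. by case: u_reg. Qed.

(** For fixed e, the integral [A] of the bump against the convolution of u occurs in both [ineq1]
    and [ineq2], by adjointness, and so does [m * PU], with m the kernel mass. Chaining the
    inequalities removes both, although m diverges as e tends to 0. *)
Lemma duality r : 0 < r ->
  (\int[mu]_(x in eball 0 (r / 2)) (frac_limit alpha u x)%:E <=
   (2 * @barrier_cst R d alpha * r `^ (- alpha))%:E * \int[mu]_(x in eball 0 r) (u x)%:E)%E.
Proof.
move=> r0; set b := @barrier_cst R d alpha; set L := frac_limit alpha u.
have b0 : 0 <= b := barrier_cst_ge0 alpha_gt0 alpha_lt2.
have [kappa k0 [C C0 hC]] := trunc_uniform alpha_gt0 alpha_lt2 u_ge0 u_reg r.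
have [M M0 uM] := bounded_on_ball u_ge0 u_reg (ltW r0).
have V0 : 0 <= 2 ^+ d * r ^+ d by rewrite mulr_ge0 ?exprn_ge0 ?(ltW r0).
have mL : measurable_fun setT L := measurable_frac_limit alpha_gt0 alpha_lt2 u_ge0 u_reg.
have L0 : forall x, 0 <= L x by [].
set Iu := (\int[mu]_(x in eball 0 r) (u x)%:E)%E.
have bump0 := @bump_ge0 R d r.
apply/lee_addgt0Pr => eta eta0.
have [e [e0 e1 eC]] : exists e, [/\ 0 < e, e <= 1 &
    2 * (C * e `^ kappa * (2 ^+ d * r ^+ d)) <= eta].
  have V1 : 0 < 2 * C * (2 ^+ d * r ^+ d) + 1.
    by rewrite ltr_wpDl// mulr_ge0// mulr_ge0.
  have q1 : 0 < eta / (2 * C * (2 ^+ d * r ^+ d) + 1) by rewrite divr_gt0.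
  near (0 : R)^'+ => e; exists e; split.
  - by near: e; exact: nbhs_right_gt.
  - by near: e; exact: nbhs_right_le.
  - have : `|e `^ kappa| < eta / (2 * C * (2 ^+ d * r ^+ d) + 1).
      by near: e; have /cvgr0Pnorm_lt/(_ _ q1) := @powR_cvg0 R kappa k0.
    rewrite ger0_norm ?powR_ge0// ltr_pdivlMr// => h.
    have := powR_ge0 e kappa; nra.
set delta := C * e `^ kappa in eC.
have delta0 : 0 <= delta by apply: mulr_ge0 => //; exact: powR_ge0.
have mK := @measurable_K R d alpha e; have Ke := @K_even R d alpha e.
have K0 z : 0 <= K e z := riesz_ge0 _ _ _.
have fm : (\int[mu]_z (K e z)%:E)%E \is a fin_num by exact: mass_K_fin_num.
set m := fine (\int[mu]_z (K e z)%:E)%E.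
have m0 : 0 <= m by apply: fine_ge0; apply: integral_ge0 => z _; rewrite lee_fin.
have fu x : conv (K e) u x \is a fin_num by exact: conv_K_fin_num.
have fb x : conv (K e) (bump r) x \is a fin_num by exact: conv_bump_fin_num.
have mcu : measurable_fun setT (conv (K e) u) by exact: measurable_conv.
have mcb : measurable_fun setT (conv (K e) (bump r)) by exact: measurable_conv.
have cu0 x : (0 <= conv (K e) u x)%E by exact: conv_ge0.
have cb0 x : (0 <= conv (K e) (bump r) x)%E by exact: conv_ge0.
have mphi : measurable_fun setT (fun x => (bump r x)%:E : \bar R).
  by apply/measurable_EFinP; exact: mbump.
have mphiL : measurable_fun setT (fun x => (bump r x * L x)%:E : \bar R).
  by apply/measurable_EFinP; apply: measurable_funM; [exact: mbump|exact: mL].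
have mphiu : measurable_fun setT (fun x => (bump r x * u x)%:E : \bar R).
  by apply/measurable_EFinP; apply: measurable_funM; [exact: mbump|exact: meas_u].
have phiL0 x : (0 <= (bump r x * L x)%:E :> \bar R)%E by rewrite lee_fin mulr_ge0.
have phiu0 x : (0 <= (bump r x * u x)%:E :> \bar R)%E by rewrite lee_fin mulr_ge0.
have phi0 x : (0 <= (bump r x)%:E :> \bar R)%E by rewrite lee_fin.
have mA : measurable_fun setT (fun x => (bump r x)%:E * conv (K e) u x)%E.
  exact: emeasurable_funM.
have A0 x : (0 <= (bump r x)%:E * conv (K e) u x)%E by exact: mule_ge0.
have mB : measurable_fun setT (fun x => (u x)%:E * conv (K e) (bump r) x)%E.
  by apply: emeasurable_funM => //; exact/measurable_EFinP.
have B0 x : (0 <= (u x)%:E * conv (K e) (bump r) x)%E by apply: mule_ge0; rewrite ?lee_fin.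
have Zl (k : R) (f : 'rV[R]_d -> \bar R) : 0 <= k -> measurable_fun setT f ->
    (forall x, (0 <= f x)%E) -> (k%:E * \int[mu]_x f x = \int[mu]_x (k%:E * f x))%E.
  move=> k00 mf f0; rewrite ge0_integralZl; [by []|exact: measurableT|exact: mf| |].
    by move=> x _; exact: f0.
  by rewrite lee_fin.
have Zm (k : R) (f : 'rV[R]_d -> \bar R) : measurable_fun setT f ->
    measurable_fun setT (fun x => k%:E * f x)%E.
  by move=> mf; apply: emeasurable_funM; [exact: measurable_cst|exact: mf].
have Z0 (k : R) (f : 'rV[R]_d -> \bar R) x : 0 <= k -> (forall x, (0 <= f x)%E) ->
    (0 <= k%:E * f x)%E.
  by move=> k00 f0; apply: mule_ge0; [rewrite lee_fin|exact: f0].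
have Dl (f g : 'rV[R]_d -> \bar R) : measurable_fun setT f ->
    (forall x, (0 <= f x)%E) -> measurable_fun setT g -> (forall x, (0 <= g x)%E) ->
    (\int[mu]_x f x + \int[mu]_x g x = \int[mu]_x (f x + g x))%E.
  move=> mf f0 mg g0; rewrite ge0_integralD; [by []|exact: measurableT|
    by move=> x _; exact: f0|exact: mf|by move=> x _; exact: g0|exact: mg].
set A := (\int[mu]_x ((bump r x)%:E * conv (K e) u x))%E.
have AB : A = (\int[mu]_x ((u x)%:E * conv (K e) (bump r) x))%E.
  by rewrite /A (conv_adjoint mK K0 Ke meas_u u_ge0 (mbump r) bump0).
set PL := (\int[mu]_x (bump r x * L x)%:E)%E.
set PU := (\int[mu]_x (bump r x * u x)%:E)%E.
set P := (\int[mu]_x (bump r x)%:E)%E.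
have PV : (P <= (2 ^+ d * r ^+ d)%:E)%E.
  apply: (le_trans _ (integral_indic_enorm_le 0 r0)); apply: ge0_le_integral.
  - exact: measurableT.
  - by move=> x _.
  - exact: mphi.
  - apply/measurable_EFinP; apply: measurable_fun_reflect; apply: measurable_indic.
    rewrite (_ : mkset _ = @enorm R d @^-1` `]-oo, r]%classic); last first.
      by apply/seteqP; split => y /=; rewrite in_itv.
    by rewrite -[X in measurable X]setTI; exact: measurable_enorm.
  - move=> x _; rewrite lee_fin indicE; have [xr|xr] := lerP (enorm x) r.
      by rewrite mem_set ?bump_le1//= sub0r enormN.
    by rewrite bump_out// ltW.
have PUM : (PU <= M%:E * P)%E.
  rewrite /P (Zl _ _ M0 mphi phi0).
  apply: ge0_le_integral; [exact: measurableT|by move=> x _; exact: phiu0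
    |exact: mphiu|exact: Zm|].
  move=> x _; rewrite -EFinM lee_fin mulrC.
  have [xr|xr] := lerP (enorm x) r; first by rewrite ler_wpM2r// uM.
  by rewrite bump_out ?mulr0// ltW.
have Pfin : P \is a fin_num.
  rewrite ge0_fin_numE; first exact: le_lt_trans PV (ltry _).
  by apply: integral_ge0 => x _.
have PUfin : PU \is a fin_num.
  rewrite ge0_fin_numE; last by apply: integral_ge0 => x _.
  by apply: (le_lt_trans PUM); rewrite ltey_eq fin_numM.
(* On the ball L is at most the truncated operator plus [delta]; off the ball the bump vanishes. *)
have ineq1 : (PL + A <= m%:E * PU + delta%:E * P)%E.
  rewrite /PL /A /PU /P (Zl _ _ m0 mphiu phiu0) (Zl _ _ delta0 mphi phi0).
  rewrite (Dl _ _ mphiL phiL0 mA A0) (Dl _ _ (Zm m _ mphiu) (fun x => Z0 m _ x m0 phiu0)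
    (Zm delta _ mphi) (fun x => Z0 delta _ x delta0 phi0)).
  apply: ge0_le_integral; first exact: measurableT.
  - by move=> x _; apply: adde_ge0; [exact: phiL0|exact: A0].
  - exact: emeasurable_funD.
  - by apply: emeasurable_funD; exact: Zm.
  - move=> x _; rewrite -(fineK (fu x)) -!EFinM -!EFinD lee_fin.
    have [xr|xr] := lerP (enorm x) r; last first.
      by rewrite bump_out ?(ltW xr)// !(mul0r, mulr0).
    have [_ /(_ e e0 e1)] := hC x xr.
    rewrite -/L -/delta /trunc -/m ler_norml => /andP[h _].
    have := ler_wpM2l (bump0 x) h; lra.
(* The barrier multiplied by u and integrated. The error is needed only on the ball, since off it
   the left side is 0. *)
have ineq2 : (m%:E * PU <= A + (b * r `^ (- alpha))%:E * Iu)%E.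
  have c0 : 0 <= b * r `^ (- alpha) by rewrite mulr_ge0 ?powR_ge0.
  have mi : measurable_fun setT (fun x => (u x * \1_(eball 0 r) x)%:E : \bar R).
    apply/measurable_EFinP; apply: measurable_funM => //.
    by apply: measurable_indic; exact: measurable_eball.
  have i0 x : (0 <= (u x * \1_(eball 0 r) x)%:E :> \bar R)%E by rewrite lee_fin mulr_ge0.
  rewrite AB /Iu /PU integral_eball_indic// (Zl _ _ m0 mphiu phiu0) (Zl _ _ c0 mi i0).
  rewrite (Dl _ _ mB B0 (Zm (b * r `^ (- alpha)) _ mi) (fun x => Z0 _ _ x c0 i0)).
  apply: ge0_le_integral; first exact: measurableT.
  - by move=> x _; exact: (Z0 m _ x m0 phiu0).
  - exact: Zm.
  - by apply: emeasurable_funD; [exact: mB|exact: Zm].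
  - move=> x _; have := bump_barrier alpha_gt0 alpha_lt2 x r0 e0.
    rewrite -(fineK (fb x)) -(fineK fm) -/m -!EFinM -!EFinD !lee_fin indicE -/b => h.
    have [xr|xr] := lerP r (enorm x).
      rewrite bump_out// mul0r mulr0; apply: addr_ge0.
        by apply: mulr_ge0; [exact: u_ge0|apply: fine_ge0; exact: cb0].
      by apply: mulr_ge0 => //; apply: mulr_ge0.
    rewrite mem_set ?eball0E// mulr1.
    have := ler_wpM2l (u_ge0 x) h; lra.
(* Cancelling [A] on both sides in the extended reals requires it to be finite. *)
have Afin : A \is a fin_num.
  have PL0 : (0 <= PL)%E by apply: integral_ge0 => x _.
  rewrite ge0_fin_numE; last by apply: integral_ge0 => x _.
  apply: (@le_lt_trans _ _ (m%:E * PU + delta%:E * P)%E).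
    by apply: le_trans ineq1; rewrite leeDr.
  by rewrite ltey_eq fin_numD !fin_numM.
have main : (PL <= (b * r `^ (- alpha))%:E * Iu + delta%:E * P)%E.
  rewrite -(leeD2rE _ _ Afin); apply: (le_trans ineq1).
  apply: (le_trans (leeD ineq2 (lexx _))).
  by rewrite -addeA [leLHS]addeC.
(* The bump is at least 1/2 on the half ball; this is the factor 2 of the statement. *)
have half : (\int[mu]_(x in eball 0 (r / 2)) (L x)%:E <= 2%:E * PL)%E.
  rewrite integral_eball_indic// /PL (Zl _ _ (ler0n _ 2) mphiL phiL0).
  apply: ge0_le_integral; first exact: measurableT.
  - by move=> x _; rewrite lee_fin mulr_ge0.
  - apply/measurable_EFinP; apply: measurable_funM => //.
    by apply: measurable_indic; exact: measurable_eball.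
  - exact: Zm.
  - move=> x _; rewrite -EFinM lee_fin indicE.
    have [xr|xr] := boolP (x \in eball 0 (r / 2)); last first.
      by rewrite mulr0 mulr_ge0// mulr_ge0.
    have := bump_half r0 (_ : enorm x <= r / 2).
    move: (set_mem xr); rewrite eball0E => /ltW xr' /(_ xr') h.
    by rewrite mulr1 mulrA ler_peMl//; lra.
apply: (le_trans half); apply: (le_trans (lee_wpmul2l _ main)) => //.
have Iu0 : (0 <= Iu)%E by apply: integral_ge0 => x _; rewrite lee_fin.
rewrite ge0_muleDr; last 2 first.
- by apply: mule_ge0 => //; rewrite lee_fin mulr_ge0 ?powR_ge0.
- by apply: mule_ge0; [rewrite lee_fin|apply: integral_ge0 => x _].
apply: leeD; first by rewrite muleA -EFinM mulrA.
apply: (@le_trans _ _ (2%:E * (delta%:E * (2 ^+ d * r ^+ d)%:E))%E).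
  by apply: lee_wpmul2l => //; apply: lee_wpmul2l; rewrite ?lee_fin.
by rewrite -!EFinM lee_fin.
Unshelve. all: by end_near. Qed.

Lemma green_lower_bound r x : 0 < r -> enorm x <= r / 2 ->
  (\int[mu]_(y in eball 0 (r / 2)) (frac_limit alpha u y)%:E <=
   (2 * @barrier_cst R d alpha * @harnack_cst R d alpha * r `^ (D - alpha) * u x)%:E)%E.
Proof.
move=> r0 xr; apply: (le_trans (duality r0)).
have b0 : 0 <= 2 * @barrier_cst R d alpha * r `^ (- alpha).
  by apply: mulr_ge0; [apply: mulr_ge0 => //; exact: barrier_cst_ge0|exact: powR_ge0].
apply: (le_trans (lee_wpmul2l _ (weak_harnack d_gt0 alpha_gt0 alpha_lt2 u_ge0 u_reg u_super r0 xr))); first by rewrite lee_fin.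
rewrite -EFinM lee_fin powRD ?(gt_eqF r0) ?implybT// powR_mulrn ?(ltW r0)//.
by rewrite le_eqVlt; apply/orP; left; apply/eqP; ring.
Qed.

End green_lower_bound.

End green_estimate.

(* The potentials are Lebesgue measurable only, so [ge0_le_integral] does not apply to them. *)
Lemma le_integral_nonmeasurable d (T : measurableType d) (R : realType)
    (mu : {measure set T -> \bar R}) (A : set T) (f g : T -> \bar R) :
  (forall x, A x -> (0 <= f x)%E) -> (forall x, A x -> (f x <= g x)%E) ->
  (\int[mu]_(x in A) f x <= \int[mu]_(x in A) g x)%E.
Proof.
move=> f0 fg; have g0 x : A x -> (0 <= g x)%E by move=> Ax; exact: le_trans (f0 x Ax) (fg x Ax).
rewrite !ge0_integralE//; apply: le_ereal_sup => _ [h hf <-]; exists h => // x; apply: (le_trans (hf x)); rewrite /patch; case: ifP => // /set_mem Ax.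
exact: fg.
Qed.

(** * Strong maximum principle and estimates on an annulus *)

Section annulus.
Context {R : realType} {d : nat}.
Hypothesis d_gt0 : (0 < d)%N.
Variable alpha : R.
Hypotheses (alpha_gt0 : 0 < alpha) (alpha_lt2 : alpha < 2).
Implicit Types (x y z : 'rV[R]_d) (e r : R).
Local Notation mu := (@lebesgue_rV R d).
Local Notation D := (d%:R : R).

Variable u : 'rV[R]_d -> R.
Hypotheses (u_ge0 : forall x, 0 <= u x) (u_reg : classical_regularity alpha u).
Hypothesis u_super : forall x, 0 <= frac_limit alpha u x.

Let cu : continuous u. Proof. by case: u_reg. Qed.

Let meas_u : measurable_fun setT u. Proof. exact: continuous_measurable_rV. Qed.

Lemma lebesgue_eball_gt0 z r : 0 < r -> (0 < mu (eball z r))%E.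
Proof.
move=> r0; apply: lt_le_trans (lebesgue_rV_eball_ge z d_gt0 r0).
by rewrite lte_fin exprn_gt0// divr_gt0// ltr0n.
Qed.

Lemma integral_eball_cst z r (m : R) :
  (m%:E * mu (eball z r) = \int[mu]_(x in eball z r) m%:E)%E.
Proof. by rewrite integral_cst//; exact: measurable_eball. Qed.

Lemma sub_eball z r s : enorm z + r <= s -> eball z r `<=` eball 0 s.
Proof.
move=> h y /= zy; rewrite eball0E; apply: lt_le_trans h.
have -> : y = z - (z - y) by rewrite subKr.
by apply: (le_lt_trans (ler_enormB _ _)); rewrite ltrD2l.
Qed.

Lemma integral_eball_gt0 y : 0 < u y -> exists2 r : R, 0 < r &
  forall s, r <= s -> (0 < \int[mu]_(x in eball 0 s) (u x)%:E)%E.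
Proof.
move=> uy; have : \forall x \near y, u y / 2 < u x.
  by apply: (@cvgr_gt _ _ _ _ _ _ (@cu y)); lra.
move=> /nbhs_ballP[e /= e0 he]; exists (enorm y + e) => [|s ys].
  by rewrite ltr_wpDl ?enorm_ge0.
apply: (@lt_le_trans _ _ ((u y / 2)%:E * mu (eball y e))%E).
  by apply: mule_gt0; [rewrite lte_fin; lra|exact: lebesgue_eball_gt0].
rewrite integral_eball_cst; apply: (@le_trans _ _ (\int[mu]_(x in eball y e) (u x)%:E)%E).
  apply: le_integral_nonmeasurable => x xy; rewrite lee_fin; first lra.
  apply/ltW/he; split => // i j; rewrite ord1 /ball /=.
  by have := coord_le_enorm (y - x) j; rewrite !mxE => /le_lt_trans; apply.
apply: ge0_subset_integral; [exact: measurable_eball|exact: measurable_eball| | |].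
- by apply: measurable_funTS; exact/measurable_EFinP.
- by move=> x _; rewrite lee_fin.
- exact: sub_eball.
Qed.

(** Strong maximum principle: at a zero of u, [weak_harnack] forces the integral of u to vanish on a
    ball that also sees the positive value at [y]. *)
Lemma positive_everywhere y : 0 < u y -> forall x, 0 < u x.
Proof.
move=> uy x; have [r r0 hr] := integral_eball_gt0 uy.
rewrite lt_neqAle u_ge0 andbT eq_sym; apply/eqP => ux.
(* This radius exceeds [r], so the integral is positive, and puts [x] in the half ball. *)
have s0 : 0 < r + 2 * enorm x by rewrite ltr_pwDl// mulr_ge0 ?enorm_ge0.
have := weak_harnack d_gt0 alpha_gt0 alpha_lt2 u_ge0 u_reg u_super s0 (_ : enorm x <= _).
rewrite ux mulr0 => /(_ ltac:(lra)).
by rewrite leNgt hr//; rewrite lerDl mulr_ge0 ?enorm_ge0.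
Qed.

Let L := frac_limit alpha u.

Let mL : measurable_fun setT L.
Proof. exact: measurable_frac_limit. Qed.

Lemma integral_frac_limit_gt0 : (forall x, 0 < L x) ->
  (0 < \int[mu]_(x in eball 0 1) (L x)%:E)%E.
Proof.
move=> Lpos; rewrite lt_neqAle; apply/andP; split; last first.
  by apply: integral_ge0 => x _; rewrite lee_fin.
apply/negP => /eqP/esym I0.
have mLE : measurable_fun (eball (0 : 'rV[R]_d) 1) (fun x => (L x)%:E : \bar R).
  by apply: measurable_funTS; exact/measurable_EFinP.
have : (\int[mu]_(x in eball 0 1) `|(L x)%:E| = 0)%E.
  rewrite -[RHS]I0; apply: eq_integral => x _; rewrite gee0_abs// lee_fin.
  exact/ltW.
move=> /(ae_eq_integral_abs _ (measurable_eball 0 1) mLE)[N [mN N0 sN]].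
have : (mu (eball 0 1) <= mu N)%E.
  apply: le_measure; rewrite ?inE//; first exact: measurable_eball.
  move=> x xB; apply: sN => /= /(_ xB) [] Lx0.
  by have := Lpos x; rewrite Lx0 ltxx.
by rewrite leNgt N0 lebesgue_eball_gt0.
Qed.

Definition annulus r : set 'rV[R]_d := [set x | r / 2 <= enorm x <= 3 * r / 2].

Lemma compact_annulus r : compact (annulus r).
Proof.
have : closed (annulus r).
  rewrite (_ : annulus r = @enorm R d @^-1` `[r / 2, 3 * r / 2]%classic); last first.
    by apply/seteqP; split => x /=; rewrite in_itv.
  apply: preimage_closed; last exact: interval_closed.
  by move=> x _; exact: continuous_enorm.
move=> /subclosed_compact; apply; first exact: (@compact_enorm_le R d (3 * r / 2)).
by move=> x /andP[].
Qed.

Lemma exists_enorm r : 0 <= r -> exists z : 'rV[R]_d, enorm z = r.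
Proof.
move=> r0; have i := Ordinal d_gt0; exists (r *: delta_mx ord0 i).
rewrite enormZ ger0_norm// /enorm (bigD1 i)//= mxE !eqxx expr1n big1 ?addr0 ?sqrtr1 ?mulr1//.
by move=> j ji; rewrite mxE eqxx (negbTE ji) expr0n.
Qed.

(* [m] is the minimum of [u] over the annulus. *)
Lemma annulus_estimate : (forall x, 0 < L x) ->
  exists c C : R, [/\ 0 < c, 0 < C & forall r, 1 <= r -> exists m : R,
    [/\ (forall x, annulus r x -> m <= u x), c * r `^ (alpha - D) <= m, m <= C &
      forall (U : 'rV[R]_d -> R) (K : R), 0 < K -> (forall x, 0 < U x) ->
        (forall x, annulus r x -> K * U x <= L x) ->
        (Phi U r <= (C * r `^ (D - alpha) * m / K)%:E)%E]].
Proof.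
move=> Lpos; pose h := @harnack_cst R d alpha; pose b := @barrier_cst R d alpha.
have b0 : 0 <= b := barrier_cst_ge0 alpha_gt0 alpha_lt2.
have h0 : 0 <= h.
  by apply: mulr_ge0 => //; apply: addr_ge0; rewrite ?exprn_ge0// mulr_ge0 ?powR_ge0.
(* The Green bound is used at radius 4r, whose half ball contains the annulus; this produces the
   power of 4. The 1 makes [G] positive. *)
pose G := 2 * b * h * 4 `^ (D - alpha) + 1.
have bh4 : 0 <= 2 * b * h * 4 `^ (D - alpha).
  by apply: mulr_ge0; [do 2 apply: mulr_ge0 => //|exact: powR_ge0].
have G0 : 0 < G by rewrite ltr_wpDl.
have green r x : 0 < r -> enorm x <= 2 * r ->
    (\int[mu]_(y in eball 0 (2 * r)) (L y)%:E <= (G * r `^ (D - alpha) * u x)%:E)%E.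
  move=> r0 xr; have r40 : 0 < 4 * r by rewrite mulr_gt0.
  have r2 : 4 * r / 2 = 2 * r by field.
  have := green_lower_bound d_gt0 alpha_gt0 alpha_lt2 u_ge0 u_reg u_super r40 (_ : enorm x <= 4 * r / 2).
  rewrite r2 => /(_ xr)/le_trans; apply; rewrite lee_fin.
  rewrite powRM ?(ltW r0)// -/b -/h /G.
  have : 0 <= r `^ (D - alpha) * u x by rewrite mulr_ge0 ?powR_ge0.
  move: (r `^ (D - alpha)) (4 `^ (D - alpha)) => s1 s2 hs.
  by rewrite [leLHS](_ : _ = 2 * b * h * s2 * (s1 * u x)); [nra|ring].
have I0 := integral_frac_limit_gt0 Lpos.
pose g := fine (\int[mu]_(x in eball 0 1) (L x)%:E)%E.
have mLE (A : set 'rV[R]_d) : measurable_fun A (fun x => (L x)%:E : \bar R).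
  by apply: measurable_funTS; exact/measurable_EFinP.
have subL (A B : set 'rV[R]_d) : measurable A -> measurable B -> A `<=` B ->
    (\int[mu]_(x in A) (L x)%:E <= \int[mu]_(x in B) (L x)%:E)%E.
  move=> mA mB AB; apply: ge0_subset_integral; [exact: mA|exact: mB|exact: mLE| |exact: AB].
  by move=> x _; rewrite lee_fin; exact: u_super.
have Ifin : (\int[mu]_(x in eball 0 1) (L x)%:E)%E \is a fin_num.
  rewrite ge0_fin_numE; last exact: ltW.
  apply: le_lt_trans (ltry (G * 1 `^ (D - alpha) * u 0)).
  apply: (le_trans _ (green 1 0 ltr01 _)); last by rewrite enorm0; lra.
  apply: subL; [exact: measurable_eball|exact: measurable_eball|].
  by apply: sub_eball; rewrite enorm0; lra.
have g0 : 0 < g by rewrite -lte_fin fineK.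
(* The ratio of [h * (4 * r) ^+ d] to the volume bound [(r / 4 / D) ^+ d], which is independent of
   r. *)
pose C2 := h * 4 ^+ d * (4 * D) ^+ d.
have D0 : 0 < D by rewrite ltr0n.
have C20 : 0 <= C2 * u 0.
  apply: mulr_ge0 => //; apply: mulr_ge0; last by rewrite exprn_ge0// mulr_ge0// ltW.
  by apply: mulr_ge0 => //; rewrite exprn_ge0.
exists (g / G), (G + C2 * u 0); split; first by rewrite divr_gt0.
  by rewrite ltr_pwDl.
move=> r r1; have r0 : 0 < r by lra.
have [z zr] := exists_enorm (ltW r0).
have zA : annulus r z by rewrite /annulus/= zr; apply/andP; split; lra.
(* With |z| = r the ball only meets norms between 3r/4 and 5r/4. It serves both the upper bound on
   the minimum and the bound on [Phi]. *)
have Az : eball z (r / 4) `<=` annulus r.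
  move=> y; rewrite /eball /annulus/= => zy.
  have h1 := ler_enormB z (z - y); have h2 := ler_enormB y (y - z).
  move: h1 h2; rewrite !subKr (enormC y) zr => h1 h2; apply/andP; split; lra.
have A2 x : annulus r x -> enorm x <= 2 * r by move=> /andP[_ h2]; lra.
have zB2 : eball z (r / 4) `<=` eball 0 (2 * r) by apply: sub_eball; rewrite zr; lra.
have [x xA xmin] := EVT_min_rV (ex_intro _ z zA) (@compact_annulus r) (continuous_subspaceT cu).
have {}xA := set_mem xA.
have xm y : annulus r y -> u x <= u y by move=> yA; apply: xmin; rewrite inE.
have rD : 0 < r `^ (D - alpha) by exact: powR_gt0.
exists (u x); split => //.
(* Lower bound: the integral of L over the ball of radius 2r is at least [g], its value on the unit
   ball. *)
- rewrite (_ : alpha - D = - (D - alpha)); last by ring.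
  rewrite powRN mulrAC ler_pdivrMr// ler_pdivrMr// mulrC.
  rewrite [leRHS](_ : _ = G * r `^ (D - alpha) * u x); last by ring.
  rewrite -lee_fin fineK//; apply: (le_trans _ (green r x r0 (A2 _ xA))).
  apply: subL; [exact: measurable_eball|exact: measurable_eball|].
  by apply: sub_eball; rewrite enorm0; lra.
(* Upper bound: the minimum is at most the average of u over the small ball, which [weak_harnack] at
   radius 4r bounds by u(0). *)
- suff : u x <= C2 * u 0 by lra.
  have r40 : 0 < r / 4 by rewrite divr_gt0.
  have R40 : 0 < 4 * r by rewrite mulr_gt0.
  have := weak_harnack d_gt0 alpha_gt0 alpha_lt2 u_ge0 u_reg u_super R40 (_ : enorm 0 <= _).
  rewrite -/h enorm0 => /(_ ltac:(lra)) H.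
  have : ((u x)%:E * (((r / 4) / D) ^+ d)%:E <= (h * (4 * r) ^+ d * u 0)%:E)%E.
    apply: (le_trans _ H); apply: (@le_trans _ _ ((u x)%:E * mu (eball z (r / 4)))%E).
      by apply: lee_wpmul2l; [rewrite lee_fin|exact: lebesgue_rV_eball_ge].
    rewrite integral_eball_cst.
    apply: (@le_trans _ _ (\int[mu]_(x in eball z (r / 4)) (u x)%:E)%E).
      by apply: le_integral_nonmeasurable => y yz; rewrite lee_fin//; exact/xm/Az.
    apply: ge0_subset_integral; [exact: measurable_eball|exact: measurable_eball| | |].
    + by apply: measurable_funTS; exact/measurable_EFinP.
    + by move=> y _; rewrite lee_fin.
    + by apply: sub_eball; rewrite zr; lra.
  have q0 : 0 < ((r / 4) / D) ^+ d by rewrite exprn_gt0// divr_gt0.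
  rewrite -EFinM lee_fin -ler_pdivlMr// => /le_trans; apply.
  rewrite le_eqVlt; apply/orP; left; apply/eqP.
  rewrite /C2 !exprMn !exprVn invfM !invrK.
  have r0d : r ^+ d != 0 by rewrite gt_eqF// exprn_gt0.
  by rewrite !invfM !invrK; field.
(* The infimum in [Phi] is bounded by its value at the single centre [z], where U <= L/K and the
   Green bound applies. *)
- move=> U K K0 U0 KU; apply: (@le_trans _ _ (\int[mu]_(y in eball z (r / 4)) (U y)%:E)%E).
    by apply: ereal_inf_lbound; exists z.
  apply: (@le_trans _ _ (\int[mu]_(y in eball z (r / 4)) ((K^-1)%:E * (L y)%:E))%E).
    apply: le_integral_nonmeasurable => y yz; first by rewrite lee_fin ltW.
    by rewrite -EFinM lee_fin mulrC ler_pdivlMr// mulrC; exact/KU/Az.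
  rewrite ge0_integralZl; [|exact: measurable_eball|exact: mLE| |]; last 2 first.
  + by move=> y _; rewrite lee_fin ltW.
  + by rewrite lee_fin invr_ge0 ltW.
  rewrite [X in (_ <= X%:E)%E]mulrC EFinM; apply: lee_wpmul2l.
    by rewrite lee_fin invr_ge0 ltW.
  apply: (@le_trans _ _ (G * r `^ (D - alpha) * u x)%:E); last first.
    by rewrite lee_fin ler_wpM2r// ler_wpM2r ?(ltW rD)// lerDl.
  apply: (le_trans _ (green r x r0 (A2 _ xA))).
  by apply: subL; [exact: measurable_eball|exact: measurable_eball|exact: zB2].
Qed.

End annulus.

(** * Algebra of the exponents *)

Section limits_bounds.
Context {R : realType}.

Lemma limsup_infty_le (f : R -> \bar R) (C : \bar R) :
  (forall r, 1 <= r -> (f r <= C)%E) -> (limsup_infty f <= C)%E.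
Proof.
move=> fC; apply: (@le_trans _ _ (ereal_sup [set f r | r in [set r | 1 <= r]])).
  by apply: ereal_inf_lbound; exists [set r | 1 <= r] => //; exact: nbhs_pinfty_ge.
by apply: ge_ereal_sup => _ [r r1 <-]; exact: fC.
Qed.

Lemma liminf_infty_ge (f : R -> \bar R) (c : \bar R) :
  (forall r, 1 <= r -> (c <= f r)%E) -> (c <= liminf_infty f)%E.
Proof.
move=> fc; rewrite /liminf_infty /limf_einf leeNr.
by apply: limsup_infty_le => r /fc; rewrite leeN2.
Qed.

(** For s = 0 the inverse in the extended reals is +oo, so the bound includes this case. *)
Lemma inve_ge_expR (s : \bar R) (A : R) : (0 <= s)%E -> (s <= (expR A)%:E)%E ->
  ((expR (- A))%:E <= s^-1)%E.
Proof.
case: s => [s| |]//; rewrite !lee_fin inver expRN => s0 sA.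
case: eqP => [_|/eqP s1]; first exact: leey.
by rewrite lee_fin lef_pV2 ?posrE ?expR_gt0// lt_neqAle eq_sym s1.
Qed.

Lemma powR_expRln (r k : R) : 0 < r -> r `^ k = expR (k * ln r).
Proof. by move=> r0; rewrite /powR gt_eqF. Qed.

Lemma powR_le_expR (s A k : R) : 0 <= s -> s <= expR A -> 0 <= k ->
  s `^ k <= expR (k * A).
Proof.
move=> s0 sA k0; apply: (@le_trans _ _ (expR A `^ k)).
  by apply: ge0_ler_powR; rewrite ?nnegrE ?expR_ge0.
by rewrite powR_expRln ?expR_gt0// expRK.
Qed.

Lemma inve_powR (r k : R) : 0 < r -> ((r `^ k)%:E^-1 = (expR (- (k * ln r)))%:E)%E.
Proof.
by move=> r0; rewrite inver gt_eqF ?powR_gt0// powR_expRln// expRN.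
Qed.

End limits_bounds.

(** * Elimination of the minima *)

Section exponents.
Context {R : realType}.
Variables (D alpha beta p1 p2 q1 q2 k : R).
Hypotheses (p2_ge0 : 0 <= p2) (q1_ge0 : 0 <= q1).
Variables (r a b : R) (sU sV : \bar R).
Hypotheses (r_gt0 : 0 < r) (sU_ge0 : (0 <= sU)%E) (sV_ge0 : (0 <= sV)%E).
(** In the logarithms of the radius and of the two minima the estimates are linear: [A] and [B]
    bound the logarithms of [Phi U r] and [Phi V r], and each case below is one linear combination
    of them. *)
Let rho := ln r.
Let A := k + (D - alpha) * rho + (1 - p1) * a - p2 * b.
Let B := k + (D - beta) * rho + (1 - q2) * b - q1 * a.
Hypotheses (sUA : (sU <= (expR A)%:E)%E) (sVB : (sV <= (expR B)%:E)%E).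
Hypotheses (a_ge : - k - (D - alpha) * rho <= a) (a_le : a <= k).
Hypotheses (b_ge : - k - (D - beta) * rho <= b) (b_le : b <= k).

Let UV_le : (sU * sV <= (expR (A + B))%:E)%E.
Proof. by rewrite expRD EFinM; apply: lee_pmul. Qed.

(** In A + B the coefficients of a and b are 1 - p1 - q1 and 1 - p2 - q2, here nonpositive, so the
    lower bounds on a and b are inserted; the powers of r then cancel exactly.
    [sublinear_lower_bound] has the opposite signs and inserts the upper bounds. *)
Lemma superlinear_lower_bound : 1 <= p1 + q1 -> 1 <= p2 + q2 ->
  ((expR (- (k * (p1 + p2 + q1 + q2))))%:E <=
   (r `^ ((p1 + p2 + q1 + q2) * D)
         / (r `^ (alpha * (p1 + q1)) * r `^ (beta * (p2 + q2))))%:E * (sU * sV)^-1)%E.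
Proof.
move=> h1 h2; have UV0 : (0 <= sU * sV)%E by exact: mule_ge0.
apply: (@le_trans _ _ ((r `^ ((p1 + p2 + q1 + q2) * D)
         / (r `^ (alpha * (p1 + q1)) * r `^ (beta * (p2 + q2))))%:E *
         (expR (- (A + B)))%:E)%E); last first.
  apply: lee_wpmul2l; last exact: inve_ge_expR.
  by rewrite lee_fin divr_ge0// ?mulr_ge0 ?powR_ge0.
rewrite !powR_expRln// -/rho -expRD -expRN -expRD -EFinM -expRD lee_fin ler_expR.
have := ler_wpM2l (_ : 0 <= p1 + q1 - 1) a_ge; have := ler_wpM2l (_ : 0 <= p2 + q2 - 1) b_ge.
rewrite !subr_ge0 => /(_ h2) H2 /(_ h1) H1; rewrite /A /B; lra.
Qed.

Lemma sublinear_lower_bound : p1 + q1 <= 1 -> p2 + q2 <= 1 ->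
  ((expR (- (k * (4 - (p1 + p2 + q1 + q2)))))%:E <=
   ((r `^ (D - alpha))%:E / sU) * ((r `^ (D - beta))%:E / sV))%E.
Proof.
move=> h1 h2.
apply: (@le_trans _ _ (((r `^ (D - alpha))%:E * (expR (- A))%:E) *
    ((r `^ (D - beta))%:E * (expR (- B))%:E))%E); last first.
  apply: lee_pmul; rewrite -?EFinM ?lee_fin ?mulr_ge0 ?powR_ge0 ?expR_ge0//; rewrite EFinM;
    by apply: lee_wpmul2l; rewrite ?lee_fin ?powR_ge0//; exact: inve_ge_expR.
rewrite !powR_expRln// -/rho -!EFinM -!expRD lee_fin ler_expR.
have := ler_wpM2l (_ : 0 <= 1 - (p1 + q1)) a_le; have := ler_wpM2l (_ : 0 <= 1 - (p2 + q2)) b_le.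
rewrite !subr_ge0 => /(_ h2) H2 /(_ h1) H1; rewrite /A /B; lra.
Qed.

Lemma finite_UV : exists s t : R, [/\ sU = s%:E, sV = t%:E, 0 <= s <= expR A & 0 <= t <= expR B].
Proof.
move: sU_ge0 sV_ge0 sUA sVB; case: sU => [s| |]//; case: sV => [t| |]//.
by rewrite !lee_fin => *; exists s, t; split => //; apply/andP.
Qed.

(** The combination (1 - q2) A + p2 B is free of b and has a with coefficient -((p1 - 1)(1 - q2) +
    p2 q1), positive here, so a <= k is inserted. *)
Lemma eliminate_v_upper_neg : q2 < 1 -> (p1 - 1) * (1 - q2) + p2 * q1 < 0 ->
  ((sU `^ (1 - q2) / (r `^ ((D - alpha) * (1 - q2)))%:E)
         * (sV `^ p2 / (r `^ ((D - beta) * p2))%:E) <=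
   (expR (k * (1 - q2 + p2) - ((p1 - 1) * (1 - q2) + p2 * q1) * k))%:E)%E.
Proof.
move=> q21 th; have [s [t [-> -> /andP[s0 sA] /andP[t0 tB]]]] := finite_UV.
have q2' : 0 <= 1 - q2 by rewrite subr_ge0 ltW.
rewrite !poweR_EFin !inve_powR// -/rho -!EFinM lee_fin.
apply: (@le_trans _ _ (expR ((1 - q2) * A) * expR (- ((D - alpha) * (1 - q2) * rho)) *
  (expR (p2 * B) * expR (- ((D - beta) * p2 * rho))))).
  apply: ler_pM; rewrite ?mulr_ge0 ?powR_ge0 ?expR_ge0//;
    by apply: ler_wpM2r; rewrite ?expR_ge0//; exact: powR_le_expR.
rewrite -!expRD ler_expR.
have th' : 0 <= - ((p1 - 1) * (1 - q2) + p2 * q1) by rewrite oppr_ge0 ltW.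
have H := ler_wpM2l th' a_le; rewrite /A /B; lra.
Qed.

(** The same combination, now with a nonpositive coefficient of a. Inserting the lower bound on a
    costs a further power of r, which turns the exponent (D - alpha)(1 - q2) into (D - alpha)(p2 q1
    + p1 (1 - q2)). *)
Lemma eliminate_v_upper_nonneg : q2 < 1 -> 0 <= (p1 - 1) * (1 - q2) + p2 * q1 ->
  ((sV `^ p2 * sU `^ (1 - q2) / (r `^ ((D - beta) * p2))%:E)
         * ((r `^ ((D - alpha) * (p2 * q1 + p1 * (1 - q2))))%:E)^-1 <=
   (expR (k * (1 - q2 + p2) + ((p1 - 1) * (1 - q2) + p2 * q1) * k))%:E)%E.
Proof.
move=> q21 th; have [s [t [-> -> /andP[s0 sA] /andP[t0 tB]]]] := finite_UV.
have q2' : 0 <= 1 - q2 by rewrite subr_ge0 ltW.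
rewrite !poweR_EFin !inve_powR// -/rho -!EFinM lee_fin.
apply: (@le_trans _ _ (expR (p2 * B) * expR ((1 - q2) * A) * expR (- ((D - beta) * p2 * rho))
  * expR (- ((D - alpha) * (p2 * q1 + p1 * (1 - q2)) * rho)))).
  do 2 (apply: ler_wpM2r; first exact: expR_ge0).
  by apply: ler_pM; rewrite ?powR_ge0//; exact: powR_le_expR.
rewrite -!expRD ler_expR.
have H := ler_wpM2l th a_ge; rewrite /A /B; lra.
Qed.

(** Symmetrically, q1 A + (1 - p1) B is free of a; the sign of its coefficient of b decides between
    the upper bound, here, and the lower bound in the next lemma. *)
Lemma eliminate_u_upper_neg : p1 < 1 -> (1 - p1) * (q2 - 1) + p2 * q1 < 0 ->
  ((sU `^ q1 / (r `^ ((D - alpha) * q1))%:E)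
         * (sV `^ (1 - p1) / (r `^ ((D - beta) * (1 - p1)))%:E) <=
   (expR (k * (1 - p1 + q1) - ((1 - p1) * (q2 - 1) + p2 * q1) * k))%:E)%E.
Proof.
move=> p11 th; have [s [t [-> -> /andP[s0 sA] /andP[t0 tB]]]] := finite_UV.
have p1' : 0 <= 1 - p1 by rewrite subr_ge0 ltW.
rewrite !poweR_EFin !inve_powR// -/rho -!EFinM lee_fin.
apply: (@le_trans _ _ (expR (q1 * A) * expR (- ((D - alpha) * q1 * rho)) *
  (expR ((1 - p1) * B) * expR (- ((D - beta) * (1 - p1) * rho))))).
  apply: ler_pM; rewrite ?mulr_ge0 ?powR_ge0 ?expR_ge0//;
    by apply: ler_wpM2r; rewrite ?expR_ge0//; exact: powR_le_expR.
rewrite -!expRD ler_expR.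
have th' : 0 <= - ((1 - p1) * (q2 - 1) + p2 * q1) by rewrite oppr_ge0 ltW.
have H := ler_wpM2l th' b_le; rewrite /A /B; lra.
Qed.

Lemma eliminate_u_upper_nonneg : p1 < 1 -> 0 <= (1 - p1) * (q2 - 1) + p2 * q1 ->
  ((sU `^ q1 * sV `^ (1 - p1) / (r `^ ((D - alpha) * q1))%:E)
         * ((r `^ ((D - beta) * (p2 * q1 + q2 * (1 - p1))))%:E)^-1 <=
   (expR (k * (1 - p1 + q1) + ((1 - p1) * (q2 - 1) + p2 * q1) * k))%:E)%E.
Proof.
move=> p11 th; have [s [t [-> -> /andP[s0 sA] /andP[t0 tB]]]] := finite_UV.
have p1' : 0 <= 1 - p1 by rewrite subr_ge0 ltW.
rewrite !poweR_EFin !inve_powR// -/rho -!EFinM lee_fin.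
apply: (@le_trans _ _ (expR (q1 * A) * expR ((1 - p1) * B) * expR (- ((D - alpha) * q1 * rho))
  * expR (- ((D - beta) * (p2 * q1 + q2 * (1 - p1)) * rho)))).
  do 2 (apply: ler_wpM2r; first exact: expR_ge0).
  by apply: ler_pM; rewrite ?powR_ge0//; exact: powR_le_expR.
rewrite -!expRD ler_expR.
have H := ler_wpM2l th b_ge; rewrite /A /B; lra.
Qed.

End exponents.

(** * The system *)

Section system.
Context {R : realType} {d : nat}.
Hypothesis d_gt0 : (0 < d)%N.
Variables (alpha beta p1 p2 q1 q2 : R) (U V u v : 'rV[R]_d -> R).
Hypotheses (alpha02 : 0 < alpha < 2) (beta02 : 0 < beta < 2).
Hypotheses (U_gt0 : forall x, 0 < U x) (V_gt0 : forall x, 0 < V x).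
Hypotheses (p1_gt0 : 0 < p1) (q2_gt0 : 0 < q2) (p2_ge0 : 0 <= p2) (q1_ge0 : 0 <= q1).
Hypothesis sol : classical_solution alpha beta p1 p2 q1 q2 U V u v.
Local Notation D := (d%:R : R).

Lemma frac_limit_ge (s : R) (f W : 'rV[R]_d -> R) : 0 < s < 2 -> (forall x, 0 <= f x) ->
  classical_regularity s f -> (forall x, frac_lap s f x >= W x) ->
  forall x, W x / @frac_lap_cst R d s <= frac_limit s f x.
Proof.
move=> s02 f0 fr fW x; have c0 := frac_lap_cst_gt0 d_gt0 s02; have /andP[s0 s2] := s02.
by rewrite ler_pdivrMr// mulrC -(frac_lapE s0 s2 f0 fr).
Qed.

Lemma Phi_ge0 (W : 'rV[R]_d -> R) (r : R) : (forall x, 0 < W x) -> (0 <= Phi W r)%E.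
Proof.
move=> W0; apply: le_ereal_inf_tmp => _ [x _ <-].
by apply: integral_ge0 => y _; rewrite lee_fin ltW.
Qed.

(** Each right-hand side is nonnegative, so both components are superharmonic and the strong maximum
    principle applies to each separately. *)
Lemma positive_or_zero : (forall x, u x = 0) \/ (forall x, v x = 0) \/
  ((forall x, 0 < u x) /\ (forall x, 0 < v x)).
Proof.
have [ru rv uv0 Lu Lv] := sol.
have [u0 v0] : (forall x, 0 <= u x) /\ (forall x, 0 <= v x).
  by split=> x; have [] := uv0 x.
have ca := frac_lap_cst_gt0 d_gt0 alpha02; have cb := frac_lap_cst_gt0 d_gt0 beta02.
have [/andP[a0 a2] /andP[b0 b2]] := (alpha02, beta02).
have su x : 0 <= frac_limit alpha u x.
  apply: le_trans (frac_limit_ge alpha02 u0 ru Lu x).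
  by rewrite divr_ge0 ?(ltW ca)// !mulr_ge0 ?powR_ge0// ltW.
have sv x : 0 <= frac_limit beta v x.
  apply: le_trans (frac_limit_ge beta02 v0 rv Lv x).
  by rewrite divr_ge0 ?(ltW cb)// !mulr_ge0 ?powR_ge0// ltW.
have zero_or_pos (w : 'rV[R]_d -> R) : (forall x, 0 <= w x) ->
    (forall y, 0 < w y -> forall x, 0 < w x) ->
    (forall x, w x = 0) \/ (forall x, 0 < w x).
  move=> w0 wp; have [|/existsNP[y /eqP wy]] := pselect (forall x, w x = 0); first by left.
  by right; apply: (wp y); rewrite lt_neqAle eq_sym wy w0.
have [uz|up] := zero_or_pos u u0 (positive_everywhere d_gt0 a0 a2 u0 ru su).
  by left.
have [vz|vp] := zero_or_pos v v0 (positive_everywhere d_gt0 b0 b2 v0 rv sv).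
  by right; left.
by right; right.
Qed.

Hypotheses (u_gt0 : forall x, 0 < u x) (v_gt0 : forall x, 0 < v x).

(* [a] and [b] are the logarithms of the minima of [u] and [v] over the annulus of radius [r]. *)
Lemma system_bounds : exists2 k : R, 0 <= k & forall r, 1 <= r -> exists a b : R,
  [/\ (Phi U r <= (expR (k + (D - alpha) * ln r + (1 - p1) * a - p2 * b))%:E)%E,
      (Phi V r <= (expR (k + (D - beta) * ln r + (1 - q2) * b - q1 * a))%:E)%E,
      - k - (D - alpha) * ln r <= a <= k & - k - (D - beta) * ln r <= b <= k].
Proof.
have [ru rv _ Lu Lv] := sol.
have u0 x : 0 <= u x by exact: ltW.
have v0 x : 0 <= v x by exact: ltW.
have [/andP[a0 a2] /andP[b0 b2]] := (alpha02, beta02).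
have [ca ca0 Lu'] : exists2 ca : R, 0 < ca &
    forall x, U x * u x `^ p1 * v x `^ p2 / ca <= frac_limit alpha u x.
  exists (@frac_lap_cst R d alpha); first exact: frac_lap_cst_gt0.
  exact: frac_limit_ge.
have [cb cb0 Lv'] : exists2 cb : R, 0 < cb &
    forall x, V x * u x `^ q1 * v x `^ q2 / cb <= frac_limit beta v x.
  exists (@frac_lap_cst R d beta); first exact: frac_lap_cst_gt0.
  exact: frac_limit_ge.
have su x : 0 < frac_limit alpha u x.
  by apply: lt_le_trans (Lu' x); rewrite divr_gt0// !mulr_gt0 ?powR_gt0.
have sv x : 0 < frac_limit beta v x.
  by apply: lt_le_trans (Lv' x); rewrite divr_gt0// !mulr_gt0 ?powR_gt0.
have [c1 [C1 [c10 C10 E1]]] := annulus_estimate d_gt0 a0 a2 u0 ru (fun x => ltW (su x)) su.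
have [c2 [C2 [c20 C20 E2]]] := annulus_estimate d_gt0 b0 b2 v0 rv (fun x => ltW (sv x)) sv.
(* One constant absorbs the logarithms of all multiplicative constants, in either direction. *)
pose k := `|ln c1| + `|ln C1| + `|ln c2| + `|ln C2| + `|ln ca| + `|ln cb|.
have [[n1 n2] n3] := (normr_ge0 (ln c1), normr_ge0 (ln C1), normr_ge0 (ln c2)).
have [[n4 n5] n6] := (normr_ge0 (ln C2), normr_ge0 (ln ca), normr_ge0 (ln cb)).
have l1 := ler_norm (- ln c1); have l2 := ler_norm (ln C1).
have l3 := ler_norm (- ln c2); have l4 := ler_norm (ln C2).
have l5 := ler_norm (ln ca); have l6 := ler_norm (ln cb).
rewrite !normrN in l1 l3.
exists k => [|r r1]; first by rewrite /k; lra.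
have r0 : 0 < r by lra.
have [m [mu_le mu_ge mu_C muP]] := E1 r r1.
have [w [mv_le mv_ge mv_C mvP]] := E2 r r1.
have m0 : 0 < m by apply: lt_le_trans mu_ge; rewrite mulr_gt0 ?powR_gt0.
have w0 : 0 < w by apply: lt_le_trans mv_ge; rewrite mulr_gt0 ?powR_gt0.
exists (ln m), (ln w).
have lnE (z : R) : 0 < z -> z = expR (ln z) by move=> z0; rewrite lnK// posrE.
split.
(* The exponents are nonnegative, so on the annulus the nonlinearity is at least its value at the
   two minima; this is the factor [K] of [annulus_estimate]. *)
- apply: (le_trans (muP U (m `^ p1 * w `^ p2 / ca) _ U_gt0 _)).
  + by rewrite divr_gt0// mulr_gt0 ?powR_gt0.
  + move=> x xA; apply: le_trans (Lu' x).
    rewrite mulrAC ler_wpM2r ?invr_ge0 ?(ltW ca0)// mulrC mulrA.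
    apply: ler_pM; rewrite ?mulr_ge0 ?powR_ge0 ?(ltW (U_gt0 x))//.
      apply: ler_wpM2l; first exact: ltW.
      by apply: ge0_ler_powR; rewrite ?nnegrE ?(ltW p1_gt0) ?(ltW m0)//; exact: mu_le.
    by apply: ge0_ler_powR; rewrite ?nnegrE ?(ltW w0)//; exact: mv_le.
  + rewrite lee_fin {1}(lnE _ C10) {1}(lnE _ m0) {1}(lnE _ ca0) !powR_expRln//.
    rewrite -!expRD -!expRN -!expRD -!expRN -!expRD ler_expR /k; lra.
- apply: (le_trans (mvP V (m `^ q1 * w `^ q2 / cb) _ V_gt0 _)).
  + by rewrite divr_gt0// mulr_gt0 ?powR_gt0.
  + move=> x xA; apply: le_trans (Lv' x).
    rewrite mulrAC ler_wpM2r ?invr_ge0 ?(ltW cb0)// mulrC mulrA.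
    apply: ler_pM; rewrite ?mulr_ge0 ?powR_ge0 ?(ltW (V_gt0 x))//.
      apply: ler_wpM2l; first exact: ltW.
      by apply: ge0_ler_powR; rewrite ?nnegrE ?(ltW m0)//; exact: mu_le.
    by apply: ge0_ler_powR; rewrite ?nnegrE ?(ltW q2_gt0) ?(ltW w0)//; exact: mv_le.
  + rewrite lee_fin {1}(lnE _ C20) {1}(lnE _ w0) {1}(lnE _ cb0) !powR_expRln//.
    rewrite -!expRD -!expRN -!expRD -!expRN -!expRD ler_expR /k; lra.
- move: mu_ge mu_C; rewrite {1}(lnE _ c10) {1 2}(lnE _ m0) {1}(lnE _ C10) powR_expRln//.
  by rewrite -expRD !ler_expR => h1 h2; apply/andP; split; rewrite /k; lra.
- move: mv_ge mv_C; rewrite {1}(lnE _ c20) {1 2}(lnE _ w0) {1}(lnE _ C20) powR_expRln//.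
  by rewrite -expRD !ler_expR => h1 h2; apply/andP; split; rewrite /k; lra.
Qed.

End system.

Theorem theorem2p3 (R : realType) (d : nat) (d_ge1 : (1 <= d)%N)
  (alpha beta : R)
  (alpha_range : 0 < alpha < Num.min 2 d%:R)
  (beta_range : 0 < beta < Num.min 2 d%:R)
  (U V : 'rV[R]_d -> R)
  (U_gt0 : forall x, 0 < U x) (V_gt0 : forall x, 0 < V x)
  (U_meas : lebesgue_measurable_fun U) (V_meas : lebesgue_measurable_fun V)
  (p1 p2 q1 q2 : R)
  (p1_gt0 : 0 < p1) (q2_gt0 : 0 < q2) (p2_ge0 : 0 <= p2) (q1_ge0 : 0 <= q1) :
  [\/ (* (i) *)
      1 <= Num.min (p1 + q1) (p2 + q2) /\
      liminf_infty (fun r : R =>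
        (r `^ ((p1 + p2 + q1 + q2) * d%:R)
         / (r `^ (alpha * (p1 + q1)) * r `^ (beta * (p2 + q2))))%:E
        * (Phi U r * Phi V r)^-1)%E = 0%E,
      (* (ii) *)
      q2 < 1 /\
      ((p1 - 1) * (1 - q2) + p2 * q1 < 0 /\
       limsup_infty (fun r : R =>
         (Phi U r `^ (1 - q2) / (r `^ ((d%:R - alpha) * (1 - q2)))%:E)
         * (Phi V r `^ p2 / (r `^ ((d%:R - beta) * p2))%:E))%E = +oo%E
       \/
       0 <= (p1 - 1) * (1 - q2) + p2 * q1 /\
       limsup_infty (fun r : R =>
         (Phi V r `^ p2 * Phi U r `^ (1 - q2) / (r `^ ((d%:R - beta) * p2))%:E)
         * ((r `^ ((d%:R - alpha) * (p2 * q1 + p1 * (1 - q2))))%:E)^-1)%E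
         = +oo%E),
      (* (iii) *)
      p1 < 1 /\
      ((1 - p1) * (q2 - 1) + p2 * q1 < 0 /\
       limsup_infty (fun r : R =>
         (Phi U r `^ q1 / (r `^ ((d%:R - alpha) * q1))%:E)
         * (Phi V r `^ (1 - p1) / (r `^ ((d%:R - beta) * (1 - p1)))%:E))%E
         = +oo%E
       \/
       0 <= (1 - p1) * (q2 - 1) + p2 * q1 /\
       limsup_infty (fun r : R =>
         (Phi U r `^ q1 * Phi V r `^ (1 - p1) / (r `^ ((d%:R - alpha) * q1))%:E)
         * ((r `^ ((d%:R - beta) * (p2 * q1 + q2 * (1 - p1))))%:E)^-1)%E
         = +oo%E) |
      (* (iv) *)
      Num.max (p1 + q1) (p2 + q2) <= 1 /\
      liminf_infty (fun r : R =>
        ((r `^ (d%:R - alpha))%:E / Phi U r)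
        * ((r `^ (d%:R - beta))%:E / Phi V r))%E = 0%E] ->
  forall u v : 'rV[R]_d -> R,
    classical_solution alpha beta p1 p2 q1 q2 U V u v ->
    (forall x, u x = 0) \/ (forall x, v x = 0).
Proof.
move=> cases u v sol.
have alpha02 : 0 < alpha < 2.
  by move: alpha_range; rewrite lt_min => /andP[-> /andP[]].
have beta02 : 0 < beta < 2.
  by move: beta_range; rewrite lt_min => /andP[-> /andP[]].
have [|[|[u_gt0 v_gt0]]] := positive_or_zero d_ge1 alpha02 beta02 U_gt0 V_gt0 sol;
  [by left|by right|exfalso].
have [k k0 bounds] := system_bounds d_ge1 alpha02 beta02 U_gt0 V_gt0
  p1_gt0 q2_gt0 p2_ge0 q1_ge0 sol u_gt0 v_gt0.
have PU r : (0 <= Phi U r)%E by exact: Phi_ge0.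
have PV r : (0 <= Phi V r)%E by exact: Phi_ge0.
have r_gt0 (r : R) : 1 <= r -> 0 < r by exact: lt_le_trans.
have lower (c : R) f : (forall r, 1 <= r -> ((expR c)%:E <= f r)%E) ->
    liminf_infty f = 0%E -> False.
  by move=> /liminf_infty_ge + f0; rewrite f0 lee_fin leNgt expR_gt0.
have upper (c : R) f : (forall r, 1 <= r -> (f r <= (expR c)%:E)%E) ->
    limsup_infty f = +oo%E -> False.
  by move=> /limsup_infty_le + fy; rewrite fy leye_eq.
case: cases => [[h]|[q21 [[h]|[h]]]|[p11 [[h]|[h]]]|[h]].
- move: h; rewrite le_min => /andP[h1 h2]; apply: lower => r r1.
  have [a [b [Ua Vb /andP[a1 a2] /andP[b1 b2]]]] := bounds r r1.
  exact: (superlinear_lower_bound (r_gt0 r r1) (PU r) (PV r) Ua Vb a1 b1 h1 h2).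
- apply: upper => r r1; have [a [b [Ua Vb /andP[a1 a2] /andP[b1 b2]]]] := bounds r r1.
  exact: (eliminate_v_upper_neg p2_ge0 (r_gt0 r r1) (PU r) (PV r) Ua Vb a2 q21 h).
- apply: upper => r r1; have [a [b [Ua Vb /andP[a1 a2] /andP[b1 b2]]]] := bounds r r1.
  exact: (eliminate_v_upper_nonneg p2_ge0 (r_gt0 r r1) (PU r) (PV r) Ua Vb a1 q21 h).
- apply: upper => r r1; have [a [b [Ua Vb /andP[a1 a2] /andP[b1 b2]]]] := bounds r r1.
  exact: (eliminate_u_upper_neg q1_ge0 (r_gt0 r r1) (PU r) (PV r) Ua Vb b2 p11 h).
- apply: upper => r r1; have [a [b [Ua Vb /andP[a1 a2] /andP[b1 b2]]]] := bounds r r1.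
  exact: (eliminate_u_upper_nonneg q1_ge0 (r_gt0 r r1) (PU r) (PV r) Ua Vb b1 p11 h).
- move: h; rewrite ge_max => /andP[h1 h2]; apply: lower => r r1.
  have [a [b [Ua Vb /andP[a1 a2] /andP[b1 b2]]]] := bounds r r1.
  exact: (sublinear_lower_bound (r_gt0 r r1) (PU r) (PV r) Ua Vb a2 b2 h1 h2).
Qed.
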